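(* Let $p$ be as in the context, fix positive $a_l<a_r$ and consider the Riemann problem with data $\bar u_l,\bar u_r\in A_0$. Define $$l'=R\left(a_r;\hat\varphi_l(\bar u_l),L_1\left(\hat\varphi_l(\bar u_l);\bar u_l\right)\right),\qquad l''=R\left(a_r;\check\varphi_l(\bar u_l),L_1\left(\check\varphi_l(\bar u_l);\bar u_l\right)\right),$$ where $R$ is the function defined in the context. A necessary and sufficient condition for existence and uniqueness of an (S)-solution to the Riemann problem, attaining values in $A_0$, is $$\left\{\begin{array}{rcl} a_l\,L_1\left(\hat\varphi_l(\bar u_l);\bar u_l\right)&\ge&a_r\,L_2^-\left(l';\bar u_r\right),\\ a_l\,L_1\left(\check\varphi_l(\bar u_l);\bar u_l\right)&\le&a_r\,L_2^-\left(l'';\bar u_r\right). \end{array}\right.$$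
   Context: Pressure: $p\in C^2(\mathbb{R}^+;\mathbb{R}^+)$, $\mathbb{R}^+=[0,+\infty[$, with $p'(\rho)>0$ and $p''(\rho)\ge0$ for all $\rho>0$. Write $u=(\rho,q)$, $c(\rho)=\sqrt{p'(\rho)}$, $P(u)=\frac{q^2}{\rho}+p(\rho)$, $\lambda_1(u)=\frac q\rho-c(\rho)$, $\lambda_2(u)=\frac q\rho+c(\rho)$. Subsonic region: $A_0=\{u\in\,]0,+\infty[\times\mathbb{R}\colon\lambda_1(u)<0<\lambda_2(u)\}$. Lax curves, for $u_o=(\rho_o,q_o)$ with $\rho_o>0$: the forward 1-Lax curve is $L_1(\rho;u_o)=\frac{\rho}{\rho_o}q_o-\rho\int_{\rho_o}^\rho\frac{c(r)}r\,dr$ if $\rho\le\rho_o$, and $L_1(\rho;u_o)=\frac{\rho}{\rho_o}q_o-\sqrt{\frac\rho{\rho_o}(\rho-\rho_o)(p(\rho)-p(\rho_o))}$ if $\rho\ge\rho_o$. The reversed 2-Lax curve is $L_2^-(\rho;u_o)=\frac{\rho}{\rho_o}q_o+\rho\int_{\rho_o}^\rho\frac{c(r)}r\,dr$ if $\rho\le\rho_o$, and $L_2^-(\rho;u_o)=\frac{\rho}{\rho_o}q_o+\sqrt{\frac\rho{\rho_o}(\rho-\rho_o)(p(\rho)-p(\rho_o))}$ if $\rho\ge\rho_o$. For $\bar u\in A_0$, the densities $\check\varphi_l(\bar u),\hat\varphi_l(\bar u),\check\varphi_r(\bar u),\hat\varphi_r(\bar u)$ are the $\rho$-components of the intersections of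 the curves $\rho\mapsto(\rho,L_1(\rho;\bar u))$ (index $l$) and $\rho\mapsto(\rho,L_2^-(\rho;\bar u))$ (index $r$) with the boundary of $A_0$; they are uniquely determined by $$\lambda_2\left(\check\varphi_r,L_2^-(\check\varphi_r;\bar u)\right)=0,\quad\lambda_2\left(\check\varphi_l,L_1(\check\varphi_l;\bar u)\right)=0,\quad\lambda_1\left(\hat\varphi_r,L_2^-(\hat\varphi_r;\bar u)\right)=0,\quad\lambda_1\left(\hat\varphi_l,L_1(\hat\varphi_l;\bar u)\right)=0,$$ all evaluated at $\bar u$. The function $R(\cdot;\rho_l,q_l)$, which depends also on $a_l$, is the solution $a\mapsto R(a)$ of the Cauchy problem $$\frac{d}{da}R(a)=\frac{R(a)}{a}\,\frac{a_l^2q_l^2}{a^2p'(R(a))R^2(a)-a_l^2q_l^2},\qquad R(a_l)=\rho_l .$$ Together with $Q(a)=\frac{a_l}{a}q_l$, this is a rewriting of $\frac{d}{da}Q=-Q/a$, $\frac{d}{da}[aP(R,Q)]=p(R)$, $Q(a_l)=q_l$, $R(a_l)=\rho_l$. Riemann problem: $\partial_t\rho+\partial_xq=0$, $\partial_tq+\partial_x(q^2/\rho+p(\rho))=0$, with $u(0,x)=\bar u_l$ for $x<0$ and $u(0,x)=\bar u_r$ for $x>0$. Given a junction function $\Phi$, a weak $\Phi$-solution is a map $u\in C^0(\mathbb{R}^+;L^1_{loc}(\mathbb{R};]0,+\infty[\times\mathbb{R}))$, with $u(t)$ of bounded variation for a.e. $t\in\mathbb{R}^+$, such that: (1) $\int_{\mathbb{R}^+}\int_{\mathbb{R}}\left((\rho,q)\,\partial_t\phi+(q,P(\rho,q))\,\partial_x\phi\right)dx\,dt=0$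 for all $\phi\in C^1_c(]0,+\infty[\times\mathbb{R};\mathbb{R})$ whose support does not intersect $x=0$; (2) $u(0,x)$ coincides with the Riemann initial datum for a.e. $x\in\mathbb{R}$; (3) for a.e. $t\in\mathbb{R}^+$, $\Phi(a_l,u(t,0-);a_r,u(t,0+))=0$. Solutions to Riemann problems are understood to be made of standard Lax waves: on $x<0$, $u$ is a (possibly trivial) Lax wave of the first family joining $\bar u_l$ to the trace $u(t,0-)$, so $q(t,0-)=L_1(\rho(t,0-);\bar u_l)$; on $x>0$, $u$ is a (possibly trivial) Lax wave of the second family joining the trace $u(t,0+)$ to $\bar u_r$, so $q(t,0+)=L_2^-(\rho(t,0+);\bar u_r)$. An (S)-solution is a weak $\Phi$-solution for the junction condition $a_lq_l=a_rq_r$ and $a_rP(\rho_r,q_r)=a_lP(\rho_l,q_l)+\int_{a_l}^{a_r}p\left(R(\alpha;\rho_l,q_l)\right)d\alpha$ on the traces $(\rho_l,q_l)=u(t,0-)$, $(\rho_r,q_r)=u(t,0+)$.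
   Formalization: ''Values in A_0'' is read as values a.e. in the closure of A_0, since with equality in the second condition the solution takes a sonic state; that the densities φ are uniquely determined on A_0 is an explicit assumption on p; R from sonic data is the subsonic branch. *)

(* Defs.v *)
(* Built on MathComp-Analysis: the reals are an arbitrary [R : realType]. *)
From HB Require Import structures.
From mathcomp Require Import all_boot all_order all_algebra.
From mathcomp Require Import all_classical all_reals all_analysis.

Set Implicit Arguments.
Unset Strict Implicit.
Unset Printing Implicit Defensive.

Import Order.TTheory GRing.Theory Num.Theory numFieldNormedType.Exports.

Local Open Scope classical_set_scope.
Local Open Scope ring_scope.

Section PSystem.
Context {R : realType}.

Local Notation mu := (@lebesgue_measure R).

(* A state u = (rho, q) is a pair: u.1 is the density, u.2 the momentum. *)
Local Notation state := (R * R)%type.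

(* p is C^2 on the closed half-line: it is continuous there and its first two
   derivatives on ]0, +oo[ extend continuously up to 0; by the mean value
   theorem the extensions are the one-sided derivatives at 0. *)
Definition C2_Rplus (p : R -> R) : Prop :=
  exists p1 p2 : R -> R,
  [/\ {within `[0, +oo[%classic, continuous p},
      {within `[0, +oo[%classic, continuous p1},
      {within `[0, +oo[%classic, continuous p2},
      forall r : R, 0 < r -> is_derive r 1 p (p1 r) &
      forall r : R, 0 < r -> is_derive r 1 p1 (p2 r)].

Definition pressure (p : R -> R) : Prop :=
  [/\ C2_Rplus p,
      forall r : R, 0 <= r -> 0 <= p r,
      forall r : R, 0 < r -> 0 < derive1 p r &
      forall r : R, 0 < r -> 0 <= derive1 (derive1 p) r].

Definition c (p : R -> R) (r : R) : R := Num.sqrt (derive1 p r).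

Definition P (p : R -> R) (u : state) : R := u.2 ^+ 2 / u.1 + p u.1.

Definition lambda1 (p : R -> R) (u : state) : R := u.2 / u.1 - c p u.1.
Definition lambda2 (p : R -> R) (u : state) : R := u.2 / u.1 + c p u.1.

Definition A0 (p : R -> R) : set state :=
  [set u | [/\ 0 < u.1, lambda1 p u < 0 & 0 < lambda2 p u]].

(* Oriented integral, with int_a^b = - int_b^a. *)
Definition oint (a b : R) (f : R -> R) : R :=
  if a <= b then \int[mu]_(x in `[a, b]) f x
  else - \int[mu]_(x in `[b, a]) f x.

Definition L1 (p : R -> R) (uo : state) (r : R) : R :=
  if r <= uo.1 then
    r / uo.1 * uo.2 - r * oint uo.1 r (fun s => c p s / s)
  else
    r / uo.1 * uo.2 - Num.sqrt (r / uo.1 * (r - uo.1) * (p r - p uo.1)).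

Definition L2m (p : R -> R) (uo : state) (r : R) : R :=
  if r <= uo.1 then
    r / uo.1 * uo.2 + r * oint uo.1 r (fun s => c p s / s)
  else
    r / uo.1 * uo.2 + Num.sqrt (r / uo.1 * (r - uo.1) * (p r - p uo.1)).

Definition is_phi_hat_l (p : R -> R) (u : state) (r : R) : Prop :=
  0 < r /\ lambda1 p (r, L1 p u r) = 0.
Definition is_phi_check_l (p : R -> R) (u : state) (r : R) : Prop :=
  0 < r /\ lambda2 p (r, L1 p u r) = 0.

Definition phi_hat_l (p : R -> R) (u : state) : R := get (is_phi_hat_l p u).
Definition phi_check_l (p : R -> R) (u : state) : R :=
  get (is_phi_check_l p u).

(* The densities above are uniquely determined on A0.  This is not a
   consequence of [pressure p] alone: for rapidly growing p the 1-Lax curve may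
   fail to meet lambda2 = 0.  The analogous property of L2m is equivalent, by
   the reflection q |-> - q, and is therefore not repeated. *)
Definition phi_well_defined (p : R -> R) : Prop :=
  forall u : state, A0 p u ->
    (exists! r, is_phi_hat_l p u r) /\ (exists! r, is_phi_check_l p u r).

(* r is the solution of the Cauchy problem for the density with datum ul at
   al, on [al, +oo[.  If ul is sonic (lambda1 = 0 or lambda2 = 0) then the
   right-hand side of the equation is singular at al and two continuous
   solutions start from ul; the positivity of the denominator for a > al
   selects the subsonic one.  For a subsonic ul this positivity holds
   automatically, and so does the equation at al, by continuity. *)
Definition is_profile (p : R -> R) (al : R) (ul : state) (r : R -> R) : Prop :=
  [/\ r al = ul.1,
      {within `[al, +oo[%classic, continuous r} &
      forall a : R, al < a ->
        [/\ 0 < r a,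
            0 < a ^+ 2 * derive1 p (r a) * r a ^+ 2 - al ^+ 2 * ul.2 ^+ 2 &
            is_derive a 1 r
              (r a / a * (al ^+ 2 * ul.2 ^+ 2 /
                (a ^+ 2 * derive1 p (r a) * r a ^+ 2 - al ^+ 2 * ul.2 ^+ 2)))]].

(* R(a; rho_l, q_l), meaningful for a >= al and ul in the closure of A0. *)
Definition profile (p : R -> R) (al : R) (ul : state) : R -> R :=
  xget (fun=> 0) (is_profile p al ul).

(* Junction function: Phi (al, ul; ar, ur) = 0 iff
   al ql = ar qr and ar P(ur) = al P(ul) + int_al^ar p(R(alpha; ul)). *)
Definition Phi_S (p : R -> R) (al : R) (ul : state) (ar : R) (ur : state) :
    state :=
  (ar * ur.2 - al * ul.2,
   ar * P p ur - (al * P p ul + oint al ar (fun a => p (profile p al ul a)))).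

Definition riemann_datum (ul ur : state) (x : R) : state :=
  if x < 0 then ul else ur.

(* C^1_c(]0, +oo[ x R), with support disjoint from the line x = 0; the
   arguments are ordered as (t, x). *)
Definition test_function (phi : R * R -> R) : Prop :=
  [/\ forall z, derivable phi z (1, 0) /\ derivable phi z (0, 1),
      continuous ('D_(1, 0) phi),
      continuous ('D_(0, 1) phi),
      compact (closure [set z | phi z != 0]) &
      closure [set z | phi z != 0] `<=` [set z | 0 < z.1 /\ z.2 != 0]].

Definition finite_TV (f : R -> R) : Prop :=
  exists M : R, forall a b : R, a <= b -> (total_variation a b f <= M%:E)%E.

(* u in C^0(R^+; L^1_loc(R; ]0, +oo[ x R)) *)
Definition C0_L1loc (u : R -> R -> state) : Prop :=
  [/\ forall t : R, 0 <= t ->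
        locally_integrable [set: R] (fun x => (u t x).1) /\
        locally_integrable [set: R] (fun x => (u t x).2),
      forall t : R, 0 <= t -> {ae mu, forall x, 0 < (u t x).1} &
      forall M t0 : R, 0 <= t0 ->
        (\int[mu]_(x in `[(- M)%R, M]) (`|u t x - u t0 x|%R)%:E)%E
          @[t --> within [set t | 0 <= t] (nbhs t0)] --> 0%E].

(* The scalar weak equation d_t f + d_x g = 0 away from x = 0. *)
Definition weak_equation (f g : R -> R -> R) : Prop :=
  forall phi : R * R -> R, test_function phi ->
  let F := fun z : R * R =>
    f z.1 z.2 * 'D_(1, 0) phi z + g z.1 z.2 * 'D_(0, 1) phi z in
  (mu \x mu)%E.-integrable (`[0, +oo[ `*` [set: R]) (fun z => (F z)%:E) /\
  (\int[(mu \x mu)%E]_(z in `[0%R, +oo[ `*` [set: R]) (F z)%:E)%E = 0%E.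

(* u t is a representative for which the total variation and the traces
   u(t, 0-), u(t, 0+) can be read pointwise. *)
Definition weak_Phi_solution (p : R -> R)
    (Phi : R -> state -> R -> state -> state)
    (al ar : R) (ubl ubr : state) (u : R -> R -> state) : Prop :=
  [/\ C0_L1loc u,
      {ae mu, forall t, 0 <= t ->
        finite_TV (fun x => (u t x).1) /\ finite_TV (fun x => (u t x).2)},
      weak_equation (fun t x => (u t x).1) (fun t x => (u t x).2) /\
      weak_equation (fun t x => (u t x).2) (fun t x => P p (u t x)),
      {ae mu, forall x, u 0 x = riemann_datum ubl ubr x} &
      {ae mu, forall t, 0 <= t -> exists ul ur : state,
        [/\ u t x @[x --> 0^'-] --> ul, u t x @[x --> 0^'+] --> ur &
            Phi al ul ar ur = (0, 0)]}].

(* w, as a function of x / t, is the Lax wave of the first family with left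
   state ub and right state ul: a centered rarefaction if ul.1 <= ub.1 (trivial
   if ul = ub), a Lax shock otherwise. *)
Definition lax1_wave (p : R -> R) (ub ul : state) (w : R -> state) : Prop :=
  [/\ 0 < ul.1,
      ul.2 = L1 p ub ul.1,
      ul.1 <= ub.1 -> forall xi : R,
        [/\ xi < lambda1 p ub -> w xi = ub,
            lambda1 p ub <= xi <= lambda1 p ul ->
              exists r : R, [/\ ul.1 <= r <= ub.1,
                w xi = (r, L1 p ub r) & lambda1 p (r, L1 p ub r) = xi] &
            lambda1 p ul < xi -> w xi = ul] &
      ub.1 < ul.1 -> forall xi : R,
        (xi < (ul.2 - ub.2) / (ul.1 - ub.1) -> w xi = ub) /\
        ((ul.2 - ub.2) / (ul.1 - ub.1) < xi -> w xi = ul)].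

(* The same for the second family, with left state ur and right state ub. *)
Definition lax2_wave (p : R -> R) (ur ub : state) (w : R -> state) : Prop :=
  [/\ 0 < ur.1,
      ur.2 = L2m p ub ur.1,
      ur.1 <= ub.1 -> forall xi : R,
        [/\ xi < lambda2 p ur -> w xi = ur,
            lambda2 p ur <= xi <= lambda2 p ub ->
              exists r : R, [/\ ur.1 <= r <= ub.1,
                w xi = (r, L2m p ub r) & lambda2 p (r, L2m p ub r) = xi] &
            lambda2 p ub < xi -> w xi = ub] &
      ub.1 < ur.1 -> forall xi : R,
        (xi < (ub.2 - ur.2) / (ub.1 - ur.1) -> w xi = ur) /\
        ((ub.2 - ur.2) / (ub.1 - ur.1) < xi -> w xi = ub)].

(* Requiring the end states to be the traces at x = 0 forces the waves to have
   nonpositive, resp. nonnegative, speed. *)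
Definition made_of_lax_waves (p : R -> R) (ubl ubr : state)
    (u : R -> R -> state) : Prop :=
  exists (ul ur : state) (wl wr : R -> state),
  [/\ lax1_wave p ubl ul wl,
      lax2_wave p ur ubr wr &
      forall t : R, 0 < t ->
        [/\ u t x @[x --> 0^'-] --> ul,
            u t x @[x --> 0^'+] --> ur,
            forall x : R, x < 0 -> u t x = wl (x / t) &
            forall x : R, 0 < x -> u t x = wr (x / t)]].

Definition S_solution (p : R -> R) (al ar : R) (ubl ubr : state)
    (u : R -> R -> state) : Prop :=
  weak_Phi_solution p (Phi_S p) al ar ubl ubr u /\
  made_of_lax_waves p ubl ubr u.

(* The closure is needed for the non-strict inequalities of the criterion:
   when the second one is an equality, the left trace is the sonic state of
   density phi_check_l, which u attains on a set of positive measure. *)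
Definition attains_values_in_A0 (p : R -> R) (u : R -> R -> state) : Prop :=
  forall t : R, 0 <= t -> {ae mu, forall x, closure (A0 p) (u t x)}.

(* Uniqueness is understood in C^0(R^+; L^1_loc), i.e. up to null sets. *)
Definition exists_unique_solution (S : (R -> R -> state) -> Prop) : Prop :=
  exists2 u, S u &
    forall v, S v -> forall t : R, 0 <= t -> {ae mu, forall x, v t x = u t x}.

End PSystem.

(* Main.v *)
(* The density along a stationary flow solves an ODE that is singular at sonic
   states; it has the first integral (Bernoulli energy) m^2 / (2 a^2 rho^2) + H rho
   with H' = p' / rho and m = a q, so that the profile is the subsonic root of an
   algebraic equation, even for a sonic datum.  Write transmitted r for the
   density at ar of the flow issued from the point of density r of the 1-Lax
   curve of the left datum: it is monotone in r, and |al L1 r| < ar rho c(rho) at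
   rho = transmitted r keeps the right trace subsonic, where L2m increases.  So
   r |-> al L1 r - ar L2m (transmitted r) vanishes at most once between phi_hat_l
   and phi_check_l, and does so exactly when it is nonnegative at the first and
   nonpositive at the second.
   A zero gives a solution by gluing two centered waves; a rarefaction is a weak
   solution because it is a superposition (layer-cake) of infinitesimal fronts
   satisfying the Rankine-Hugoniot conditions. *)
Require Import Defs.
From HB Require Import structures.
From mathcomp Require Import all_boot all_order all_algebra.
From mathcomp Require Import all_classical all_reals all_analysis.
From mathcomp Require Import measurable_realfun ring lra.
Set Implicit Arguments.
Unset Strict Implicit.
Unset Printing Implicit Defensive.
Import Order.TTheory GRing.Theory Num.Theory numFieldNormedType.Exports.
Local Open Scope classical_set_scope.
Local Open Scope ring_scope.

(** * The weak equation and moving fronts *)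

Section plane_measure.
Context {R : realType}.
Local Notation mu := (@lebesgue_measure R).

(** The monotony of [transmitted] compares two algebraic equations with different fluxes, so it has
    two inputs: the Bernoulli value is nondecreasing along the Lax curve from [phi_hat_l] on, and
    the effect of a larger flux is compensated by the gain of [H], because the starting point is
    subsonic. Convexity of [p] enters mainly through chord slopes on the shock branch. The
    hypothesis [phi_well_defined] speaks only of single roots; the sign of [lambda2] along the curve
    is recovered from it by letting the momentum of the datum vary at fixed density. Where the
    transmitted density might leave the range in which [L2m] increases, monotony is replaced by the
    bound [L2m <= - (r * c)], which is incompatible with a subsonic flux. The second family is never
    treated by itself: reversing the momentum turns it into the first. Uniqueness reduces to the
    traces, since the end states determine a Lax wave up to one value of x / t. *)

Lemma open_measurable_prod (A : set (R * R)) : open A -> measurable A.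
Proof.
move=> oA.
(* Squares with rational centre and half-width; those not contained in [A] are replaced by [set0],
   so that the union runs over a countable type. *)
pose B (q : rat * rat * rat) : set (R * R) :=
  `]ratr q.1.1 - ratr q.2, ratr q.1.1 + ratr q.2[%classic `*`
  `]ratr q.1.2 - ratr q.2, ratr q.1.2 + ratr q.2[%classic.
pose F q := if `[< B q `<=` A >] then B q else set0.
have -> : A = \bigcup_q F q.
  apply/seteqP; split => [z Az|z [q _]]; last first.
    by rewrite /F; case: asboolP => // + Bz; exact.
  have [e /= e0 eA] : exists2 e : R, 0 < e & ball z e `<=` A.
    by apply/nbhs_ballP; exact: open_nbhs_nbhs.
  have e3 : 0 < e / 3 by rewrite divr_gt0.
  (* The half-width is taken between e/3, the distance allowed from [z] to the centre, and e/2: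
     since e/3 + e/2 < e, the square stays in the ball. *)
  have e32 : e / 3 < e / 2 by rewrite ltr_pM2l// ltf_pV2 ?posrE// ltr_nat.
  have [r] := rat_in_itvoo e32; rewrite in_itv/= => /andP[r1 r2].
  have tq (t : R) : exists q : rat, t - e / 3 < ratr q < t + e / 3.
    have [q] : exists q : rat, ratr q \in `]t - e / 3, t + e / 3[.
      by apply: rat_in_itvoo; lra.
    by rewrite in_itv/=; exists q.
  have [q1 /andP[q11 q12]] := tq z.1.
  have [q2 /andP[q21 q22]] := tq z.2.
  exists (q1, q2, r) => //; rewrite /F.
  have BA : B (q1, q2, r) `<=` A.
    move=> [y1 y2] [/=]; rewrite !in_itv/= => /andP[y11 y12] /andP[y21 y22].
    apply: eA; split => /=; rewrite /ball/= lter_norml; apply/andP; split; lra.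
  case: asboolP => // _; split => /=; rewrite in_itv/=; apply/andP; split; lra.
apply: countable_bigcupT_measurable => // q; rewrite /F.
by case: asboolP => // _; apply: measurableX; exact: measurable_itv.
Qed.

Lemma continuous_measurable_prod (f : R * R -> R) :
  continuous f -> measurable_fun setT f.
Proof.
move=> cf; apply: (measurability _ (RGenOpens.measurableE R)).
move=> _ [_ [a [b ->]] <-]; rewrite setTI.
apply: open_measurable_prod.
by apply: open_comp; [move=> x _; exact: cf|exact: interval_open].
Qed.

Lemma bounded_support_integrable d (T : measurableType d)
    (nu : {measure set T -> \bar R}) (f : T -> R) (A : set T) (M : R) :
  measurable A -> (nu A < +oo)%E -> measurable_fun setT f ->
  (forall x, `|f x| <= M) -> (forall x, ~ A x -> f x = 0) ->
  nu.-integrable setT (EFin \o f).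
Proof.
move=> mA nuA mf fM f0.
have -> : EFin \o f = (EFin \o f) \_ A.
  apply/funext => x; rewrite patchE; case: ifPn => //.
  by rewrite notin_setE => /f0/= ->.
apply/(integrable_mkcond _ mA).
apply: measurable_bounded_integrable => //; first exact: measurable_funS mf.
exists M; split; first exact: num_real.
by move=> x Mx y _ /=; rewrite (le_trans (fM y))// ltW.
Qed.

Lemma lebesgue_measure_shift (a : R) (A : set R) : measurable A ->
  pushforward mu (fun x : measurableTypeR R => x + a : measurableTypeR R) A = mu A.
Proof.
have ms : measurable_fun setT (fun x : measurableTypeR R => x + a : measurableTypeR R).
  exact: measurable_funD.
move=> mA; apply/esym; apply: lebesgue_measure_unique => //= _ [[b c]] _ <-.
rewrite /pushforward (_ : _ @^-1` _ = `](b - a), (c - a)]%classic).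
  by rewrite !lebesgue_measure_itv/= !lte_fin ltrD2r; case: ifP => // _; rewrite -!EFinB; congr _%:E; ring.
by apply/seteqP; split => x /=; rewrite !in_itv/= ltrBlDr lerBrDr.
Qed.

Lemma integral_shift (a : R) (f : R -> R) : measurable_fun setT f ->
  mu.-integrable setT (fun x => (f (x + a))%:E) ->
  (\int[mu]_x (f x)%:E = \int[mu]_x (f (x + a))%:E)%E.
Proof.
move=> mf fi.
have ms : measurable_fun setT (fun x : measurableTypeR R => x + a : measurableTypeR R).
  exact: measurable_funD.
have := @integral_pushforward _ _ _ _ _ _ ms mu setT (EFin \o f).
rewrite preimage_setT => /(_ _ fi measurableT) /= <-.
  by apply: eq_measure_integral => A mA _; apply/esym/lebesgue_measure_shift.
exact/measurable_EFinP.
Qed.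

End plane_measure.

Section calculus.
Context {R : realType}.
Local Notation mu := (@lebesgue_measure R).

Lemma is_derive_continuous (f : R -> R) (x l : R) :
  is_derive x 1 f l -> {for x, continuous f}.
Proof. by move=> [df _]; exact/differentiable_continuous/derivable1_diffP. Qed.

Lemma FTC2_within (f f' : R -> R) (a b : R) : a <= b ->
  {within `[a, b], continuous f} -> {within `[a, b], continuous f'} ->
  (forall x : R, a < x < b -> is_derive x 1 f (f' x)) ->
  (\int[mu]_(x in `[a, b]) (f' x)%:E = (f b - f a)%:E)%E.
Proof.
rewrite le_eqVlt => /predU1P[<- _ _ _|ab cf cf' df].
  by rewrite set_itv1 integral_set1 subrr.
move/(continuous_within_itvP _ ab) : (cf) => [cfo cfa cfb].
rewrite EFinB; apply: continuous_FTC2 => //.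
  by split=> // x; rewrite in_itv/= => /df[].
by move=> x; rewrite in_itv/= => /df xd; rewrite derive1E (@derive_val _ _ _ _ _ _ _ xd).
Qed.

Lemma mvt_between (f f' : R -> R) (a b : R) :
  (forall x : R, is_derive x 1 f (f' x)) ->
  exists2 c, `|c - a| <= `|b - a| & f b - f a = f' c * (b - a).
Proof.
move=> df; have [ab|ba|->] := ltgtP a b; last first.
- by exists b; rewrite // !subrr mulr0.
- have [c] := @MVT R f f' b a ba (fun x _ => df x) (continuous_subspaceT
    (fun x => is_derive_continuous (df x))).
  rewrite in_itv/= => /andP[bc ca] E; exists c; last by lra.
  by rewrite ler0_norm ?ler0_norm; lra.
- have [c] := @MVT R f f' a b ab (fun x _ => df x) (continuous_subspaceT
    (fun x => is_derive_continuous (df x))).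
  rewrite in_itv/= => /andP[bc ca] E; exists c; last by lra.
  by rewrite ger0_norm ?ger0_norm; lra.
Qed.

Lemma is_derive_eps (f : R -> R) (x l : R) :
  (forall e, 0 < e -> exists2 d, 0 < d & forall h, h != 0 -> `|h| < d ->
    `|(f (x + h) - f x) / h - l| <= e) ->
  is_derive x 1 f l.
Proof.
move=> H.
have C : h^-1 *: ((f \o shift x) (h *: 1) - f x) @[h --> 0^'] --> l.
  apply/cvgrPdist_le => e e0; have [d d0 Hd] := H _ e0.
  near=> h; rewrite distrC /= [h *: 1]mulr1 (addrC h) [_ *: _]mulrC; apply: Hd.
    by near: h; exact: nbhs_dnbhs_neq.
  near: h; exists d => //= y; rewrite /ball_/= sub0r normrN => + _; exact.
split; first by apply/cvg_ex; exists l.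
by apply: cvg_lim => //; exact: Rhausdorff.
Unshelve. all: by end_near. Qed.

Lemma integral_derive_support (f f' : R -> R) (B : R) :
  (forall x : R, is_derive x 1 f (f' x)) -> continuous f' ->
  (forall x, B < `|x| -> f x = 0 /\ f' x = 0) ->
  (\int[mu]_x (f' x)%:E = 0)%E.
Proof.
move=> df cf' f0; pose b : R := `|B| + 1.
have b0 : - b <= b by rewrite /b; have := normr_ge0 B; lra.
have Bb : B < `|b| by rewrite ger0_norm /b; have := ler_norm B; have := normr_ge0 B; lra.
transitivity (\int[mu]_(x in `[(- b)%R, b]) (f' x)%:E)%E.
  rewrite [RHS]integral_mkcond; apply: eq_integral => x _; rewrite patchE.
  case: ifPn => //; rewrite notin_setE /= => xb; congr EFin; apply: (f0 _ _).2.
  rewrite ltNge; apply/negP => xB; apply: xb.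
  by rewrite in_itv/= -ler_norml (le_trans xB)// (le_trans (ler_norm _))// lerDl.
rewrite (@FTC2_within f) //.
- by rewrite (f0 _ Bb).1 (f0 (- b) _).1 ?subrr// normrN.
- by apply: continuous_subspaceT => x; exact: is_derive_continuous (df x).
- exact: continuous_subspaceT.
Qed.

End calculus.

(** * Test functions and their derivatives along rays *)

Section test_functions.
Context {R : realType}.
Local Notation mu := (@lebesgue_measure R).
Implicit Types (phi : R * R -> R) (t x s : R).

Lemma partial1_is_derive phi t x : derivable phi (t, x) (1, 0) ->
  is_derive t 1 (fun t => phi (t, x)) ('D_(1, 0) phi (t, x)).
Proof.
move=> d.
have E : (fun h => h^-1 *: (((fun t => phi (t, x)) \o shift t) (h *: 1) - phi (t, x))) =
  (fun h => h^-1 *: ((phi \o shift (t, x)) (h *: (1, 0)) - phi (t, x))).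
  apply/funext => h /=; congr (_ *: (phi _ - _)).
  by apply: injective_projections => //=; rewrite [_ *: 0]mulr0 add0r.
by split; rewrite /derivable /derive /= E.
Qed.

Lemma partial2_is_derive phi t x : derivable phi (t, x) (0, 1) ->
  is_derive x 1 (fun x => phi (t, x)) ('D_(0, 1) phi (t, x)).
Proof.
move=> d.
have E : (fun h => h^-1 *: (((fun x => phi (t, x)) \o shift x) (h *: 1) - phi (t, x))) =
  (fun h => h^-1 *: ((phi \o shift (t, x)) (h *: (0, 1)) - phi (t, x))).
  apply/funext => h /=; congr (_ *: (phi _ - _)).
  by apply: injective_projections => //=; rewrite [_ *: 0]mulr0 add0r.
by split; rewrite /derivable /derive /= E.
Qed.

Lemma ray_is_derive phi t x s :
  (forall z, derivable phi z (1, 0) /\ derivable phi z (0, 1)) ->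
  continuous ('D_(1, 0) phi) ->
  is_derive t 1 (fun t => phi (t, x + s * t))
    ('D_(1, 0) phi (t, x + s * t) + s * 'D_(0, 1) phi (t, x + s * t)).
Proof.
move=> dphi c1; set X := x + s * t.
(* The increment along the ray is split into a change of time and a change of position at the fixed
   time [t]. The second needs only a partial derivative; the first uses the mean value theorem at a
   moving position, hence the continuity of the time derivative. *)
have -> : (fun t => phi (t, x + s * t)) =
    (fun u => phi (u, x + s * u) - phi (t, x + s * u)) \+ (fun u => phi (t, x + s * u)).
  by apply/funext => u /=; rewrite subrK.
apply: is_deriveD; last first.
  rewrite mulrC; apply: (@is_derive1_comp _ (fun y => phi (t, y)) (fun u => x + s * u)).
    exact: partial2_is_derive (dphi _).2.
  apply: is_derive_eps => e e0; exists 1 => // h h0 _.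
  by rewrite (_ : _ - s = 0) ?normr0 ?ltW//; field.
apply: is_derive_eps => e e0.
have := c1 (t, X); rewrite /continuous_at => /cvgrPdist_le /(_ _ e0) /nbhs_ballP[d /= d0 Hd].
(* Dividing by 1 + |s| makes both displacements, h in time and s h in space, smaller than d. *)
have k0 : 0 < 1 + `|s| by have := normr_ge0 s; lra.
exists (d / (1 + `|s|)); first by rewrite divr_gt0.
move=> h h0; rewrite ltr_pdivlMr// => hd.
have [cc hc ->] := @mvt_between R (fun u => phi (u, x + s * (t + h)))
  (fun u => 'D_(1, 0) phi (u, x + s * (t + h))) t (t + h)
  (fun u => partial1_is_derive (dphi _).1).
rewrite (_ : t + h - t = h) in hc *; last by ring.
rewrite /= (_ : _ / h = 'D_(1, 0) phi (cc, x + s * (t + h))); last first.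
  by field.
rewrite distrC; apply: Hd; split; rewrite /ball/=.
  rewrite distrC (le_lt_trans hc)// (le_lt_trans _ hd)//.
  by rewrite ler_peMr// lerDl.
rewrite /X (_ : _ - _ = - (s * h)); last by ring.
rewrite normrN normrM (le_lt_trans _ hd)// mulrC ler_wpM2l// lerDr.
done.
Qed.

Lemma test_function_support phi : test_function phi ->
  exists B : R, [/\ 0 < B,
    (forall z, B < `|z.1| \/ B < `|z.2| ->
      [/\ phi z = 0, 'D_(1, 0) phi z = 0 & 'D_(0, 1) phi z = 0]) &
    (forall z, z.1 <= 0 \/ z.2 = 0 ->
      [/\ phi z = 0, 'D_(1, 0) phi z = 0 & 'D_(0, 1) phi z = 0])].
Proof.
move=> [_ _ _ cK Ksub]; set K := closure _ in cK Ksub.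
have phi0 z : ~ K z -> phi z = 0.
  move=> nK; apply/eqP/negPn/negP => pz; apply: nK; exact: subset_closure.
have d0 v z : ~ K z -> 'D_v phi z = 0.
  move=> nK; have oK : open (~` K) by apply: closed_openC; exact: closed_closure.
  have : \forall y \near z, y \notin K.
    have : nbhs z (~` K) by exact: open_nbhs_nbhs.
    by apply: filterS => y /= yK; rewrite notin_setE.
  move=> nz; rewrite (@near_eq_derive _ _ _ phi (cst 0) z v).
  - exact: derive_cst.
  - by near=> y; rewrite /= phi0//; apply/set_mem; rewrite in_setC; near: y.
have [B0 [_ HB]] := compact_bounded cK.
pose B := `|B0| + 1.
exists B; split.
- by rewrite /B; have := normr_ge0 B0; lra.
- move=> z zB; have nK : ~ K z.
    move=> Kz; have := HB B; rewrite /B (le_lt_trans (ler_norm _)) ?ltrDl//.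
    move=> /(_ isT _ Kz) /=; rewrite prod_normE/= ge_max => /andP[].
    by case: zB; rewrite /B; lra.
  by split; [exact: phi0|exact: d0|exact: d0].
- move=> z zB; have nK : ~ K z.
    by move=> /Ksub/= [z1 /eqP z2]; case: zB => //; lra.
  by split; [exact: phi0|exact: d0|exact: d0].
Unshelve. all: by end_near. Qed.

End test_functions.

(** * The weak equation as an integral over the plane *)

Section weak_equation.
Context {R : realType}.
Local Notation mu := (@lebesgue_measure R).
Local Notation mu2 := (mu \x mu)%E.
Local Notation D := (`[0%R, +oo[%classic `*` [set: R]).
Implicit Types (phi : R * R -> R) (t x s : R).

Lemma test_function_derive_bounded phi : test_function phi ->
  exists C : R, forall z, `|'D_(1, 0) phi z| <= C /\ `|'D_(0, 1) phi z| <= C.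
Proof.
move=> tphi; have [B [B0 HB _]] := test_function_support tphi.
have [_ c1 c2 cK _] := tphi; set K := closure _ in cK.
have bnd (g : R * R -> R) : continuous g -> exists C, forall z, K z -> `|g z| <= C.
  move=> cg; have : compact (g @` K) by apply: continuous_compact => //; exact: continuous_subspaceT.
  move=> /compact_bounded[C [_ HC]]; exists (C + 1) => z Kz.
  by apply: (HC (C + 1)); [rewrite ltrDl|exists z].
have d0 v z : ~ K z -> 'D_v phi z = 0.
  move=> nK; have oK : open (~` K) by apply: closed_openC; exact: closed_closure.
  have : \forall y \near z, y \notin K.
    have : nbhs z (~` K) by exact: open_nbhs_nbhs.
    by apply: filterS => y /= yK; rewrite notin_setE.
  move=> nz; rewrite (@near_eq_derive _ _ _ phi (cst 0) z v).
  - exact: derive_cst.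
  - near=> y; rewrite /=; apply/eqP/negPn/negP => pz.
    have : y \notin K by near: y.
    by rewrite notin_setE; apply; exact: subset_closure.
have [C1 H1] := bnd _ c1; have [C2 H2] := bnd _ c2.
exists (`|C1| + `|C2|) => z.
have n1 := normr_ge0 C1; have n2 := normr_ge0 C2.
have l1 := ler_norm C1; have l2 := ler_norm C2.
have [Kz|nKz] := pselect (K z); last by rewrite !d0// normr0; split; lra.
by have := H1 _ Kz; have := H2 _ Kz; split; lra.
Unshelve. all: by end_near. Qed.

Definition weak_integrand (f g : R -> R -> R) phi (z : R * R) : R :=
  f z.1 z.2 * 'D_(1, 0) phi z + g z.1 z.2 * 'D_(0, 1) phi z.

Lemma weak_integrand_support (f g : R -> R -> R) phi z :
  test_function phi -> z.1 <= 0 \/ z.2 = 0 -> weak_integrand f g phi z = 0.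
Proof.
move=> tphi z0; have [B [_ _ /(_ _ z0)[_ d1 d2]]] := test_function_support tphi.
by rewrite /weak_integrand d1 d2 !mulr0 addr0.
Qed.

Lemma measurable_quadrant : measurable (D : set (R * R)).
Proof. by apply: measurableX => //; exact: measurable_itv. Qed.

(** Test functions vanish for t <= 0, so the half-plane can be replaced by the whole plane, where
    shears and Fubini produce no boundary terms. *)
Lemma weak_equationT (f g : R -> R -> R) :
  (forall phi, test_function phi ->
    mu2.-integrable setT (EFin \o weak_integrand f g phi) /\
    (\int[mu2]_z (weak_integrand f g phi z)%:E = 0)%E) <->
  weak_equation f g.
Proof.
have E phi : test_function phi -> (EFin \o weak_integrand f g phi) \_ D =
    EFin \o weak_integrand f g phi.
  move=> tphi; apply/funext => z; rewrite patchE; case: ifPn => //.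
  rewrite notin_setE => zD /=; rewrite weak_integrand_support//; left.
  rewrite leNgt; apply/negP => z0; apply: zD; split => //=.
  by rewrite in_itv/= andbT ltW.
split=> H phi tphi.
- have [fi f0] := H _ tphi; split.
    apply: (integrable_mkcond (mu := mu2) (EFin \o weak_integrand f g phi)
      measurable_quadrant).2.
    by rewrite E.
  rewrite -[RHS]f0 [LHS]integral_mkcond; congr (integral _ _ _).
  exact: E.
- have /= [fi f0] := H _ tphi; split.
    rewrite -E//; apply: (integrable_mkcond (mu := mu2) (EFin \o weak_integrand f g phi)
      measurable_quadrant).1.
    exact: fi.
  rewrite -[RHS]f0 [RHS]integral_mkcond; congr (integral _ _ _).
  exact/esym/E.
Qed.

(** The supports avoid t <= 0 and x = 0. Values there are invisible, in particular those produced by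
    x / t at t = 0. *)
Lemma eq_weak_equation (f g f' g' : R -> R -> R) :
  (forall t x, 0 < t -> x != 0 -> f t x = f' t x /\ g t x = g' t x) ->
  weak_equation f g -> weak_equation f' g'.
Proof.
move=> E /weak_equationT H; apply/weak_equationT => phi tphi.
suff -> : weak_integrand f' g' phi = weak_integrand f g phi by exact: H.
apply/funext => z.
have [z1|z1] := leP z.1 0; first by rewrite !weak_integrand_support//; left.
have [z2|z2] := eqVneq z.2 0; first by rewrite !weak_integrand_support//; right.
by rewrite /weak_integrand; have [-> ->] := E _ _ z1 z2.
Qed.

Lemma weak_equationD (f1 g1 f2 g2 : R -> R -> R) :
  weak_equation f1 g1 -> weak_equation f2 g2 ->
  weak_equation (fun t x => f1 t x + f2 t x) (fun t x => g1 t x + g2 t x).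
Proof.
move=> /weak_equationT H1 /weak_equationT H2; apply/weak_equationT => phi tphi.
have [i1 e1] := H1 _ tphi; have [i2 e2] := H2 _ tphi.
have E : EFin \o weak_integrand (fun t x => f1 t x + f2 t x)
    (fun t x => g1 t x + g2 t x) phi =
  (EFin \o weak_integrand f1 g1 phi) \+ (EFin \o weak_integrand f2 g2 phi).
  by apply/funext => z /=; rewrite -EFinD /weak_integrand; congr EFin; ring.
split; first by rewrite E; exact: integrableD.
transitivity (\int[mu2]_z ((EFin \o weak_integrand f1 g1 phi) \+
  (EFin \o weak_integrand f2 g2 phi)) z)%E.
  by congr (integral _ _ _); exact: E.
by rewrite integralD// [X in (X + _)%E]e1 [X in (_ + X)%E]e2 adde0.
Qed.

Lemma weak_equationZ (k : R) (f g : R -> R -> R) : weak_equation f g ->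
  weak_equation (fun t x => k * f t x) (fun t x => k * g t x).
Proof.
move=> /weak_equationT H; apply/weak_equationT => phi tphi.
have [i e] := H _ tphi.
have E : EFin \o weak_integrand (fun t x => k * f t x) (fun t x => k * g t x) phi =
  (fun z => (k%:E * (EFin \o weak_integrand f g phi) z)%E).
  by apply/funext => z /=; rewrite -EFinM /weak_integrand; congr EFin; ring.
split; first by rewrite E; exact: integrableZl.
transitivity (\int[mu2]_z (k%:E * (EFin \o weak_integrand f g phi) z))%E.
  by congr (integral _ _ _); exact: E.
by rewrite integralZl// [X in (_ * X)%E]e mule0.
Qed.

Definition box (b1 b2 : R) : set (R * R) :=
  `[(- b1)%R, b1]%classic `*` `[(- b2)%R, b2]%classic.

Lemma measurable_box b1 b2 : measurable (box b1 b2).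
Proof. by apply: measurableX; exact: measurable_itv. Qed.

Lemma box_finite b1 b2 : (mu2 (box b1 b2) < +oo)%E.
Proof.
rewrite product_measure1E; [|exact: measurable_itv|exact: measurable_itv].
have fin (b : R) : (mu `[(- b)%R, b] < +oo)%E.
  by rewrite lebesgue_measure_itv/=; case: ifP => // _; rewrite -EFinB ltry.
apply: lte_mul_pinfty => //; last exact: fin.
rewrite ge0_fin_numE; [exact: fin|exact: measure_ge0].
Qed.

Lemma not_box b1 b2 z : ~ box b1 b2 z -> b1 < `|z.1| \/ b2 < `|z.2|.
Proof.
move=> nb; have [z1|z1] := ltP b1 `|z.1|; first by left.
right; rewrite ltNge; apply/negP => z2; apply: nb.
by split; rewrite /= in_itv/= -ler_norml.
Qed.

End weak_equation.

(** * Transported profiles *)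

Section weak_waves.
Context {R : realType}.
Local Notation mu := (@lebesgue_measure R).
Local Notation mu2 := (mu \x mu)%E.
Implicit Types (phi : R * R -> R) (t x s : R).

Lemma segment_finite (a b : R) : (mu `[a, b]%classic < +oo)%E.
Proof. by rewrite lebesgue_measure_itv/=; case: ifP => // _; rewrite -EFinB ltry. Qed.

Lemma box_integrable (F : R * R -> R) (M B : R) :
  measurable_fun setT F -> (forall z, `|F z| <= M) ->
  (forall z, B < `|z.1| \/ B < `|z.2| -> F z = 0) ->
  mu2.-integrable setT (EFin \o F).
Proof.
move=> mF FM F0.
apply: (@bounded_support_integrable R _ _ mu2 F (box B B) M) => //.
- exact: measurable_box.
- exact: box_finite.
- by move=> z /not_box; exact: F0.
Qed.

(** The shear (t, x) |-> (t, x + s t) translates each line of constant t, so it preserves the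
    integral; exchanging the integrals then leaves integrals along the rays of speed [s]. *)
Lemma shear_integral0 (F : R * R -> R) (M B s : R) :
  measurable_fun setT F -> (forall z, `|F z| <= M) ->
  (forall z, B < `|z.1| \/ B < `|z.2| -> F z = 0) ->
  (forall x, (\int[mu]_t (F (t, x + s * t))%:E = 0)%E) ->
  (\int[mu2]_z (F z)%:E = 0)%E.
Proof.
move=> mF FM F0 I0; have iF := box_integrable mF FM F0.
pose sh (z : R * R) := (z.1, z.2 + s * z.1).
have msh : measurable_fun setT sh.
  apply: measurable_fun_pair => //.
  by apply: measurable_funD => //; exact: measurable_funM.
have mG : measurable_fun setT (F \o sh) by exact: measurableT_comp.
have iG : mu2.-integrable setT (EFin \o (F \o sh)).
  (* A point that the shear sends into the box of size |B| has a second coordinate of size at most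
     |B| + |s| |B|. *)
  apply: (@box_integrable _ M (`|B| + `|s| * `|B|)) => //.
    by move=> z; exact: FM.
  move=> z nz; apply: F0; rewrite /sh/=.
  have B0 := ler_norm B; have := normr_ge0 s => s0.
  have := normr_ge0 B => nB.
  case: (ltP B `|z.1|) => zB; first by left.
  have h1 : `|z.2| <= `|z.2 + s * z.1| + `|s| * `|z.1|.
    by rewrite -normrM -[X in `|X| <= _](addrK (s * z.1)) ler_normB.
  have h2 : `|s| * `|z.1| <= `|s| * `|B| by rewrite ler_wpM2l// (le_trans zB).
  have h3 : 0 <= `|s| * `|B| by exact: mulr_ge0.
  by right; case: nz => nz; lra.
rewrite -(integral12_prod_meas1 iF) /fubini_F /=.
transitivity (\int[mu]_t \int[mu]_x ((F \o sh) (t, x))%:E)%E.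
  apply: eq_integral => t _.
  have mFt : measurable_fun setT (fun x => F (t, x)) by exact: measurableT_comp.
  apply: (@integral_shift _ (s * t) (fun x => F (t, x)) mFt).
  apply: (@bounded_support_integrable R _ _ mu (fun x => F (t, x + s * t))
    `[(- (`|B| + `|s * t|))%R, `|B| + `|s * t|]%classic M).
  - exact: measurable_itv.
  - exact: segment_finite.
  - by apply: (measurableT_comp mFt); exact: measurable_funD.
  - by move=> x; exact: FM.
  - move=> x; rewrite /= in_itv/= -ler_norml => /negP; rewrite -ltNge => xB.
    apply: F0; right; have : `|x| <= `|x + s * t| + `|s * t|.
      by rewrite -[X in `|X| <= _](addrK (s * t)) ler_normB.
    by have B0 := ler_norm B; lra.
rewrite (Fubini iG); apply: integral0_eq => x _; exact: I0.
Qed.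

Lemma test_functionP phi : test_function phi ->
  exists (p1 p2 : R * R -> R) (B C : R), [/\
    [/\ forall z, 'D_(1, 0) phi z = p1 z, forall z, 'D_(0, 1) phi z = p2 z,
        continuous p1 & continuous p2],
    measurable_fun setT p1 /\ measurable_fun setT p2,
    forall z, `|p1 z| <= C /\ `|p2 z| <= C,
    forall z, B < `|z.1| \/ B < `|z.2| -> [/\ phi z = 0, p1 z = 0 & p2 z = 0] &
    forall t x s, is_derive t 1 (fun t => phi (t, x + s * t))
      (p1 (t, x + s * t) + s * p2 (t, x + s * t))].
Proof.
move=> tphi.
have [B [B0 HB _]] := test_function_support tphi.
have [C HC] := test_function_derive_bounded tphi.
have [dphi c1 c2 _ _] := tphi.
pose p1 (z : R * R) : R := 'D_(1, 0) phi z.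
pose p2 (z : R * R) : R := 'D_(0, 1) phi z.
exists p1, p2, B, C; split; [split| |exact: HC|exact: HB|].
- by move=> z.
- by move=> z.
- exact: c1.
- exact: c2.
- by split; [exact: (continuous_measurable_prod c1)|exact: (continuous_measurable_prod c2)].
- move=> t x s; exact: (@ray_is_derive R phi t x s dphi c1).
Qed.

End weak_waves.

Section flux_waves.
Context {R : realType}.
Local Notation mu := (@lebesgue_measure R).
Local Notation mu2 := (mu \x mu)%E.
Implicit Types (phi : R * R -> R) (t x s : R).

Lemma continuous_pair (p : R * R -> R) (f g : R -> R) t :
  {for (f t, g t), continuous p} -> {for t, continuous f} -> {for t, continuous g} ->
  {for t, continuous (fun u => p (f u, g u))}.
Proof.
move=> cp cf cg.
apply: (@continuous2_cvg _ _ _ _ _ _ f g (fun a b => p (a, b)) (f t) (g t)) => //.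
by have -> : (fun z : R * R => p (z.1, z.2)) = p by apply/funext => -[].
Qed.

Lemma continuous_line (p : R * R -> R) (x s : R) : continuous p ->
  continuous (fun t : R => p (t, x + s * t)).
Proof.
move=> cp t; apply: (@continuous_pair p id (fun t => x + s * t)); first exact: cp.
  exact: cvg_id.
apply: cvgD; first exact: cvg_cst.
by apply: cvgM; [exact: cvg_cst|exact: cvg_id].
Qed.

(** Along a ray of speed [s] the profile is constant and the integrand is that constant times the
    derivative of the test function along the ray, whose integral vanishes. No regularity of [e] is
    involved. *)
Lemma weak_wave (e : R -> R) (M s : R) :
  measurable_fun setT e -> (forall y, `|e y| <= M) ->
  weak_equation (fun t x => e (x - s * t)) (fun t x => s * e (x - s * t)).
Proof.
move=> me eM; apply/weak_equationT => phi tphi.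
have [p1 [p2 [B [C [[Ep1 Ep2 c1 c2] [mp1 mp2] HC HB dray]]]]] := test_functionP tphi.
have -> : weak_integrand (fun t x => e (x - s * t)) (fun t x => s * e (x - s * t)) phi =
    fun z : R * R => e (z.2 - s * z.1) * (p1 z + s * p2 z).
  by apply/funext => z; rewrite /weak_integrand Ep1 Ep2; ring.
have me1 : measurable_fun setT (fun z : R * R => e (z.2 - s * z.1)).
  apply: measurableT_comp => //; apply: measurable_funB => //.
  exact: measurable_funM.
have mF : measurable_fun setT (fun z : R * R => e (z.2 - s * z.1) * (p1 z + s * p2 z)).
  apply: measurable_funM => //; apply: measurable_funD => //.
  exact: measurable_funM.
have FM (z : R * R) : `|e (z.2 - s * z.1) * (p1 z + s * p2 z)| <= M * (C + `|s| * C).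
  rewrite normrM; apply: ler_pM => //.
  rewrite (le_trans (ler_normD _ _))// normrM; have [? ?] := HC z.
  by apply: lerD => //; apply: ler_wpM2l.
have F0 (z : R * R) : B < `|z.1| \/ B < `|z.2| -> e (z.2 - s * z.1) * (p1 z + s * p2 z) = 0.
  by move=> /HB[_ q1 q2]; rewrite q1 q2 mulr0 addr0 mulr0.
split; first exact: (box_integrable mF FM F0).
apply: (@shear_integral0 R _ _ _ s mF FM F0) => x.
apply: (@integral_derive_support _ (fun t => e x * phi (t, x + s * t)) _ B).
- move=> t; rewrite /= addrK.
  exact: (@is_deriveZ _ _ _ (fun t => phi (t, x + s * t)) (e x) t 1 _ (dray t x s)).
- move=> t.
  have -> : (fun u : R => e ((u, x + s * u).2 - s * (u, x + s * u).1) *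
      (p1 (u, x + s * u) + s * p2 (u, x + s * u))) =
      (fun u => e x * (p1 (u, x + s * u) + s * p2 (u, x + s * u))).
    by apply/funext => u /=; rewrite addrK.
  apply: cvgM; first exact: cvg_cst.
  apply: cvgD; first exact: (continuous_line c1).
  apply: cvgM; first exact: cvg_cst.
  exact: (continuous_line c2).
- move=> t tB; have := HB (t, x + s * t) (or_introl tB).
  by move=> [q0 q1 q2]; rewrite q0 q1 q2 !(mulr0, addr0).
Qed.

(** Constant profiles are waves of every speed: the pair (k, l) is (k - l) times the unit wave of
    speed 0 plus l times the unit wave of speed 1. *)
Lemma weak_equation_cst (k l : R) : weak_equation (fun _ _ => k) (fun _ _ => l).
Proof.
have w (s : R) := @weak_wave (cst 1) 1 s (measurable_cst _)
  (fun y => eq_ind_r (fun a => a <= 1) (lexx 1) (normr1 R)).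
apply: (eq_weak_equation _ (weak_equationD
  (weak_equationZ (k - l) (w 0)) (weak_equationZ l (w 1)))) => t x _ _.
by rewrite /=; split; ring.
Qed.

Lemma weak_equation_flux_jump (l : R) :
  weak_equation (fun _ _ => 0) (fun _ x => if x < 0 then l else 0).
Proof.
apply/weak_equationT => phi tphi.
have [p1 [p2 [B [C [[Ep1 Ep2 c1 c2] [mp1 mp2] HC HB dray]]]]] := test_functionP tphi.
have [_ [_ _ phi0]] := test_function_support tphi.
have [dphi _ _ _ _] := tphi.
pose e (x : R) : R := if x < 0 then l else 0.
have -> : weak_integrand (fun _ _ => 0) (fun _ x => if x < 0 then l else 0) phi =
    fun z : R * R => e z.2 * p2 z.
  by apply/funext => z; rewrite /weak_integrand Ep1 Ep2 mul0r add0r.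
have me : measurable_fun setT e.
  by apply: measurable_fun_ifT => //; exact: measurable_fun_ltr.
have mF : measurable_fun setT (fun z : R * R => e z.2 * p2 z).
  by apply: measurable_funM => //; exact: measurableT_comp.
have FM (z : R * R) : `|e z.2 * p2 z| <= `|l| * C.
  rewrite normrM; apply: ler_pM => //; last by have [] := HC z.
  by rewrite /e; case: ifP => // _; rewrite normr0.
have F0 (z : R * R) : B < `|z.1| \/ B < `|z.2| -> e z.2 * p2 z = 0.
  by move=> /HB[_ q1 q2]; rewrite q2 mulr0.
have iF := box_integrable mF FM F0; split; first exact: iF.
rewrite -(integral12_prod_meas1 iF) /fubini_F /=; apply: integral0_eq => t _.
pose b : R := `|B| + 1.
have b0 : 0 < b by rewrite /b ltr_wpDl.
have Bb : B < b by rewrite /b (le_lt_trans (ler_norm _))// ltrDl.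
transitivity (\int[mu]_(x in `[(- b)%R, 0%R]) (l * p2 (t, x))%:E)%E.
  rewrite [RHS]integral_mkcond; apply: eq_integral => x _; rewrite patchE.
  case: ifPn; rewrite ?inE ?notin_setE /= in_itv/= /e.
    move=> /andP[_]; rewrite le_eqVlt => /predU1P[->|->//].
    by have [_ _] := phi0 (t, 0) (or_intror erefl); rewrite ltxx Ep2 mul0r => ->; rewrite mulr0.
  move=> /negP; rewrite negb_and -!ltNge => /orP[xb|x0]; last first.
    by rewrite ltNge ltW// mul0r.
  have [|_ _ ->] := HB (t, x); last by rewrite mulr0.
  by right; rewrite /= ltr0_norm; lra.
have dl (x : R) : is_derive x 1 (fun x => l * phi (t, x)) (l * p2 (t, x)).
  rewrite -Ep2; exact: (@is_deriveZ _ _ _ (fun x => phi (t, x)) l x 1 _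
    (partial2_is_derive (dphi _).2)).
have E := @FTC2_within R (fun x => l * phi (t, x)) (fun x => l * p2 (t, x)) (- b) 0.
rewrite E.
- have [-> _ _] := phi0 (t, 0) (or_intror erefl).
  have [|-> _ _] := HB (t, - b); last by rewrite !mulr0 subrr.
  by right; rewrite /= normrN gtr0_norm.
- by rewrite oppr_le0 ltW.
- by apply: continuous_subspaceT => x; apply: is_derive_continuous (dl x).
- apply: continuous_subspaceT => x; apply: cvgM; first exact: cvg_cst.
  apply: (@continuous_pair p2 (cst t) id); first exact: c2.
    exact: cvg_cst.
  exact: cvg_id.
Qed.

End flux_waves.

(** * Superposition of fronts *)

Section superposition.
Context {R : realType}.
Local Notation mu := (@lebesgue_measure R).
Local Notation mu2 := (mu \x mu)%E.

(** If every slice [r] integrates to zero, so does the integral over [r]. The sigma-finiteness of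
    the product [m1 \x m2] is a hypothesis, packed into a measure structure before Fubini is
    applied. *)
Lemma fubini_slices0 d1 d2 d3 (T1 : measurableType d1) (T2 : measurableType d2)
    (T3 : measurableType d3) (m1 : {sigma_finite_measure set T1 -> \bar R})
    (m2 : {sigma_finite_measure set T2 -> \bar R})
    (m3 : {sigma_finite_measure set T3 -> \bar R}) (H : (T1 * T2) * T3 -> R) :
  sigma_finite setT (m1 \x m2)%E ->
  ((m1 \x m2) \x m3)%E.-integrable setT (EFin \o H) ->
  (forall r, (\int[(m1 \x m2)%E]_z (H (z, r))%:E = 0)%E) ->
  (m1 \x m2)%E.-integrable setT (fun z => \int[m3]_r (H (z, r))%:E)%E /\
  (\int[(m1 \x m2)%E]_z \int[m3]_r (H (z, r))%:E = 0)%E.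
Proof.
move=> sf iH H0.
pose nu : {sigma_finite_measure set (T1 * T2)%type -> \bar R} :=
  HB.pack (m1 \x m2)%E (Measure_isSigmaFinite.Build _ _ _ (m1 \x m2)%E sf).
split; first exact: (@integrable_fubini_F _ _ _ _ _ nu m3 _ iH).
by rewrite (@Fubini _ _ _ _ _ nu m3 _ iH); apply: integral0_eq => r _; exact: H0.
Qed.

Lemma plane_sigma_finite : sigma_finite setT mu2.
Proof.
exists (fun n => box n%:R n%:R).
  apply/seteqP; split => // -[x y] _.
  have [n xn] : exists n : nat, `|x| + `|y| <= n%:R.
    by exists (Num.bound (`|x| + `|y|)); rewrite ltW// archi_boundP// addr_ge0.
  have x0 := normr_ge0 x; have y0 := normr_ge0 y.
  by exists n => //; split; rewrite /= in_itv/= -ler_norml; lra.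
by move=> n; split; [exact: measurable_box|exact: box_finite].
Qed.

Lemma plane_slices0 (H : (R * R) * R -> R) :
  (mu2 \x mu)%E.-integrable setT (EFin \o H) ->
  (forall r, (\int[mu2]_z (H (z, r))%:E = 0)%E) ->
  mu2.-integrable setT (fun z => \int[mu]_r (H (z, r))%:E)%E /\
  (\int[mu2]_z \int[mu]_r (H (z, r))%:E = 0)%E.
Proof. exact: (@fubini_slices0 _ _ _ _ _ _ mu mu mu H plane_sigma_finite). Qed.

Lemma slab_finite (b1 b2 a b : R) :
  ((mu2 \x mu)%E (box b1 b2 `*` `[a, b]%classic) < +oo)%E.
Proof.
rewrite product_measure1E; [|exact: measurable_box|exact: measurable_itv].
apply: lte_mul_pinfty; [exact: measure_ge0| |exact: segment_finite].
rewrite ge0_fin_numE; [exact: box_finite|exact: measure_ge0].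
Qed.

Lemma bounded_segment_integrable (f : R -> R) (M a b : R) :
  measurable_fun setT f -> (forall x, `|f x| <= M) ->
  mu.-integrable `[a, b] (EFin \o f).
Proof.
move=> mf fM; apply: measurable_bounded_integrable.
- exact: measurable_itv.
- exact: segment_finite.
- exact: measurable_funS mf.
- exists M; split; first exact: num_real.
  by move=> x Mx y _ /=; rewrite (le_trans (fM y))// ltW.
Qed.

(** For each [r] the integrand is a front of height [g r] and speed [eps * lam r], an instance of
    [weak_wave]; Fubini sums them over [r]. The number [eps] is a sign, and -1 gives the picture
    mirrored in x. *)
Lemma weak_superposition (lam g : R -> R) (a b eps M L : R) :
  measurable_fun setT lam -> measurable_fun setT g ->
  (forall r, `|lam r| <= L) -> (forall r, `|g r| <= M) -> eps * eps = 1 ->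
  weak_equation
    (fun t x => \int[mu]_(r in `[a, b]) (if eps * x < lam r * t then g r else 0))%R
    (fun t x => eps *
      \int[mu]_(r in `[a, b]) (if eps * x < lam r * t then lam r * g r else 0))%R.
Proof.
move=> ml mg lL gM ee; apply/weak_equationT => phi tphi.
have [p1 [p2 [B [C [[Ep1 Ep2 c1 c2] [mp1 mp2] HC HB dray]]]]] := test_functionP tphi.
pose A (z : R * R) r : R := if eps * z.2 < lam r * z.1 then g r else 0.
pose K (z : R * R) (r : R) : R := A z r * (p1 z + eps * lam r * p2 z).
(* The indicator of the segment turns the integral over [r] into one over the whole line, as Fubini
   expects. *)
pose e (r : R) : R := if (a <= r) && (r <= b) then 1 else 0.
pose H (w : (R * R) * R) : R := e w.2 * K w.1 w.2.
have mfst : measurable_fun setT (fun w : (R * R) * R => w.1.1) by exact: measurableT_comp.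
have msnd : measurable_fun setT (fun w : (R * R) * R => w.1.2) by exact: measurableT_comp.
have me : measurable_fun setT e.
  apply: measurable_fun_ifT => //; apply: measurable_and => //; exact: measurable_fun_ler.
have mA : measurable_fun setT (fun w : (R * R) * R => A w.1 w.2).
  apply: measurable_fun_ifT => //; last exact: measurableT_comp.
  apply: measurable_fun_ltr; first exact: measurable_funM.
  by apply: measurable_funM => //; exact: measurableT_comp.
have mK : measurable_fun setT (fun w : (R * R) * R => K w.1 w.2).
  apply: measurable_funM => //; apply: measurable_funD; first exact: measurableT_comp.
  apply: measurable_funM; last exact: measurableT_comp.
  by apply: measurable_funM => //; exact: measurableT_comp.
have mH : measurable_fun setT H.
  by apply: measurable_funM => //; exact: measurableT_comp.
have M0 : 0 <= M by rewrite (le_trans _ (gM 0)).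
have AM z r : `|A z r| <= M by rewrite /A; case: ifP => // _; rewrite normr0.
have HM w : `|H w| <= M * (C + `|eps| * L * C).
  rewrite /H /e; case: ifP => _; last first.
    rewrite mul0r normr0 mulr_ge0//.
    have C0 : 0 <= C by rewrite (le_trans _ (HC (0, 0)).1).
    have L0 : 0 <= L by rewrite (le_trans _ (lL 0)).
    by rewrite addr_ge0// !mulr_ge0.
  rewrite mul1r normrM; apply: ler_pM => //.
  rewrite (le_trans (ler_normD _ _))// !normrM; have [? ?] := HC w.1.
  by apply: lerD => //; apply: ler_pM; rewrite ?mulr_ge0 ?ler_wpM2l.
have iH : (mu2 \x mu)%E.-integrable setT (EFin \o H).
  apply: (@bounded_support_integrable R _ _ (mu2 \x mu)%E H
    (box B B `*` `[a, b]%classic) _ _ _ mH HM).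
  - by apply: measurableX; [exact: measurable_box|exact: measurable_itv].
  - exact: slab_finite.
  - move=> [z r] nb; rewrite /H /K /=.
    have [zb|/not_box/HB[_ q1 q2]] := pselect (box B B z); last first.
      by rewrite q1 q2 !(mulr0, addr0).
    rewrite /e; case: ifP => [rab|]; last by rewrite mul0r.
    by exfalso; apply: nb; split => //=; rewrite in_itv.
have mAz z : measurable_fun setT (A z).
  by apply: measurable_fun_ifT => //; apply: measurable_fun_ltr => //; exact: measurable_funM.
have iA z : mu.-integrable `[a, b] (EFin \o A z).
  exact: (bounded_segment_integrable _ _ (mAz z) (AM z)).
have iAl z : mu.-integrable `[a, b] (EFin \o (fun r => lam r * A z r)).
  apply: (@bounded_segment_integrable _ (L * M)); first exact: measurable_funM.
  by move=> r; rewrite normrM ler_pM.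
have EH z : (\int[mu]_r (H (z, r))%:E)%E =
    ((\int[mu]_(r in `[a, b]) A z r)%R * p1 z +
     eps * (\int[mu]_(r in `[a, b]) (lam r * A z r))%R * p2 z)%:E.
  have iK : mu.-integrable `[a, b] (EFin \o K z).
    apply: (@bounded_segment_integrable _ (M * (C + `|eps| * L * C))).
      apply: measurable_funM => //; apply: measurable_funD => //.
      by apply: measurable_funM => //; exact: measurable_funM.
    move=> r; rewrite normrM; apply: ler_pM => //.
    rewrite (le_trans (ler_normD _ _))// !normrM; have [? ?] := HC z.
    by apply: lerD => //; apply: ler_pM; rewrite ?mulr_ge0 ?ler_wpM2l.
  transitivity (\int[mu]_(r in `[a, b]) (K z r)%:E)%E.
    rewrite [RHS]integral_mkcond; apply: eq_integral => r _; rewrite patchE /H /e /=.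
    case: ifPn => rab; case: ifPn; rewrite ?inE ?notin_setE /= in_itv/= => rab'.
    - by rewrite mul1r.
    - by [].
    - by rewrite rab' in rab.
    - by rewrite mul0r.
  rewrite -[LHS]fineK; last exact: integrable_fin_num.
  congr EFin; rewrite -[LHS]/(\int[mu]_(r in `[a, b]) K z r)%R.
  transitivity (\int[mu]_(r in `[a, b]) (p1 z * A z r + (eps * p2 z) * (lam r * A z r)))%R.
    by apply: eq_Rintegral => r _; rewrite /K; ring.
  have i1 : mu.-integrable `[a, b] (EFin \o (fun r => p1 z * A z r)).
    have -> : EFin \o (fun r => p1 z * A z r) =
      (fun r => ((p1 z)%:E * (EFin \o A z) r)%E) by [].
    by apply: integrableZl => //; exact: measurable_itv.
  have i2 : mu.-integrable `[a, b] (EFin \o (fun r => (eps * p2 z) * (lam r * A z r))).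
    have -> : EFin \o (fun r => (eps * p2 z) * (lam r * A z r)) =
      (fun r => ((eps * p2 z)%:E * (EFin \o (fun r => (lam r * A z r))%R) r)%E) by [].
    by apply: integrableZl => //; exact: measurable_itv.
  rewrite RintegralD; [|exact: measurable_itv|exact: i1|exact: i2].
  rewrite RintegralZl; [|exact: measurable_itv|exact: iA].
  rewrite RintegralZl; [|exact: measurable_itv|exact: iAl].
  ring.
have E : EFin \o weak_integrand
    (fun t x => \int[mu]_(r in `[a, b]) (if eps * x < lam r * t then g r else 0))%R
    (fun t x => eps *
      \int[mu]_(r in `[a, b]) (if eps * x < lam r * t then lam r * g r else 0))%R phi =
    (fun z => \int[mu]_r (H (z, r))%:E)%E.
  apply/funext => z; rewrite EH /= /weak_integrand Ep1 Ep2; congr (_ + eps * _ * _)%:E.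
  by apply: eq_Rintegral => r _; rewrite /A; case: ifP => // _; rewrite mulr0.
have W r : mu2.-integrable setT (EFin \o (fun z => e r * K z r)) /\
    (\int[mu2]_z (e r * K z r)%:E = 0)%E.
  have mer : measurable_fun setT (fun y : R => e r * (if eps * y < 0 then g r else 0)).
    apply: measurable_funM => //; apply: measurable_fun_ifT => //.
    by apply: measurable_fun_ltr => //; exact: measurable_funM.
  have Me y : `|e r * (if eps * y < 0 then g r else 0)| <= `|e r| * M.
    by rewrite normrM; apply: ler_pM => //; case: ifP => // _; rewrite normr0.
  have /weak_equationT/(_ _ tphi) := @weak_wave R _ _ (eps * lam r) mer Me.
  suff -> : weak_integrand
    (fun t x => e r * (if eps * (x - eps * lam r * t) < 0 then g r else 0))
    (fun t x => eps * lam r * (e r * (if eps * (x - eps * lam r * t) < 0 then g r else 0)))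
    phi = (fun z => e r * K z r) by [].
  apply/funext => z; rewrite /weak_integrand Ep1 Ep2 /K /A.
  rewrite (_ : eps * (z.2 - _) = eps * z.2 - lam r * z.1); last first.
    by rewrite mulrBr !mulrA ee mul1r.
  by rewrite subr_lt0; case: ifP => _; ring.
have [iF F0] := plane_slices0 iH (fun r => (W r).2).
split; first by rewrite E; exact: iF.
by rewrite -[RHS]F0; congr (integral _ _ _); exact: E.
Qed.

End superposition.

(** * The pressure law and the Lax curves *)

Section real_calculus.
Context {R : realType}.
Local Notation mu := (@lebesgue_measure R).

Lemma is_derive_addf (f g : R -> R) (x a b : R) : is_derive x 1 f a ->
  is_derive x 1 g b -> is_derive x 1 (fun y => f y + g y) (a + b).
Proof. by move=> df dg; exact: is_deriveD. Qed.

Lemma is_derive_subf (f g : R -> R) (x a b : R) : is_derive x 1 f a ->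
  is_derive x 1 g b -> is_derive x 1 (fun y => f y - g y) (a - b).
Proof. by move=> df dg; exact: is_deriveB. Qed.

Lemma is_derive_oppf (f : R -> R) (x a : R) : is_derive x 1 f a ->
  is_derive x 1 (fun y => - f y) (- a).
Proof. by move=> df; exact: is_deriveN. Qed.

Lemma is_derive_scalef (k : R) (f : R -> R) (x a : R) : is_derive x 1 f a ->
  is_derive x 1 (fun y => k * f y) (k * a).
Proof. by move=> df; exact: is_deriveZ. Qed.

Lemma is_derive_mulf (f g : R -> R) (x a b : R) : is_derive x 1 f a ->
  is_derive x 1 g b -> is_derive x 1 (fun y => f y * g y) (a * g x + f x * b).
Proof.
move=> df dg; have -> : a * g x + f x * b = f x *: b + g x *: a.
  by rewrite addrC [a * _]mulrC.
exact: is_deriveM.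
Qed.

Lemma is_derive_sqrf (f : R -> R) (x a : R) : is_derive x 1 f a ->
  is_derive x 1 (fun y => f y ^+ 2) (2 * f x * a).
Proof.
move=> df; have -> : 2 * f x * a = a * f x + f x * a by ring.
exact: is_derive_mulf.
Qed.

Lemma is_derive_inv (x : R) : x != 0 -> is_derive x 1 (fun y => y^-1) (- x ^- 2).
Proof.
move=> x0; have -> : - x ^- 2 = - x ^- 2 *: 1 by rewrite [RHS]mulr1.
exact: (@is_deriveV R id x 1 _ x0 (is_derive_id _ _)).
Qed.

Lemma is_derive_invf (f : R -> R) (x a : R) : f x != 0 -> is_derive x 1 f a ->
  is_derive x 1 (fun y => (f y)^-1) (- a / f x ^+ 2).
Proof.
move=> fx df; have -> : - a / f x ^+ 2 = - f x ^- 2 * a by rewrite mulrC mulrN mulNr.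
exact: (@is_derive1_comp R _ f x _ _ (is_derive_inv fx) df).
Qed.

Lemma is_derive_cstf (k x : R) : is_derive x 1 (fun _ : R => k) 0.
Proof. exact: is_derive_cst. Qed.

Lemma is_derive_idf (x : R) : is_derive x 1 (fun y : R => y) 1.
Proof. exact: is_derive_id. Qed.

Lemma is_derive_eqf (f g : R -> R) (x a b : R) : is_derive x 1 f a ->
  (forall y, f y = g y) -> a = b -> is_derive x 1 g b.
Proof. by move=> df /funext <- <-. Qed.

Lemma within_continuousP (A : set R) (f : R -> R) : {within A, continuous f} <->
  (forall x, A x -> f y @[y --> within A (nbhs x)] --> f x).
Proof. exact: subspace_continuousP. Qed.

Lemma derive_le (f f' : R -> R) (a b : R) : a <= b ->
  (forall x : R, a <= x <= b -> is_derive x 1 f (f' x)) ->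
  (forall x, a < x < b -> 0 <= f' x) -> f a <= f b.
Proof.
rewrite le_eqVlt => /predU1P[->//|ab] df f'0.
have [||x] := @MVT R f f' a b ab.
- by move=> x; rewrite in_itv/= => /andP[ax xb]; apply: df; rewrite !ltW.
- apply: derivable_within_continuous => x; rewrite in_itv/= => xab.
  by have [] := df _ xab.
- rewrite in_itv/= => xab E; rewrite -subr_ge0 E mulr_ge0 ?f'0// subr_ge0 ltW//.
Qed.

Lemma derive_lt (f f' : R -> R) (a b : R) : a < b ->
  (forall x : R, a <= x <= b -> is_derive x 1 f (f' x)) ->
  (forall x, a < x < b -> 0 < f' x) -> f a < f b.
Proof.
move=> ab df f'0.
have [||x] := @MVT R f f' a b ab.
- by move=> x; rewrite in_itv/= => /andP[ax xb]; apply: df; rewrite !ltW.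
- apply: derivable_within_continuous => x; rewrite in_itv/= => xab.
  by have [] := df _ xab.
- rewrite in_itv/= => xab E; rewrite -subr_gt0 E mulr_gt0 ?f'0// subr_gt0//.
Qed.

Lemma near_eq_is_derive (f g : R -> R) (x l : R) :
  (\forall y \near x, f y = g y) -> is_derive x 1 f l -> is_derive x 1 g l.
Proof.
move=> fg [df E]; have n1 : (1 : R) != 0 by exact: oner_neq0.
split; first exact: near_eq_derivable df.
by rewrite -E; apply/esym; exact: near_eq_derive.
Qed.

Lemma continuous_pos_within (f : R -> R) (a b : R) : 0 < a ->
  (forall r, 0 < r -> {for r, continuous f}) -> {within `[a, b], continuous f}.
Proof.
move=> a0 cf; apply: continuous_in_subspaceT => x; rewrite inE/= in_itv/= => /andP[ax _].
by apply: cf; exact: lt_le_trans ax.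
Qed.

Lemma primitive_from (f : R -> R) (a x : R) : 0 < a -> a < x ->
  (forall r, 0 < r -> {for r, continuous f}) ->
  is_derive x 1 (fun y => \int[mu]_(t in `[a, y]) f t)%R (f x).
Proof.
move=> a0 ax cf.
have xx1 : x < x + 1 by rewrite ltrDl.
have fi : mu.-integrable `[a, x + 1] (EFin \o f).
  apply: continuous_compact_integrable; first exact: segment_compact.
  exact: continuous_pos_within.
have [d <-] := continuous_FTC1_closed xx1 fi ax (cf _ (lt_trans a0 ax)).
split; [exact: d|exact/esym/derive1E].
Qed.

(** The integrands in view, [c p r / r] and [derive1 p r / r], need not be integrable at 0, so no
    base point serves all r > 0. *)
Lemma primitive_pos (f : R -> R) :
  (forall r, 0 < r -> {for r, continuous f}) ->
  exists F : R -> R, forall r : R, 0 < r -> is_derive r 1 F (f r).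
Proof.
move=> cf; pose G a y := (\int[mu]_(t in `[a, y]) f t)%R.
(* The base point moves with [r] and stays below both 1 and [r]; subtracting the value at 1 removes
   the dependence on it. *)
pose al (r : R) : R := Num.min 1 r / 2.
exists (fun r => G (al r) r - G (al r) 1) => r r0.
(* A base point fixed for the differentiation at [r]: with 4 in place of 2 it stays below [al y] for
   all [y] near [r]. *)
pose a0 : R := Num.min 1 r / 4.
have m0 : 0 < Num.min 1 r by rewrite lt_min ltr01.
have m1 : Num.min 1 r <= 1 by rewrite ge_min lexx.
have mr : Num.min 1 r <= r by rewrite ge_min lexx orbT.
have a00 : 0 < a0 by rewrite /a0; lra.
have H : is_derive r 1 (fun y => G a0 y - G a0 1) (f r).
  rewrite -[f r]subr0; apply: is_deriveB.
  by apply: primitive_from => //; rewrite /a0; lra.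
apply: near_eq_is_derive H; near=> y.
have yr : r / 2 < y by near: y; apply: lt_nbhsr; lra.
have aly : a0 < al y.
  have : a0 * 2 < Num.min 1 y by rewrite lt_min /a0; apply/andP; split; lra.
  by rewrite /al; lra.
have y0 : 0 < y by lra.
have mp : 0 < Num.min 1 y by rewrite lt_min ltr01.
have py1 : Num.min 1 y <= 1 by rewrite ge_min lexx.
have pyy : Num.min 1 y <= y by rewrite ge_min lexx orbT.
have al0 : 0 < al y by rewrite /al; lra.
have al1 : al y < 1 by rewrite /al; lra.
have aly' : al y < y by rewrite /al; lra.
(* Integrals from two base points differ by a constant, so this difference takes the same value at
   [y] and at 1. *)
have D (x : R) : al y < x -> is_derive x 1 (fun z => G a0 z - G (al y) z) 0.
  move=> xl; rewrite -[0](subrr (f x)).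
  by apply: is_deriveB; apply: primitive_from => //; lra.
suff : G a0 y - G (al y) y = G a0 1 - G (al y) 1 by lra.
apply/eqP; rewrite eq_le; have [y1|y1] := leP y 1.
  apply/andP; split.
    apply: (@derive_le (fun z => G a0 z - G (al y) z) (cst 0)) => // x /andP[x1 x2].
    by apply: D; lra.
  rewrite -lerN2.
  apply: (@derive_le (fun z => - (G a0 z - G (al y) z)) (cst 0)) => // x /andP[x1 x2].
  by rewrite -[cst 0 x]oppr0; apply: is_deriveN; apply: D; lra.
apply/andP; split; last first.
  apply: (@derive_le (fun z => G a0 z - G (al y) z) (cst 0)) => //; first exact: ltW.
  by move=> x /andP[x1 x2]; apply: D; lra.
rewrite -lerN2.
apply: (@derive_le (fun z => - (G a0 z - G (al y) z)) (cst 0)) => //; first exact: ltW.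
move=> x /andP[x1 x2].
by rewrite -[cst 0 x]oppr0; apply: is_deriveN; apply: D; lra.
Unshelve. all: by end_near. Qed.

Lemma Rintegral_FTC2 (f F : R -> R) (a b : R) : 0 < a -> a <= b ->
  (forall r, 0 < r -> {for r, continuous f}) ->
  (forall r : R, 0 < r -> is_derive r 1 F (f r)) ->
  (\int[mu]_(x in `[a, b]) f x)%R = F b - F a.
Proof.
move=> a0 ab cf dF; rewrite /Rintegral.
have -> : (\int[mu]_(x in `[a, b]) (f x)%:E = (F b - F a)%:E)%E; last by [].
apply: FTC2_within => //.
- by apply: continuous_pos_within => // r r0; exact: is_derive_continuous (dF _ r0).
- exact: continuous_pos_within.
- by move=> x /andP[ax _]; apply: dF; exact: lt_trans ax.
Qed.

Lemma oint_FTC2 (f F : R -> R) (a b : R) : 0 < a -> 0 < b ->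
  (forall r, 0 < r -> {for r, continuous f}) ->
  (forall r : R, 0 < r -> is_derive r 1 F (f r)) ->
  oint a b f = F b - F a.
Proof.
move=> a0 b0 cf dF; rewrite /oint; case: (leP a b) => ab; first exact: Rintegral_FTC2.
by rewrite (@Rintegral_FTC2 f F)// ?opprB// ltW.
Qed.

Lemma IVT_lt (f : R -> R) (a b v : R) : a < b ->
  (forall x, a <= x <= b -> {for x, continuous f}) ->
  f a < v < f b \/ f b < v < f a -> exists2 x, a < x < b & f x = v.
Proof.
move=> ab cf H.
have cw : {within `[a, b], continuous f}.
  by apply: continuous_in_subspaceT => x; rewrite inE/= in_itv/=; exact: cf.
have [|x] := @IVT R f a b v (ltW ab) cw.
  by rewrite ge_min le_max; case: H => /andP[h1 h2]; rewrite !(ltW h1, ltW h2) ?orbT.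
rewrite in_itv/= => /andP[ax xb] E; exists x => //.
rewrite !lt_neqAle ax xb !andbT; apply/andP; split; apply/eqP => x0.
  by move: H; rewrite x0 E ltxx; case => /andP[]; rewrite ?ltxx.
by move: H; rewrite -x0 E ltxx; case => /andP[]; rewrite ?ltxx.
Qed.

End real_calculus.

Section pressure_facts.
Context {R : realType} (p : R -> R) (hp : pressure p).

Lemma pressure_is_derive (r : R) : 0 < r -> is_derive r 1 p (derive1 p r).
Proof.
move=> r0; have [[p1 [p2 [_ _ _ dp _]]] _ _ _] := hp.
by rewrite derive1E (@derive_val _ _ _ _ _ _ _ (dp _ r0)); exact: dp.
Qed.

Lemma derive1_pressure_is_derive (r : R) : 0 < r ->
  is_derive r 1 (derive1 p) (derive1 (derive1 p) r).
Proof.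
move=> r0; have [[p1 [p2 [_ _ _ dp dp1]]] _ _ _] := hp.
have E : \forall y \near r, p1 y = derive1 p y.
  near=> y; have y0 : 0 < y by near: y; exact: lt_nbhsr.
  by rewrite derive1E (@derive_val _ _ _ _ _ _ _ (dp _ y0)).
have := near_eq_is_derive E (dp1 _ r0) => D.
by rewrite derive1E (@derive_val _ _ _ _ _ _ _ D).
Unshelve. all: by end_near. Qed.

Lemma derive1_pressure_continuous (r : R) : 0 < r ->
  {for r, continuous (derive1 p)}.
Proof. by move=> /derive1_pressure_is_derive; exact: is_derive_continuous. Qed.

Lemma derive1_pressure_gt0 (r : R) : 0 < r -> 0 < derive1 p r.
Proof. by have [_ _ h _] := hp; exact: h. Qed.

Lemma derive1_pressure_le (r s : R) : 0 < r -> r <= s -> derive1 p r <= derive1 p s.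
Proof.
move=> r0 rs; apply: (@derive_le R (derive1 p) (derive1 (derive1 p)) r s rs).
  by move=> x /andP[rx _]; apply: derive1_pressure_is_derive; exact: lt_le_trans rx.
by move=> x /andP[rx _]; have [_ _ _ h] := hp; apply: h; exact: lt_trans rx.
Qed.

Lemma pressure_lt (r s : R) : 0 < r -> r < s -> p r < p s.
Proof.
move=> r0 rs; apply: (@derive_lt _ _ (derive1 p)) => // x /andP[rx _].
  by apply: pressure_is_derive; exact: lt_le_trans rx.
by apply: derive1_pressure_gt0; exact: lt_trans rx.
Qed.

Lemma pressure_le (r s : R) : 0 < r -> r <= s -> p r <= p s.
Proof. by move=> r0; rewrite le_eqVlt => /predU1P[->//|/(pressure_lt r0)/ltW]. Qed.

Lemma pressure_slope (r s : R) : 0 < r -> r <= s ->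
  derive1 p r * (s - r) <= p s - p r <= derive1 p s * (s - r).
Proof.
move=> r0; rewrite le_eqVlt => /predU1P[->|rs]; first by rewrite !subrr !mulr0 lexx.
have [||x] := @MVT R p (derive1 p) r s rs.
- move=> x; rewrite in_itv/= => /andP[rx _]; apply: pressure_is_derive; exact: lt_trans rx.
- apply: (@continuous_pos_within _ _ r s r0) => y y0.
  exact: is_derive_continuous (pressure_is_derive y0).
- rewrite in_itv/= => /andP[rx xs] ->; rewrite !ler_pM2r ?subr_gt0//.
  by rewrite !derive1_pressure_le// ?(lt_trans r0) ?ltW.
Qed.

Lemma pressure_continuous (r : R) : 0 < r -> {for r, continuous p}.
Proof. by move=> /pressure_is_derive; exact: is_derive_continuous. Qed.

Lemma c_gt0 (r : R) : 0 < r -> 0 < c p r.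
Proof. by move=> r0; rewrite sqrtr_gt0 derive1_pressure_gt0. Qed.

Lemma c_sqr (r : R) : 0 < r -> c p r ^+ 2 = derive1 p r.
Proof. by move=> r0; rewrite sqr_sqrtr// ltW// derive1_pressure_gt0. Qed.

Lemma c_le (r s : R) : 0 < r -> r <= s -> c p r <= c p s.
Proof. by move=> r0 rs; apply: ler_wsqrtr; exact: derive1_pressure_le. Qed.

Lemma c_continuous (r : R) : 0 < r -> {for r, continuous (c p)}.
Proof.
move=> r0; apply: (@continuous_comp _ _ _ (derive1 p) Num.sqrt).
  exact: derive1_pressure_continuous.
exact: sqrt_continuous.
Qed.

End pressure_facts.

(** * The 1-Lax curve in terms of the velocity *)

Section lax_curve.
Context {R : realType} (p : R -> R) (hp : pressure p) (K : R -> R).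
Hypothesis dK : forall r : R, 0 < r -> is_derive r 1 K (c p r / r).
Implicit Types (u : R * R) (r s o : R).

(** The velocity drop across a 1-shock from density [o] to density [s], in terms of the specific
    volumes. *)
Definition shock_fall o s : R := Num.sqrt ((o^-1 - s^-1) * (p s - p o)).

(** The quotient q / rho along the 1-Lax curve. The minimum and the maximum switch off the inactive
    branch, so one formula covers both. Unlike [L1], it is strictly decreasing on the whole
    half-line, and [u.2] enters it only as an additive constant. *)
Definition velocity u r : R :=
  u.2 / u.1 - (K (Num.min r u.1) - K u.1) - shock_fall u.1 (Num.max r u.1).

Lemma velocity_rarefaction u r : r <= u.1 ->
  velocity u r = u.2 / u.1 - (K r - K u.1).
Proof.
by move=> ro; rewrite /velocity min_l// max_r// /shock_fall subrr mul0r sqrtr0 subr0.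
Qed.

Lemma velocity_shock u r : u.1 <= r ->
  velocity u r = u.2 / u.1 - shock_fall u.1 r.
Proof. by move=> ro; rewrite /velocity min_r// max_l// subrr subr0. Qed.

Lemma c_div_continuous (r : R) : 0 < r -> {for r, continuous (fun s => c p s / s)}.
Proof.
move=> r0; apply: cvgM; first exact: c_continuous.
by apply: cvgV => //; rewrite gt_eqF.
Qed.

Lemma L1_velocity u r : 0 < u.1 -> 0 < r -> L1 p u r = r * velocity u r.
Proof.
move=> o0 r0; rewrite /L1; case: (leP r u.1) => ro.
  rewrite velocity_rarefaction// (@oint_FTC2 _ _ K)//; last exact: c_div_continuous.
  by ring.
have rr : r = Num.sqrt (r ^+ 2) by rewrite sqrtr_sqr ger0_norm ?ltW.
rewrite velocity_shock ?ltW// /shock_fall.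
suff -> : Num.sqrt (r / u.1 * (r - u.1) * (p r - p u.1)) =
    r * Num.sqrt ((u.1^-1 - r^-1) * (p r - p u.1)) by ring.
rewrite [X in X * Num.sqrt _]rr -sqrtrM ?sqr_ge0//; congr Num.sqrt.
by field; rewrite !gt_eqF.
Qed.

Lemma K_lt r s : 0 < r -> r < s -> K r < K s.
Proof.
move=> r0 rs; apply: (@derive_lt R K (fun s => c p s / s) r s rs).
  by move=> x /andP[rx _]; apply: dK; exact: lt_le_trans rx.
move=> x /andP[rx _]; have x0 : 0 < x by exact: lt_trans rx.
by rewrite divr_gt0// c_gt0.
Qed.

Lemma K_le r s : 0 < r -> r <= s -> K r <= K s.
Proof. by move=> r0; rewrite le_eqVlt => /predU1P[->//|/(K_lt r0)/ltW]. Qed.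

Lemma shock_arg_ge0 o s : 0 < o -> o <= s -> 0 <= (o^-1 - s^-1) * (p s - p o).
Proof.
move=> o0 os; have s0 : 0 < s by exact: lt_le_trans os.
by rewrite mulr_ge0// subr_ge0 ?lef_pV2 ?posrE//; exact: (pressure_le hp).
Qed.

Lemma shock_fall_lt o s t : 0 < o -> o <= s -> s < t -> shock_fall o s < shock_fall o t.
Proof.
move=> o0 os st; have s0 : 0 < s by exact: lt_le_trans os.
have t0 : 0 < t by exact: lt_trans st.
have ot : o < t by exact: le_lt_trans st.
rewrite /shock_fall ltr_sqrt; last first.
  by rewrite mulr_gt0// subr_gt0 ?ltf_pV2 ?posrE//; exact: (pressure_lt hp).
have h1 : o^-1 - s^-1 < o^-1 - t^-1 by rewrite ltrD2l ltrN2 ltf_pV2 ?posrE.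
have h2 : p s - p o < p t - p o by rewrite ltrD2r; exact: (pressure_lt hp).
apply: ltr_pM => //; first by rewrite subr_ge0 lef_pV2 ?posrE.
by rewrite subr_ge0; exact: (pressure_le hp).
Qed.

Lemma shock_fall_le o s t : 0 < o -> o <= s -> s <= t -> shock_fall o s <= shock_fall o t.
Proof. by move=> o0 os; rewrite le_eqVlt => /predU1P[->//|/(shock_fall_lt o0 os)/ltW]. Qed.

Lemma velocity_lt u r s : 0 < u.1 -> 0 < r -> r < s -> velocity u s < velocity u r.
Proof.
move=> o0 r0 rs; have s0 : 0 < s by exact: lt_trans rs.
rewrite /velocity; have /orP[ro|ro] : (r < u.1) || (u.1 <= r) by case: ltP.
  have h1 : K (Num.min r u.1) < K (Num.min s u.1).
    by apply: K_lt; rewrite ?lt_min ?ge_min ?r0 ?o0// min_l ?(ltW ro)// rs ro.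
  have h2 : shock_fall u.1 (Num.max r u.1) <= shock_fall u.1 (Num.max s u.1).
    apply: shock_fall_le => //; first by rewrite le_max lexx orbT.
    by rewrite max_r ?(ltW ro)// le_max lexx orbT.
  lra.
have us : u.1 <= s by rewrite (le_trans ro)// ltW.
rewrite !min_r// !max_l//; have := shock_fall_lt o0 ro rs; lra.
Qed.

Lemma velocity_le u r s : 0 < u.1 -> 0 < r -> r <= s -> velocity u s <= velocity u r.
Proof. by move=> o0 r0; rewrite le_eqVlt => /predU1P[->//|/(velocity_lt o0 r0)/ltW]. Qed.

Lemma shock_fall_continuous o s : 0 < o -> 0 < s -> {for s, continuous (shock_fall o)}.
Proof.
move=> o0 s0; apply: (@continuous_comp _ _ _
  (fun s => (o^-1 - s^-1) * (p s - p o)) Num.sqrt); last exact: sqrt_continuous.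
apply: cvgM; apply: cvgB; try exact: cvg_cst.
  by apply: cvgV; rewrite ?gt_eqF.
exact: (pressure_continuous hp).
Qed.

Lemma velocity_continuous u r : 0 < u.1 -> 0 < r -> {for r, continuous (velocity u)}.
Proof.
move=> o0 r0; apply: cvgB.
  apply: cvgB; first exact: cvg_cst.
  apply: cvgB; last exact: cvg_cst.
  apply: (@continuous_comp _ _ _ (fun r => Num.min r u.1) K).
    by apply: continuous_min; [exact: cvg_id|exact: cvg_cst].
  by apply: is_derive_continuous (dK _); rewrite lt_min r0.
apply: (@continuous_comp _ _ _ (fun r => Num.max r u.1) (shock_fall u.1)).
  by apply: continuous_max; [exact: cvg_id|exact: cvg_cst].
by apply: shock_fall_continuous => //; rewrite lt_max r0.
Qed.

Lemma velocity_shift (o q e r : R) : 0 < o ->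
  velocity (o, q - e * o) r = velocity (o, q) r - e.
Proof. by move=> o0; rewrite /velocity/= mulrBl mulfK ?gt_eqF//; ring. Qed.

Lemma velocity0 u : velocity u u.1 = u.2 / u.1.
Proof. by rewrite velocity_rarefaction// subrr subr0. Qed.

Lemma A0P u : A0 p u <-> 0 < u.1 /\ - c p u.1 < u.2 / u.1 < c p u.1.
Proof.
rewrite /A0/= /lambda1 /lambda2; split => [[? ? ?]|[? /andP[? ?]]].
  by split=> //; apply/andP; split; lra.
by split => //; lra.
Qed.

Lemma is_phi_hat_lP u r : 0 < u.1 ->
  is_phi_hat_l p u r <-> 0 < r /\ velocity u r = c p r.
Proof.
move=> o0; rewrite /is_phi_hat_l /lambda1/=.
split=> -[r0]; rewrite L1_velocity// mulrAC mulfV ?gt_eqF// mul1r => E; split=> //; lra.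
Qed.

Lemma is_phi_check_lP u r : 0 < u.1 ->
  is_phi_check_l p u r <-> 0 < r /\ velocity u r = - c p r.
Proof.
move=> o0; rewrite /is_phi_check_l /lambda2/=.
split=> -[r0]; rewrite L1_velocity// mulrAC mulfV ?gt_eqF// mul1r => E; split=> //; lra.
Qed.

Hypothesis hphi : phi_well_defined p.

Lemma phi_hat_lP u : A0 p u ->
  [/\ 0 < phi_hat_l p u, phi_hat_l p u < u.1 &
      velocity u (phi_hat_l p u) = c p (phi_hat_l p u)].
Proof.
move=> u0; have [ o0 uo] := (A0P u).1 u0; have [[r [hr _]] _] := hphi u0.
have [h0 hE] : 0 < phi_hat_l p u /\ velocity u (phi_hat_l p u) = c p (phi_hat_l p u).
  by apply/is_phi_hat_lP => //; exact: (getPex (ex_intro _ r hr)).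
split=> //; rewrite ltNge; apply/negP => uh.
have := velocity_le o0 o0 uh; have := c_le hp o0 uh; rewrite velocity0; lra.
Qed.

(** Since the velocity decreases and [c p] does not, their difference changes sign only once. The
    sum [velocity + c] has no such monotony, which is why [phi_check_l] requires a different
    argument. *)
Lemma velocity_lt_c u r : A0 p u -> 0 < r -> (velocity u r < c p r) = (phi_hat_l p u < r).
Proof.
move=> u0 r0; have [ o0 _] := (A0P u).1 u0; have [h0 _ hE] := phi_hat_lP u0.
apply/idP/idP => H.
  rewrite ltNge; apply/negP => rh.
  have := velocity_le o0 r0 rh; have := c_le hp r0 rh; lra.
have := velocity_lt o0 h0 H; have := c_le hp h0 (ltW H); lra.
Qed.

Lemma velocity_le_c u r : A0 p u -> 0 < r -> (velocity u r <= c p r) = (phi_hat_l p u <= r).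
Proof.
move=> u0 r0; have [ o0 _] := (A0P u).1 u0; have [h0 _ hE] := phi_hat_lP u0.
apply/idP/idP => H.
  rewrite leNgt; apply/negP => rh.
  have := velocity_lt o0 r0 rh; have := c_le hp r0 (ltW rh); lra.
have := velocity_le o0 h0 H; have := c_le hp h0 H; lra.
Qed.

(* [velocity u r + c p r] depends on [u.2] only through an additive constant, so
   uniqueness of phi_check_l for every state of A0 forbids that it takes any
   value of ]- c, c[ twice, or without crossing it. *)
Lemma check_unique u (y r s : R) : 0 < u.1 -> - c p u.1 < y < c p u.1 ->
  0 < r -> 0 < s ->
  velocity (u.1, 0) r + c p r = y -> velocity (u.1, 0) s + c p s = y -> r = s.
Proof.
move=> o0 /andP[y1 y2] r0 s0 er es.
have uA : A0 p (u.1, 0 - y * u.1).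
  by apply/A0P; split => //=; rewrite sub0r mulNr mulfK ?gt_eqF// ltrN2 y2 ltrNl y1.
have [_ [t [_ tu]]] := hphi uA.
have H z : 0 < z -> velocity (u.1, 0) z + c p z = y -> t = z.
  move=> z0 ez; apply: tu; apply/is_phi_check_lP => //; split => //.
  by rewrite velocity_shift//; lra.
by rewrite -(H r)// -(H s).
Qed.

Lemma check_exists u (y : R) : 0 < u.1 -> - c p u.1 < y < c p u.1 ->
  exists2 r, 0 < r & velocity (u.1, 0) r + c p r = y.
Proof.
move=> o0 /andP[y1 y2].
(* A state of the same density with velocity [- y]; the point where its curve meets lambda2 = 0 is
   the density sought. *)
have uA : A0 p (u.1, 0 - y * u.1).
  by apply/A0P; split => //=; rewrite sub0r mulNr mulfK ?gt_eqF// ltrN2 y2 ltrNl y1.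
have [_ [t [/is_phi_check_lP[//|t0]]]] := hphi uA.
by rewrite velocity_shift// => E _; exists t => //; lra.
Qed.

Lemma velocityE u r : 0 < u.1 -> velocity u r = velocity (u.1, 0) r + u.2 / u.1.
Proof. by move=> o0; rewrite /velocity/= mul0r; ring. Qed.

Lemma speed_continuous u r : 0 < u.1 -> 0 < r ->
  {for r, continuous (fun r => velocity (u.1, 0) r + c p r)}.
Proof. by move=> o0 r0; apply: cvgD; [exact: velocity_continuous|exact: c_continuous]. Qed.

(** The continuous function [M] equals [c p u.1] at [u.1] and takes each value of ]- c, c[ exactly
    once. It therefore crosses the level [y] once, downwards, and to the right of [u.1]. *)
Lemma phi_check_lP u : A0 p u ->
  [/\ u.1 < phi_check_l p u,
      velocity u (phi_check_l p u) = - c p (phi_check_l p u) &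
      forall r, 0 < r -> (- c p r < velocity u r) = (r < phi_check_l p u)].
Proof.
move=> u0; have [ o0 /andP[uo1 uo2]] := (A0P u).1 u0; have [_ [r0 [hr _]]] := hphi u0.
set k := phi_check_l p u.
have [k0 kE] : 0 < k /\ velocity u k = - c p k.
  by apply/is_phi_check_lP => //; exact: (getPex (ex_intro _ r0 hr)).
pose M r := velocity (u.1, 0) r + c p r.
pose y := - (u.2 / u.1).
have yA : (- c p u.1 < y) && (y < c p u.1) by rewrite /y; apply/andP; split; lra.
have [y1 y2] := andP yA.
have Mk : M k = y by rewrite /M /y; have := velocityE k o0; lra.
have Mo : M u.1 = c p u.1 by rewrite /M (velocity0 (u.1, 0))/= mul0r add0r.
have co := c_gt0 hp o0.
have Mc r : 0 < r -> {for r, continuous M} by move=> ?; exact: speed_continuous.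
have uniq r : 0 < r -> M r = y -> r = k.
  by move=> r1 Er; exact: (check_unique o0 yA).
have ok : u.1 < k.
  (* The level is made negative because [M] is positive on ]0, u.1], where the velocity of the datum
     at rest is nonnegative. Hence [z] lies to the right of [u.1] with [M z <= y], and the
     intermediate value theorem places the root there. *)
  have [z z0 zE] : exists2 z, 0 < z & M z = Num.min y (- c p u.1 / 2).
    by apply: check_exists => //; rewrite lt_min gt_min; apply/andP; split;
      [apply/andP; split; lra|rewrite y2].
  have zy : M z <= y by rewrite zE ge_min lexx.
  have zn : M z < 0 by rewrite zE gt_min; apply/orP; right; lra.
  have oz : u.1 < z.
    rewrite ltNge; apply/negP => zo; have := velocity_le (u := (u.1, 0)) o0 z0 zo.
    rewrite (velocity0 (u.1, 0))/= mul0r => h.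
    by move: zn; rewrite /M ltNge (addr_ge0 h (ltW (c_gt0 hp z0))).
  move: zy; rewrite le_eqVlt => /predU1P[/(uniq _ z0) <-//|zy].
  have [||w /andP[w1 w2] wE] := @IVT_lt R M u.1 z y oz.
  - by move=> x /andP[ox _]; apply: Mc; exact: lt_le_trans ox.
  - by right; rewrite zy Mo.
  - by rewrite -(uniq w) ?(lt_trans o0).
have yM r : 0 < r -> r < k -> y < M r.
  move=> r1 rk; rewrite ltNge; apply/negP; rewrite le_eqVlt => /predU1P[/(uniq _ r1)|My].
    by move=> E; rewrite E ltxx in rk.
  have [ro|] := ltP r u.1.
    have [||w /andP[w1 w2] wE] := @IVT_lt R M r u.1 y ro.
    - by move=> x /andP[ox _]; apply: Mc; exact: lt_le_trans ox.
    - by left; rewrite My Mo.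
    - by move: (lt_trans w2 ok); rewrite (uniq w (lt_trans r1 w1) wE) ltxx.
  rewrite le_eqVlt => /predU1P[E|ro].
    by move: My; rewrite -E Mo ltNge ltW.
  have [||w /andP[w1 w2] wE] := @IVT_lt R M u.1 r y ro.
  - by move=> x /andP[ox _]; apply: Mc; exact: lt_le_trans ox.
  - by right; rewrite My Mo.
  - by move: (lt_trans w2 rk); rewrite (uniq w (lt_trans o0 w1) wE) ltxx.
have My r : k <= r -> M r <= y.
  rewrite le_eqVlt => /predU1P[<-|kr]; first by rewrite Mk.
  have r1 : 0 < r by exact: lt_trans kr.
  rewrite leNgt; apply/negP => yMr.
  (* If [M] rose above [y] again, this intermediate level would be attained once before [k] and once
     after it. *)
  pose z := (y + Num.min (M r) (c p u.1)) / 2.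
  have m1 : Num.min (M r) (c p u.1) <= M r by rewrite ge_min lexx.
  have m2 : Num.min (M r) (c p u.1) <= c p u.1 by rewrite ge_min lexx orbT.
  have m3 : y < Num.min (M r) (c p u.1) by rewrite lt_min yMr.
  have [z1 z2] := midf_lt m3; rewrite -/z in z1 z2.
  have zc := lt_le_trans z2 m2.
  have [||w /andP[w1 w2] wE] := @IVT_lt R M u.1 k z ok.
  - by move=> x /andP[ox _]; apply: Mc; exact: lt_le_trans ox.
  - by right; rewrite Mk Mo z1 zc.
  have [||w' /andP[w3 w4] wE'] := @IVT_lt R M k r z kr.
  - by move=> x /andP[ox _]; apply: Mc; exact: lt_le_trans ox.
  - by left; rewrite Mk z1 (lt_le_trans z2 m1).
  have E : w = w'.
    apply: (@check_unique u z) => //; last 2 first.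
    - exact: lt_trans w1.
    - exact: lt_trans w3.
    - by rewrite (lt_trans y1 z1) zc.
  by have := lt_trans w2 w3; rewrite E ltxx.
have key r : (y < M r) = (- c p r < velocity u r).
  by rewrite -subr_gt0 -[RHS]subr_gt0 /M /y (velocityE r o0); congr (0 < _); ring.
split=> // r r1; rewrite -key; apply/idP/idP => [H|]; last exact: yM.
by rewrite ltNge; apply/negP => /My; rewrite leNgt H.
Qed.

Lemma velocity_ge_Nc u r : A0 p u -> 0 < r -> (- c p r <= velocity u r) = (r <= phi_check_l p u).
Proof.
move=> u0 r0; have [ o0 _] := (A0P u).1 u0; have [uk kE kP] := phi_check_lP u0.
rewrite [RHS]le_eqVlt -kP// le_eqVlt; apply/orP/orP => -[/eqP E|H]; try by right.
  left; apply/eqP; have [_ [t [_ tu]]] := hphi u0.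
  rewrite -(tu r); last by apply/is_phi_check_lP.
  by rewrite -(tu (phi_check_l p u))//; apply/is_phi_check_lP => //; split => //; exact: lt_trans uk.
by left; rewrite E kE.
Qed.

End lax_curve.

(** * Monotony of momentum and energy along the Lax curve *)

Section lax_curve_monotony.
Context {R : realType} (p : R -> R) (hp : pressure p) (K H : R -> R).
Hypothesis dK : forall r : R, 0 < r -> is_derive r 1 K (c p r / r).
Hypothesis dH : forall r : R, 0 < r -> is_derive r 1 H (derive1 p r / r).
Implicit Types (u : R * R) (r s o : R).

Lemma derive_le_within (f f' : R -> R) (a b : R) : a <= b ->
  {within `[a, b], continuous f} ->
  (forall x : R, a < x < b -> is_derive x 1 f (f' x)) ->
  (forall x, a < x < b -> 0 <= f' x) -> f a <= f b.
Proof.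
rewrite le_eqVlt => /predU1P[->//|ab] cf df f'0.
have D x : x \in `]a, b[ -> is_derive x 1 f (f' x) by rewrite in_itv/=; exact: df.
have [x] := @MVT R f f' a b ab D cf.
by rewrite in_itv/= => xab E; rewrite -subr_ge0 E mulr_ge0 ?f'0// subr_ge0 ltW.
Qed.

Lemma shock_fall_mulE o s : 0 < o -> o <= s ->
  s * shock_fall p o s = Num.sqrt ((s - o) * (p s - p o) * s / o).
Proof.
move=> o0 os; have s0 : 0 < s by exact: lt_le_trans os.
have ss : s = Num.sqrt (s ^+ 2) by rewrite sqrtr_sqr ger0_norm ?ltW.
rewrite [X in X * shock_fall _ _ _]ss -sqrtrM ?sqr_ge0//; congr Num.sqrt.
by field; rewrite !gt_eqF.
Qed.

(** Convexity bounds the pressure jump below by its tangent, and s / o >= 1. Since a subsonic datum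
    has velocity less than [c p o], this loss outweighs the linear growth of the momentum. *)
Lemma shock_fall_ge o s : 0 < o -> o <= s -> c p o * (s - o) <= s * shock_fall p o s.
Proof.
move=> o0 os; have s0 : 0 < s by exact: lt_le_trans os.
have so : 0 <= s - o by rewrite subr_ge0.
rewrite shock_fall_mulE//.
have -> : c p o * (s - o) = Num.sqrt ((c p o * (s - o)) ^+ 2).
  by rewrite sqrtr_sqr ger0_norm// mulr_ge0// ltW// c_gt0.
rewrite ler_wsqrtr// exprMn (c_sqr hp o0).
have /andP[h _] := pressure_slope hp o0 os.
have dp0 := derive1_pressure_gt0 hp o0.
have h1 : derive1 p o * (s - o) ^+ 2 <= (s - o) * (p s - p o).
  by rewrite expr2 mulrA mulrC ler_wpM2l.
apply: (le_trans h1); rewrite -mulrA ler_peMr//.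
  by rewrite mulr_ge0// (le_trans _ h)// mulr_ge0// ltW.
by rewrite ler_pdivlMr// mul1r.
Qed.

Lemma pressure_slope_le o r s : 0 < o -> o <= r -> r <= s ->
  (p r - p o) * (s - o) <= (p s - p o) * (r - o).
Proof.
move=> o0 or rs; have r0 : 0 < r by exact: lt_le_trans or.
have /andP[_ h1] := pressure_slope hp o0 or.
have /andP[h2 _] := pressure_slope hp r0 rs.
have ro : 0 <= r - o by rewrite subr_ge0.
have sr : 0 <= s - r by rewrite subr_ge0.
have h3 : (p r - p o) * (s - r) <= (p s - p r) * (r - o).
  apply: (@le_trans _ _ (derive1 p r * (r - o) * (s - r))); first exact: ler_wpM2r.
  by rewrite mulrAC ler_wpM2r.
have -> : (p r - p o) * (s - o) = (p r - p o) * (s - r) + (p r - p o) * (r - o) by ring.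
have -> : (p s - p o) * (r - o) = (p s - p r) * (r - o) + (p r - p o) * (r - o) by ring.
by rewrite lerD2r.
Qed.

(** The squared quotient of [s * shock_fall p o s] by s - o is a chord slope of [p] times s / o, a
    product of nondecreasing factors. Denominators are cleared so that s = o is allowed. *)
Lemma shock_fall_slope_le o r s : 0 < o -> o <= r -> r <= s ->
  (s - o) * (r * shock_fall p o r) <= (r - o) * (s * shock_fall p o s).
Proof.
move=> o0 or rs; have os := le_trans or rs.
have r0 : 0 < r by exact: lt_le_trans or.
have s0 : 0 < s by exact: lt_le_trans os.
have ro : 0 <= r - o by rewrite subr_ge0.
have so : 0 <= s - o by rewrite subr_ge0.
have pr : 0 <= p r - p o by rewrite subr_ge0; exact: (pressure_le hp).
have ps : 0 <= p s - p o by rewrite subr_ge0; exact: (pressure_le hp).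
rewrite !shock_fall_mulE//.
have nn x y : 0 <= x -> x * Num.sqrt y = Num.sqrt (x ^+ 2 * y).
  by move=> x0; rewrite sqrtrM ?sqr_ge0// sqrtr_sqr ger0_norm.
rewrite !nn//; apply: ler_wsqrtr; rewrite !mulrA ler_pM2r ?invr_gt0//.
have -> : (s - o) ^+ 2 * (r - o) * (p r - p o) * r =
  (s - o) * (r - o) * (((p r - p o) * (s - o)) * r) by ring.
have -> : (r - o) ^+ 2 * (s - o) * (p s - p o) * s =
  (s - o) * (r - o) * (((p s - p o) * (r - o)) * s) by ring.
rewrite ler_wpM2l ?mulr_ge0//; apply: ler_pM => //; first exact: mulr_ge0.
  exact: ltW.
exact: pressure_slope_le.
Qed.

Hypothesis hphi : phi_well_defined p.

(** The derivative is [lambda1]: it gives the sign needed for monotony, and later the speed of the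
    fronts composing a rarefaction. *)
Lemma L1_rarefaction_is_derive u r : 0 < u.1 -> 0 < r ->
  is_derive r 1 (fun r => r * (u.2 / u.1 - (K r - K u.1)))
    ((u.2 / u.1 - (K r - K u.1)) - c p r).
Proof.
move=> o0 r0; have dKr := dK r0.
apply: (is_derive_eqf (is_derive_mulf (is_derive_idf r) (is_derive_subf
  (is_derive_cstf (u.2 / u.1) r) (is_derive_subf dKr (is_derive_cstf (K u.1) r))))) => //.
by rewrite /=; field; rewrite !gt_eqF.
Qed.

Lemma L1_rarefaction u r : 0 < u.1 -> 0 < r -> r <= u.1 ->
  L1 p u r = r * (u.2 / u.1 - (K r - K u.1)).
Proof. by move=> o0 r0 ro; rewrite (L1_velocity hp dK)// velocity_rarefaction. Qed.

Lemma L1_at u : 0 < u.1 -> L1 p u u.1 = u.2.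
Proof. by move=> o0; rewrite (L1_velocity hp dK)// (velocity0 p K) mulrCA mulfV ?mulr1 ?gt_eqF. Qed.

Lemma L1_lt_rarefaction u r s : A0 p u -> phi_hat_l p u <= r -> r < s -> s <= u.1 ->
  L1 p u s < L1 p u r.
Proof.
move=> u0 hr rs so; have [ o0 _] := (A0P p u).1 u0.
have [h0 _ _] := phi_hat_lP hp dK hphi u0.
have r0 : 0 < r by exact: lt_le_trans hr.
have s0 : 0 < s by exact: lt_trans rs.
rewrite !L1_rarefaction//; last by rewrite ltW// (lt_le_trans rs).
rewrite -ltrN2.
apply: (@derive_lt _ (fun r => - (r * (u.2 / u.1 - (K r - K u.1))))
   (fun r => - ((u.2 / u.1 - (K r - K u.1)) - c p r)) r s rs) => x /andP[rx xs].
  have x0 : 0 < x by exact: lt_le_trans rx.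
  exact: (is_deriveN (L1_rarefaction_is_derive o0 x0)).
have x0 : 0 < x by exact: lt_trans rx.
rewrite oppr_gt0 subr_lt0 -(velocity_rarefaction p K) ?(velocity_lt_c hp dK hphi)//.
  exact: le_lt_trans rx.
by rewrite ltW// (lt_le_trans xs).
Qed.

Lemma L1_lt_shock u r s : A0 p u -> u.1 <= r -> r < s -> L1 p u s < L1 p u r.
Proof.
move=> u0 or rs; have [ o0 /andP[_ vc]] := (A0P p u).1 u0.
have r0 : 0 < r by exact: lt_le_trans or.
have s0 : 0 < s by exact: lt_trans rs.
have os : u.1 < s by exact: le_lt_trans rs.
rewrite !(L1_velocity hp dK)// !velocity_shock// ?(ltW os)// !mulrBr.
have h1 := shock_fall_slope_le o0 or (ltW rs).
have h2 := shock_fall_ge o0 (ltW os).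
have h3 : u.2 / u.1 * (s - r) < c p u.1 * (s - r) by rewrite ltr_pM2r// subr_gt0.
have so : 0 < s - u.1 by rewrite subr_gt0.
(* The chord property transfers the lower bound on the loss between [u.1] and [s] to the increment
   between [r] and [s]. *)
have h4 : c p u.1 * (s - r) <= s * shock_fall p u.1 s - r * shock_fall p u.1 r.
  rewrite -(ler_pM2l so) [leRHS]mulrBr.
  apply: (@le_trans _ _ ((s - u.1) * (s * shock_fall p u.1 s) -
    (r - u.1) * (s * shock_fall p u.1 s))); last by rewrite lerD2l lerN2.
  rewrite -mulrBl (_ : s - u.1 - (r - u.1) = s - r); last by ring.
  rewrite mulrA [X in X <= _]mulrC; apply: ler_wpM2l; first by rewrite subr_ge0 ltW.
  by rewrite mulrC.
by move: h3 h4; lra.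
Qed.

Lemma L1_lt u r s : A0 p u -> phi_hat_l p u <= r -> r < s -> L1 p u s < L1 p u r.
Proof.
move=> u0 hr rs; have [so|os] := leP s u.1; first exact: L1_lt_rarefaction.
have [ro|or] := ltP r u.1; last exact: L1_lt_shock.
apply: (@lt_trans _ _ (L1 p u u.1)); first exact: L1_lt_shock.
exact: L1_lt_rarefaction.
Qed.

Lemma L1_le u r s : A0 p u -> phi_hat_l p u <= r -> r <= s -> L1 p u s <= L1 p u r.
Proof. by move=> u0 hr; rewrite le_eqVlt => /predU1P[->//|/(L1_lt u0 hr)/ltW]. Qed.

Lemma L1_continuous u r : 0 < u.1 -> 0 < r -> {for r, continuous (L1 p u)}.
Proof.
move=> o0 r0; have E : \forall s \near r, s * velocity p K u s = L1 p u s.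
  near=> s; rewrite (L1_velocity hp dK)//; near: s; exact: lt_nbhsr.
rewrite /prop_for /continuous_at -(nbhs_singleton E).
apply: cvg_trans; first exact: (near_eq_cvg E).
by apply: cvgM; [exact: cvg_id|exact: (velocity_continuous hp dK)].
Unshelve. all: by end_near. Qed.

(** By the definition of [c], the derivative of [H] is [c p] times that of [K], and [c p] is at
    least [c p r] to the right of [r]. *)
Lemma H_ge r s : 0 < r -> r <= s -> c p r * (K s - K r) <= H s - H r.
Proof.
move=> r0 rs.
suff : H r - c p r * K r <= H s - c p r * K s by rewrite mulrBr; lra.
apply: (@derive_le _ (fun x => H x - c p r * K x)
  (fun x => derive1 p x / x - c p r * (c p x / x)) r s rs) => x /andP[rx _].
  have x0 : 0 < x by exact: lt_le_trans rx.
  have h := dH x0; have k := dK x0.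
  exact: (is_deriveB h (is_deriveZ (c p r) k)).
have x0 : 0 < x by exact: lt_trans rx.
rewrite -(c_sqr hp x0) expr2 subr_ge0 -mulrA; apply: ler_wpM2r.
  by rewrite divr_ge0 ?ltW ?c_gt0.
by apply: (c_le hp) => //; exact: ltW.
Qed.

(** The left side is the kinetic energy lost by a flow that is sonic at density [r] when it is
    compressed to density [s] at constant flux. Beyond the sonic point the sum of kinetic energy and
    [H] increases, which is the inequality. *)
Lemma H_ge_sqr r s : 0 < r -> r <= s ->
  c p r ^+ 2 * (1 - r ^+ 2 / s ^+ 2) / 2 <= H s - H r.
Proof.
move=> r0 rs; have s0 : 0 < s by exact: lt_le_trans rs.
pose k := c p r ^+ 2 * r ^+ 2 / 2.
suff : H r + k * (r ^- 2) <= H s + k * (s ^- 2).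
  have -> : c p r ^+ 2 * (1 - r ^+ 2 / s ^+ 2) / 2 = k * r ^- 2 - k * s ^- 2.
    by rewrite /k; field; rewrite !gt_eqF.
  by move: (k * _) (k * _) => a b; lra.
apply: (@derive_le _ (fun x => H x + k * (x ^- 2))
  (fun x => derive1 p x / x + k * (- 2 * x ^- 3)) r s rs) => x /andP[rx _].
  have x0 : 0 < x by exact: lt_le_trans rx.
  have h := dH x0.
  have x2 : x ^+ 2 != 0 by rewrite expf_neq0// gt_eqF.
  apply: (is_derive_eqf (is_derive_addf h (is_derive_scalef k (@is_derive_invf _
    (fun y => y ^+ 2) _ _ x2 (is_derive_sqrf (is_derive_idf x)))))) => //.
  by rewrite /=; field; rewrite !gt_eqF.
have x0 : 0 < x by exact: lt_trans rx.
have -> : derive1 p x / x + k * (- 2 * x ^- 3) = (derive1 p x * x ^+ 2 - c p r ^+ 2 * r ^+ 2) / x ^+ 3.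
  by rewrite /k; field; rewrite gt_eqF.
apply: divr_ge0; last by rewrite exprn_ge0 ?ltW.
rewrite subr_ge0 -(c_sqr hp x0).
have cx : c p r <= c p x by apply: (c_le hp) => //; exact: ltW.
have c0 := ltW (c_gt0 hp r0); have r0' := ltW r0; have x0' := ltW x0.
have l1 : c p r ^+ 2 <= c p x ^+ 2 by rewrite !expr2; apply: ler_pM.
have l2 : r ^+ 2 <= x ^+ 2 by rewrite !expr2; apply: ler_pM => //; exact: ltW.
by apply: ler_pM => //; exact: sqr_ge0.
Qed.

Lemma H_lt r s : 0 < r -> r < s -> H r < H s.
Proof.
move=> r0 rs; apply: (@derive_lt _ H (fun x => derive1 p x / x) r s rs) => x /andP[rx _].
  by apply: dH; exact: lt_le_trans rx.
have x0 : 0 < x by exact: lt_trans rx.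
by rewrite divr_gt0// derive1_pressure_gt0.
Qed.

Lemma H_le r s : 0 < r -> r <= s -> H r <= H s.
Proof. by move=> r0; rewrite le_eqVlt => /predU1P[->//|/(H_lt r0)/ltW]. Qed.

Lemma H_continuous r : 0 < r -> {for r, continuous H}.
Proof. by move=> /dH; exact: is_derive_continuous. Qed.

(** The value of the first integral on the stationary flow issued from the point of density [r] of
    the Lax curve. *)
Definition bernoulli u r : R := velocity p K u r ^+ 2 / 2 + H r.

(** With [d] the increment of [K], the velocity loses [d], so the kinetic energy loses at most V d,
    while [H] gains at least c d, and V <= c from [phi_hat_l] on. *)
Lemma bernoulli_le_rarefaction u r s : A0 p u -> phi_hat_l p u <= r -> r <= s ->
  s <= u.1 -> bernoulli u r <= bernoulli u s.
Proof.
move=> u0 hr rs so; have [h0 _ _] := phi_hat_lP hp dK hphi u0.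
have r0 : 0 < r by exact: lt_le_trans hr.
have vc : velocity p K u r <= c p r by rewrite (velocity_le_c hp dK hphi).
have HK := H_ge r0 rs.
have d0 : 0 <= K s - K r by rewrite subr_ge0; exact: (K_le hp dK).
have E : velocity p K u s = velocity p K u r - (K s - K r).
  by rewrite !velocity_rarefaction//; [ring|exact: le_trans so].
rewrite /bernoulli E; set V := velocity _ _ _ _ in vc *; set d := K s - K r in HK d0 *.
have h1 : V * d <= c p r * d by rewrite ler_wpM2r.
have h2 : 0 <= d ^+ 2 by exact: sqr_ge0.
have -> : (V - d) ^+ 2 = V ^+ 2 - 2 * (V * d) + d ^+ 2 by ring.
by move: h1 h2 HK; lra.
Qed.

Lemma shock_fall_is_derive o x : 0 < o -> o < x ->
  is_derive x 1 (shock_fall p o)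
    (((p x - p o) / x ^+ 2 + (o^-1 - x^-1) * derive1 p x) / (2 * shock_fall p o x)).
Proof.
move=> o0 ox; have x0 : 0 < x by exact: lt_trans ox.
have dp := pressure_is_derive hp x0.
have xn : x != 0 by rewrite gt_eqF.
have dg := is_derive_mulf (is_derive_subf (is_derive_cstf o^-1 x) (is_derive_inv xn))
  (is_derive_subf dp (is_derive_cstf (p o) x)).
have g0 : 0 < (o^-1 - x^-1) * (p x - p o).
  by rewrite mulr_gt0// subr_gt0 ?ltf_pV2 ?posrE//; exact: (pressure_lt hp).
apply: (is_derive_eqf (@is_derive1_comp R Num.sqrt _ x _ _ (is_derive1_sqrt g0) dg)) => //.
rewrite /= -/(shock_fall p o x) mulrC; congr (_ / _).
by field; rewrite !gt_eqF.
Qed.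

Lemma bernoulli_is_derive_shock u x : 0 < u.1 -> u.1 < x ->
  is_derive x 1 (bernoulli u) (derive1 p x / x - velocity p K u x *
    (((p x - p u.1) / x ^+ 2 + (u.1^-1 - x^-1) * derive1 p x) / (2 * shock_fall p u.1 x))).
Proof.
move=> o0 ox; have x0 : 0 < x by exact: lt_trans ox.
pose B s := (u.2 / u.1 - shock_fall p u.1 s) ^+ 2 / 2 + H s.
have E : \forall s \near x, B s = bernoulli u s.
  near=> s; rewrite /B /bernoulli velocity_shock//.
  by apply: ltW; near: s; exact: lt_nbhsr.
rewrite (velocity_shock p K (ltW ox)); apply: (near_eq_is_derive E).
have dS := shock_fall_is_derive o0 ox; have h := dH x0.
move: (_ / (2 * _)) dS => S' dS.
apply: (is_derive_eqf (is_derive_addf (is_derive_mulf (is_derive_sqrf (is_derive_subf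
  (is_derive_cstf (u.2 / u.1) x) dS)) (is_derive_cstf (2^-1) x)) h)) => //.
by rewrite /=; field; rewrite !gt_eqF.
Unshelve. all: by end_near. Qed.

Lemma bernoulli_continuous u r : 0 < u.1 -> 0 < r -> {for r, continuous (bernoulli u)}.
Proof.
move=> o0 r0; apply: cvgD; last exact: H_continuous.
apply: cvgM; last exact: cvg_cst.
have vc := velocity_continuous hp dK o0 r0.
by rewrite expr2; under eq_fun do rewrite expr2; apply: cvgM.
Qed.

(** While the velocity is positive the kinetic energy falls along the shock branch, and the
    derivative of [H] must be shown to dominate that loss. *)
Lemma bernoulli_le_shock_pos u r s : A0 p u -> u.1 <= r -> r <= s ->
  0 <= velocity p K u s -> bernoulli u r <= bernoulli u s.
Proof.
move=> u0 or rs vs; have [ o0 /andP[_ vc]] := (A0P p u).1 u0.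
have r0 : 0 < r by exact: lt_le_trans or.
apply: (@derive_le_within (bernoulli u) (fun x => derive1 p x / x - velocity p K u x *
    (((p x - p u.1) / x ^+ 2 + (u.1^-1 - x^-1) * derive1 p x) /
      (2 * shock_fall p u.1 x))) r s rs) => [|x /andP[rx xs]|x /andP[rx xs]].
- by apply: continuous_pos_within r0 _ => x x0; exact: bernoulli_continuous.
- by apply: bernoulli_is_derive_shock => //; exact: le_lt_trans rx.
have ox : u.1 < x by exact: le_lt_trans rx.
have x0 : 0 < x by exact: lt_trans ox.
have vx : 0 <= velocity p K u x.
  by rewrite (le_trans vs)// (velocity_le hp dK)// ltW.
have Sx := shock_fall_ge o0 (ltW ox).
have S0 : 0 < shock_fall p u.1 x.
  rewrite -(pmulr_rgt0 _ x0) (lt_le_trans _ Sx)// mulr_gt0 ?c_gt0// subr_gt0//.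
move: vx; rewrite (velocity_shock p K (ltW ox)).
move: (u.2 / u.1) (shock_fall p u.1 x) vc Sx S0 => v S vc Sx S0 vx.
have d0 := derive1_pressure_gt0 hp x0.
have /andP[_ ps] := pressure_slope hp o0 (ltW ox).
move: (derive1 p x) d0 ps => d d0 ps.
have xo : 0 < x - u.1 by rewrite subr_gt0.
(* The slope of the shock curve is controlled because its lower bound [Sx] gives
   [V (x - o) <= S o]. *)
have h1 : (v - S) * (x - u.1) <= S * u.1.
  have : (v - S) * (x - u.1) <= (c p u.1 - S) * (x - u.1).
    by rewrite ler_pM2r// lerD2r ltW.
  by move: Sx; lra.
have h2 : p x - p u.1 <= d * (x - u.1) * (x / u.1).
  apply: (le_trans ps); rewrite ler_peMr ?mulr_ge0 ?(ltW d0) ?(ltW xo)//.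
  by rewrite ler_pdivlMr// mul1r ltW.
have -> : d / x - (v - S) * (((p x - p u.1) / x ^+ 2 + (u.1^-1 - x^-1) * d) / (2 * S)) =
   (2 * S * d * x - (v - S) * ((p x - p u.1) + d * (x - u.1) * (x / u.1))) / (2 * S * x ^+ 2).
  by field; rewrite !gt_eqF.
apply: divr_ge0; last by rewrite mulr_ge0 ?sqr_ge0// mulr_ge0// ltW.
rewrite subr_ge0.
apply: (@le_trans _ _ ((v - S) * (2 * (d * (x - u.1) * (x / u.1))))).
  by apply: ler_wpM2l => //; move: h2; lra.
have -> : (v - S) * (2 * (d * (x - u.1) * (x / u.1))) =
  (2 * d * (x / u.1)) * ((v - S) * (x - u.1)) by ring.
have -> : 2 * S * d * x = (2 * d * (x / u.1)) * (S * u.1).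
  by field; rewrite gt_eqF.
by rewrite ler_wpM2l// mulr_ge0 ?divr_ge0 ?ltW// mulr_gt0.
Qed.

(** Once the velocity is nonpositive its modulus grows with the density, so both terms of the energy
    increase. *)
Lemma bernoulli_le_neg u r s : 0 < u.1 -> 0 < r -> r <= s ->
  velocity p K u r <= 0 -> bernoulli u r <= bernoulli u s.
Proof.
move=> o0 r0 rs v0; rewrite /bernoulli lerD ?H_le// ler_pM2r//.
by rewrite -[leLHS]sqrrN -[leRHS]sqrrN ler_sqr ?nnegrE ?lerN2 ?oppr_ge0 ?(velocity_le hp dK)//
  (le_trans _ v0)// (velocity_le hp dK).
Qed.

Lemma bernoulli_le_shock u r s : A0 p u -> u.1 <= r -> r <= s ->
  bernoulli u r <= bernoulli u s.
Proof.
move=> u0 or rs; have [ o0 _] := (A0P p u).1 u0.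
have r0 : 0 < r by exact: lt_le_trans or.
have [vr|vr] := leP (velocity p K u r) 0; first exact: bernoulli_le_neg.
have [vs|vs] := leP 0 (velocity p K u s); first exact: bernoulli_le_shock_pos.
have rs' : r < s.
  by rewrite lt_neqAle rs andbT; apply/eqP => E; move: vs; rewrite -E ltNge ltW.
have [||z /andP[rz zs] z0] := @IVT_lt R (velocity p K u) r s 0 rs'.
- by move=> x /andP[rx _]; apply: (velocity_continuous hp dK) => //; exact: lt_le_trans rx.
- by right; rewrite vs.
apply: (@le_trans _ _ (bernoulli u z)).
  by apply: bernoulli_le_shock_pos => //; rewrite ?z0 // ltW.
apply: bernoulli_le_neg => //; [exact: lt_trans rz|exact: ltW|by rewrite z0].
Qed.

Lemma bernoulli_le u r s : A0 p u -> phi_hat_l p u <= r -> r <= s ->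
  bernoulli u r <= bernoulli u s.
Proof.
move=> u0 hr rs; have [so|os] := leP s u.1; first exact: bernoulli_le_rarefaction.
have [ro|or] := leP r u.1; last by apply: bernoulli_le_shock => //; exact: ltW.
apply: (@le_trans _ _ (bernoulli u u.1)); first exact: bernoulli_le_rarefaction.
by apply: bernoulli_le_shock => //; exact: ltW.
Qed.

End lax_curve_monotony.

(** * Stationary profiles *)

Section stationary_profile.
Context {R : realType} (p : R -> R) (hp : pressure p) (H : R -> R).
Hypothesis dH : forall r : R, 0 < r -> is_derive r 1 H (derive1 p r / r).
Implicit Types (a r s m : R).

(* Stationary flows conserve the mass flux m and this energy (Bernoulli), which
   replaces the differential equation for the density by an implicit one. *)
Definition energy m a r : R := m ^+ 2 / 2 * (a ^- 2 * r ^- 2) + H r.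

Lemma energy_is_derive m a r : 0 < a -> 0 < r ->
  is_derive r 1 (energy m a) ((a ^+ 2 * derive1 p r * r ^+ 2 - m ^+ 2) / (a ^+ 2 * r ^+ 3)).
Proof.
move=> a0 r0; have r2 : r ^+ 2 != 0 by rewrite expf_neq0// gt_eqF.
apply: (is_derive_eqf (is_derive_addf (is_derive_scalef (m ^+ 2 / 2)
  (is_derive_scalef (a ^- 2) (@is_derive_invf _ (fun y => y ^+ 2) _ _ r2
    (is_derive_sqrf (is_derive_idf r))))) (dH r0))) => //.
by rewrite /=; field; rewrite !gt_eqF.
Qed.

Lemma subsonic_lt m a r s : 0 < a -> 0 < r -> r < s ->
  m ^+ 2 <= a ^+ 2 * derive1 p r * r ^+ 2 -> m ^+ 2 < a ^+ 2 * derive1 p s * s ^+ 2.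
Proof.
move=> a0 r0 rs; move=> /le_lt_trans; apply.
have s0 : 0 < s by exact: lt_trans rs.
have d0 := derive1_pressure_gt0 hp r0.
apply: (@le_lt_trans _ _ (a ^+ 2 * derive1 p s * r ^+ 2)).
  by rewrite ler_pM2r ?exprn_gt0// ler_pM2l ?exprn_gt0// (derive1_pressure_le hp)// ltW.
rewrite ltr_pM2l; last by rewrite mulr_gt0 ?exprn_gt0// (derive1_pressure_gt0 hp).
by rewrite ltr_pXn2r// nnegrE ltW.
Qed.

(** Strict growth on the subsonic branch leaves the algebraic equation at most one subsonic root. *)
Lemma energy_lt m a r s : 0 < a -> 0 < r -> r < s ->
  m ^+ 2 <= a ^+ 2 * derive1 p r * r ^+ 2 -> energy m a r < energy m a s.
Proof.
move=> a0 r0 rs mr; apply: (@derive_lt R (energy m a)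
  (fun x => (a ^+ 2 * derive1 p x * x ^+ 2 - m ^+ 2) / (a ^+ 2 * x ^+ 3)) r s rs).
  by move=> x /andP[rx _]; apply: energy_is_derive => //; exact: lt_le_trans rx.
move=> x /andP[rx _]; have x0 : 0 < x by exact: lt_trans rx.
by rewrite divr_gt0// ?mulr_gt0 ?exprn_gt0// subr_gt0; exact: subsonic_lt rx mr.
Qed.

Lemma energy_inj m a r s : 0 < a -> 0 < r -> 0 < s ->
  m ^+ 2 <= a ^+ 2 * derive1 p r * r ^+ 2 -> m ^+ 2 <= a ^+ 2 * derive1 p s * s ^+ 2 ->
  energy m a r = energy m a s -> r = s.
Proof.
move=> a0 r0 s0 mr ms E; have [rs|sr|//] := ltgtP r s.
  by have := energy_lt a0 r0 rs mr; rewrite E ltxx.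
by have := energy_lt a0 s0 sr ms; rewrite E ltxx.
Qed.

(** Strict growth of [P] in the density at fixed momentum lets the second junction equation
    determine the density of a subsonic right trace. *)
Lemma momentum_lt (q r s : R) : 0 < r -> r < s -> q ^+ 2 <= derive1 p r * r ^+ 2 ->
  P p (r, q) < P p (s, q).
Proof.
move=> r0 rs qr; rewrite /P/=.
apply: (@derive_lt R (fun x => q ^+ 2 / x + p x)
  (fun x => (derive1 p x * x ^+ 2 - q ^+ 2) / x ^+ 2) r s rs) => x /andP[rx _].
  have x0 : 0 < x by exact: lt_le_trans rx.
  have xn : x != 0 by rewrite gt_eqF.
  apply: (is_derive_eqf (is_derive_addf (is_derive_scalef (q ^+ 2) (is_derive_inv xn))
    (pressure_is_derive hp x0))) => //.
  by rewrite /=; field; rewrite !gt_eqF.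
have x0 : 0 < x by exact: lt_trans rx.
rewrite divr_gt0 ?exprn_gt0// subr_gt0.
by have := @subsonic_lt q 1 r x ltr01 r0 rx; rewrite !expr1n !mul1r; apply.
Qed.

Lemma momentum_inj (q r s : R) : 0 < r -> 0 < s ->
  q ^+ 2 <= derive1 p r * r ^+ 2 -> q ^+ 2 <= derive1 p s * s ^+ 2 ->
  P p (r, q) = P p (s, q) -> r = s.
Proof.
move=> r0 s0 mr ms E; have [rs|sr|//] := ltgtP r s.
  by have := momentum_lt r0 rs mr; rewrite E ltxx.
by have := momentum_lt s0 sr ms; rewrite E ltxx.
Qed.

Variables (al : R) (ul : R * R).
Hypotheses (al0 : 0 < al) (ul0 : 0 < ul.1) (ulc : ul.2 ^+ 2 <= derive1 p ul.1 * ul.1 ^+ 2).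
Let m := al * ul.2.

Lemma datum_subsonic a r : al <= a -> ul.1 <= r ->
  m ^+ 2 <= a ^+ 2 * derive1 p r * r ^+ 2.
Proof.
move=> ala ulr; have a0 : 0 < a by exact: lt_le_trans ala.
have h : m ^+ 2 <= a ^+ 2 * derive1 p ul.1 * ul.1 ^+ 2.
  rewrite /m exprMn -mulrA; apply: ler_pM => //; rewrite ?sqr_ge0//.
  by apply: lerXn2r; rewrite ?nnegrE// ltW.
move: ulr; rewrite le_eqVlt => /predU1P[<-//|ulr].
exact/ltW/(subsonic_lt _ _ ulr).
Qed.

(** Strictness comes from [al < a] alone, so it also covers a sonic datum: the flow leaves the sonic
    state as soon as the section grows. *)
Lemma datum_subsonic_lt a r : al < a -> ul.1 <= r ->
  m ^+ 2 < a ^+ 2 * derive1 p r * r ^+ 2.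
Proof.
move=> ala ulr; have r0 : 0 < r by exact: lt_le_trans ulr.
apply: (le_lt_trans (datum_subsonic (lexx al) ulr)).
rewrite ltr_pM2r ?exprn_gt0// ltr_pM2r ?(derive1_pressure_gt0 hp)//.
by rewrite ltr_pXn2r// nnegrE ltW// (lt_trans al0).
Qed.

Lemma energy_datum_le a : al <= a -> energy m a ul.1 <= energy m al ul.1.
Proof.
move=> ala; have a0 : 0 < a by exact: lt_le_trans ala.
rewrite /energy lerD2r ler_wpM2l ?divr_ge0 ?sqr_ge0//.
rewrite ler_pM2r ?invr_gt0 ?exprn_gt0// lef_pV2 ?posrE ?exprn_gt0//.
by apply: lerXn2r; rewrite ?nnegrE// ltW.
Qed.

(** Upper bracket for the root. The kinetic energy of a subsonic datum is at most p'(r) / 2, while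
    on [r, 3 r] the integrand p'(x) / x is at least p'(r) / (3 r), so [H] gains at least 2 p'(r) /
    3. *)
Lemma energy_datum_lt : energy m al ul.1 < H (3 * ul.1).
Proof.
have r0 := ul0; have rc := ulc; have a0 := al0.
have d0 := derive1_pressure_gt0 hp ul0; set r := ul.1 in r0 rc d0 *.
have h1 : energy m al r <= H r + derive1 p r / 2.
  rewrite /energy addrC lerD2l /m exprMn.
  have -> : al ^+ 2 * ul.2 ^+ 2 / 2 * (al ^- 2 * r ^- 2) = ul.2 ^+ 2 / r ^+ 2 / 2.
    by field; rewrite !gt_eqF.
  by rewrite ler_pM2r// ler_pdivrMr ?exprn_gt0.
have h2 : H r - derive1 p r / (3 * r) * r <= H (3 * r) - derive1 p r / (3 * r) * (3 * r).
  have r3 : r <= 3 * r by lra.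
  apply: (@derive_le R (fun x => H x - derive1 p r / (3 * r) * x)
    (fun x => derive1 p x / x - derive1 p r / (3 * r) * 1) r (3 * r) r3) => x /andP[rx x3].
    have x0 : 0 < x by exact: lt_le_trans rx.
    exact: (is_derive_subf (dH x0) (is_derive_scalef _ (is_derive_idf x))).
  have x0 : 0 < x by exact: lt_trans rx.
  rewrite mulr1 subr_ge0; apply: ler_pM.
  - exact: ltW.
  - by rewrite invr_ge0 mulr_ge0// ltW.
  - by apply: (derive1_pressure_le hp) => //; exact: ltW.
  - by rewrite lef_pV2 ?posrE ?mulr_gt0// ltW.
have -> : H (3 * r) = H (3 * r) - derive1 p r / (3 * r) * (3 * r) + derive1 p r.
  by rewrite divfK ?subrK// mulf_neq0// gt_eqF.
have h3 : derive1 p r / (3 * r) * r = derive1 p r / 3 by field; rewrite gt_eqF.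
by rewrite h3 in h2; move: h2; set z := H (3 * r) - _ => h2; lra.
Qed.

Lemma energy_continuous_density a r : 0 < a -> 0 < r -> {for r, continuous (energy m a)}.
Proof. by move=> a0 r0; exact: is_derive_continuous (energy_is_derive m a0 r0). Qed.

Lemma energy_continuous_section a r : 0 < a -> 0 < r ->
  {for a, continuous (fun a => energy m a r)}.
Proof.
move=> a0 r0; apply: cvgD; last exact: cvg_cst.
apply: cvgM; first exact: cvg_cst.
apply: cvgM; last exact: cvg_cst.
apply: cvgV; first by rewrite expf_neq0// gt_eqF.
exact: exprn_continuous.
Qed.

Lemma density_exists a : al <= a ->
  exists r, ul.1 <= r /\ energy m a r = energy m al ul.1.
Proof.
move=> ala; have a0 : 0 < a by exact: lt_le_trans ala.
have := energy_datum_le ala; rewrite le_eqVlt => /predU1P[E|lt1].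
  by exists ul.1.
have r3 : ul.1 < 3 * ul.1 by have r0 := ul0; lra.
have [||r /andP[r1 _] rE] := @IVT_lt R (energy m a) ul.1 (3 * ul.1) (energy m al ul.1) r3.
- by move=> x /andP[rx _]; apply: energy_continuous_density => //; exact: lt_le_trans rx.
- left; rewrite lt1/= (lt_le_trans energy_datum_lt)// /energy lerDr.
  by apply: mulr_ge0; rewrite divr_ge0 ?invr_ge0 ?sqr_ge0.
by exists r; split=> //; exact: ltW.
Qed.

Definition density a : R := xget ul.1 [set r | ul.1 <= r /\ energy m a r = energy m al ul.1].

Lemma densityP a : al <= a -> ul.1 <= density a /\ energy m a (density a) = energy m al ul.1.
Proof.
by move=> ala; exact: (@xgetPex _ ul.1 [set r | ul.1 <= r /\ energy m a r = energy m al ul.1]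
  (density_exists ala)).
Qed.

Lemma density_gt0 a : al <= a -> 0 < density a.
Proof. by move=> /densityP[h _]; exact: lt_le_trans h. Qed.

Lemma density_unique a r : al <= a -> 0 < r -> m ^+ 2 <= a ^+ 2 * derive1 p r * r ^+ 2 ->
  energy m a r = energy m al ul.1 -> density a = r.
Proof.
move=> ala r0 mr E; have a0 : 0 < a by exact: lt_le_trans ala.
have [d1 d2] := densityP ala.
apply: (@energy_inj m a _ _ a0 (density_gt0 ala) r0) => //; last by rewrite d2 E.
exact: datum_subsonic.
Qed.

Lemma density_at : density al = ul.1.
Proof. by apply: density_unique => //; exact: datum_subsonic. Qed.

Lemma density_lt a s : al <= a -> ul.1 <= s -> energy m al ul.1 < energy m a s ->
  density a < s.
Proof.
move=> ala us Es; have a0 : 0 < a by exact: lt_le_trans ala.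
have [d1 d2] := densityP ala; rewrite ltNge; apply/negP => sd.
move: Es; rewrite -d2 ltNge => /negP; apply.
move: sd; rewrite le_eqVlt => /predU1P[->//|sd].
by apply/ltW/energy_lt => //; [exact: lt_le_trans us|exact: datum_subsonic].
Qed.

(** Zero flux is separate: the density is constant, and the section can no longer be expressed
    through the density. *)
Lemma density_is_derive_rest a : ul.2 = 0 -> al < a -> is_derive a 1 density 0.
Proof.
move=> q0 ala; have m0 : m = 0 by rewrite /m q0 mulr0.
apply: (@near_eq_is_derive R (fun _ => ul.1) density a 0 _ (is_derive_cstf _ _)).
near=> b; have alb : al <= b by apply: ltW; near: b; exact: lt_nbhsr.
apply/esym/density_unique => //; first exact: datum_subsonic.
by rewrite /energy m0 expr0n/= !mul0r.
Unshelve. all: by end_near. Qed.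

(** The energy equation is explicit in a^-2, so the density is the inverse of the elementary
    function [W]; the inverse function rule composed with a |-> a^-2 replaces an implicit function
    theorem. The derivative of [W] is nonzero because the flow is strictly subsonic for [a > al]. *)
Lemma density_is_derive_flow a : ul.2 != 0 -> al < a ->
  is_derive a 1 density (density a / a * (m ^+ 2 /
    (a ^+ 2 * derive1 p (density a) * density a ^+ 2 - m ^+ 2))).
Proof.
move=> q0 ala; have m0 : m != 0 by rewrite mulf_neq0// gt_eqF.
have m2 : 0 < m ^+ 2 by rewrite exprn_even_gt0.
have a0 : 0 < a by exact: lt_trans ala.
have [d1 d2] := densityP (ltW ala); set r := density a in d1 d2 *.
have r0 : 0 < r by exact: lt_le_trans d1.
have rsub : m ^+ 2 < a ^+ 2 * derive1 p r * r ^+ 2 by exact: datum_subsonic_lt.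
set E0 := energy m al ul.1 in d2.
(* [W s] is the value of a^-2 at which the density [s] has energy [E0], and [w s] below is the
   corresponding section. *)
pose W s : R := 2 * (E0 - H s) * s ^+ 2 / m ^+ 2.
have dW s : 0 < s -> is_derive s 1 W
    ((2 * (- (derive1 p s / s)) * s ^+ 2 + 2 * (E0 - H s) * (2 * s)) / m ^+ 2).
  move=> s0; apply: (is_derive_eqf (is_derive_mulf (is_derive_mulf (is_derive_scalef 2
    (is_derive_subf (is_derive_cstf E0 s) (dH s0))) (is_derive_sqrf (is_derive_idf s)))
    (is_derive_cstf (m ^- 2) s))) => //.
  by rewrite /=; field; rewrite m0 gt_eqF.
have Wr : W r = a ^- 2.
  by rewrite /W -d2 /energy; field; rewrite m0 !gt_eqF.
(* Equality would give the same energy at two different sections with a nonzero flux. Strictness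
   leaves room for densities on both sides of [r]. *)
have rl : ul.1 < r.
  rewrite lt_neqAle d1 andbT; apply/eqP => E; move: d2; rewrite -E /E0 /energy => /addIr.
  move=> /(mulfI (_ : m ^+ 2 / 2 != 0)); rewrite mulf_neq0 ?expf_neq0 ?invr_eq0//.
  move=> /(_ isT) /(mulIf (_ : ul.1 ^- 2 != 0)); rewrite invr_eq0 expf_neq0 ?gt_eqF//.
  move=> /(_ isT) /invr_inj; apply/eqP; rewrite gt_eqF// ltr_pXn2r// nnegrE ltW//.
pose w s : R := (Num.sqrt (W s))^-1.
have wr : w r = a by rewrite /w Wr sqrtrV ?sqr_ge0// sqrtr_sqr gtr0_norm// invrK.
have wc : {for r, continuous w}.
  apply: cvgV; first by rewrite Wr sqrtrV ?sqr_ge0// sqrtr_sqr gtr0_norm// invr_neq0// gt_eqF.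
  apply: (@continuous_comp _ _ _ W Num.sqrt); last exact: sqrt_continuous.
  exact: is_derive_continuous (dW _ r0).
have can : \forall s \near r, density (w s) = s.
  near=> s.
  have s1 : ul.1 < s by near: s; exact: lt_nbhsr.
  have s0 : 0 < s by exact: lt_trans s1.
  have W0 : 0 < W s.
    near: s; apply: (@cvgr_gt _ _ _ _ W (W r)); last by rewrite Wr invr_gt0 exprn_gt0.
    exact: is_derive_continuous (dW _ r0).
  have ws : al < w s.
    near: s; apply: (@cvgr_gt _ _ _ _ w (w r)); last by rewrite wr.
    exact: wc.
  apply: density_unique; [exact: ltW|by []|by apply: datum_subsonic; exact: ltW|].
  rewrite -/E0 /energy /w exprVn invrK sqr_sqrtr ?ltW// /W.
  by field; rewrite m0 gt_eqF.
(* The density as a function of x = a^-2, a local left inverse of [W]. *)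
pose om (x : R) : R := density (Num.sqrt x)^-1.
have dom : is_derive (W r) 1 om
    ((2 * (- (derive1 p r / r)) * r ^+ 2 + 2 * (E0 - H r) * (2 * r)) / m ^+ 2)^-1.
  apply: (@is_derive_inverse R W om _ r can _ (dW _ r0)).
    near=> s; have s0 : 0 < s by near: s; exact: lt_nbhsr.
    exact: is_derive_continuous (dW s s0).
  rewrite mulf_neq0 ?invr_neq0 ?expf_neq0//.
    have -> : E0 - H r = m ^+ 2 / 2 * (a ^- 2 * r ^- 2) by rewrite -d2 /energy addrK.
    have -> : 2 * - (derive1 p r / r) * r ^+ 2 + 2 * (m ^+ 2 / 2 * (a ^- 2 * r ^- 2)) * (2 * r)
      = 2 * (m ^+ 2 - a ^+ 2 * derive1 p r * r ^+ 2) / (a ^+ 2 * r).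
      by field; rewrite !gt_eqF.
    apply: mulf_neq0; last by rewrite invr_neq0// mulf_neq0 ?expf_neq0 ?gt_eqF.
    by rewrite mulf_neq0 ?pnatr_eq0// subr_eq0 lt_eqF.
rewrite Wr in dom.
have an : a ^+ 2 != 0 by rewrite expf_neq0// gt_eqF.
have da : is_derive a 1 (fun y => (y ^+ 2)^-1) (- (2 * a * 1) / (a ^+ 2) ^+ 2).
  exact: (@is_derive_invf _ (fun y => y ^+ 2) _ _ an (is_derive_sqrf (is_derive_idf a))).
have D := @is_derive1_comp R om (fun y => (y ^+ 2)^-1) a _ _ dom da.
have near_om : \forall b \near a, (om \o (fun y => (y ^+ 2)^-1)) b = density b.
  near=> b; have b0 : 0 < b by near: b; exact: lt_nbhsr.
  by rewrite /om /= sqrtrV ?sqr_ge0// sqrtr_sqr gtr0_norm// invrK.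
have := near_eq_is_derive near_om D.
have E1 : E0 - H r = m ^+ 2 / 2 * (a ^- 2 * r ^- 2) by rewrite -d2 /energy addrK.
have nz : m ^+ 2 - a ^+ 2 * derive1 p r * r ^+ 2 != 0 by rewrite subr_eq0 lt_eqF.
have nz' : a ^+ 2 * derive1 p r * r ^+ 2 - m ^+ 2 != 0 by rewrite subr_eq0 gt_eqF.
move=> h; apply: (is_derive_eqf h) => //; rewrite E1.
have -> : 2 * - (derive1 p r / r) * r ^+ 2 + 2 * (m ^+ 2 / 2 * (a ^- 2 * r ^- 2)) * (2 * r)
  = 2 * (m ^+ 2 - a ^+ 2 * derive1 p r * r ^+ 2) / (a ^+ 2 * r).
  by field; rewrite !gt_eqF.
by field; rewrite nz nz' m0 !gt_eqF.
Unshelve. all: by end_near. Qed.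

Lemma density_is_profile : is_profile p al ul density.
Proof.
have dd a : al < a -> is_derive a 1 density (density a / a * (m ^+ 2 /
    (a ^+ 2 * derive1 p (density a) * density a ^+ 2 - m ^+ 2))).
  move=> ala; have [q0|q0] := eqVneq ul.2 0; last exact: density_is_derive_flow.
  have -> : m = 0 by rewrite /m q0 mulr0.
  by rewrite expr0n/= mul0r mulr0; exact: density_is_derive_rest.
split; first exact: density_at.
- apply/within_continuousP => a; rewrite /= in_itv/= andbT le_eqVlt => /predU1P[<-|ala].
  (* At [al] the derivative blows up for a sonic datum, so continuity is obtained by squeezing: the
     density is at least [ul.1], and it stays below [ul.1 + e] as long as the energy there exceeds
     that of the datum. *)
  + apply/cvgrPdist_lt => e e0.
    have r0 : 0 < ul.1 + e by rewrite addr_gt0.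
    have r1 : ul.1 < ul.1 + e by rewrite ltrDl.
    have lt1 : energy m al ul.1 < energy m al (ul.1 + e).
      by apply: energy_lt => //; exact: datum_subsonic.
    have N : \forall b \near al, energy m al ul.1 < energy m b (ul.1 + e).
      by apply: (@cvgr_gt _ _ _ _ _ _ (energy_continuous_section al0 r0)).
    rewrite density_at; near=> b.
    have alb : al <= b.
      have : (fun x => x \in `[al, +oo[) b by near: b; exact: withinT.
      by rewrite /= in_itv/= andbT.
    have [b1 _] := densityP alb.
    have : density b < ul.1 + e.
      by apply: density_lt => //; [exact: ltW|near: b; exact: cvg_within].
    by rewrite ler0_norm; lra.
  + apply: cvg_within_filter; exact: is_derive_continuous (dd _ ala).
- move=> a ala; have [d1 d2] := densityP (ltW ala).
  have mm : al ^+ 2 * ul.2 ^+ 2 = m ^+ 2 by rewrite /m exprMn.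
  by rewrite mm; split; [exact: lt_le_trans d1|rewrite subr_gt0 datum_subsonic_lt|exact: dd].
Unshelve. all: by end_near. Qed.

(** The differential equation makes the energy of [f] constant, and the positive denominator places
    [f a] on the subsonic branch, where the root is unique. This settles uniqueness even though the
    equation is singular at a sonic datum. *)
Lemma is_profile_density (f : R -> R) a : is_profile p al ul f -> al <= a ->
  f a = density a.
Proof.
move=> [f0 fc fp]; rewrite le_eqVlt => /predU1P[<-|ala]; first by rewrite density_at.
have mm : al ^+ 2 * ul.2 ^+ 2 = m ^+ 2 by rewrite /m exprMn.
have [fa fs _] := fp _ ala; rewrite mm subr_gt0 in fs.
have a0 : 0 < a by exact: lt_trans ala.
have fpos b : al <= b -> 0 < f b.
  by rewrite le_eqVlt => /predU1P[<-|/fp[]//]; rewrite f0.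
pose e b := energy m b (f b).
have de (b : R) : al < b -> is_derive b 1 e 0.
  move=> alb; have b0 : 0 < b by exact: lt_trans alb.
  have [fb fs' df] := fp _ alb; rewrite mm in fs' df.
  have bn : b ^+ 2 != 0 by rewrite expf_neq0// gt_eqF.
  have fn : f b ^+ 2 != 0 by rewrite expf_neq0// gt_eqF.
  have dHf := @is_derive1_comp R H f b _ _ (dH fb) df.
  apply: (is_derive_eqf (is_derive_addf (is_derive_scalef (m ^+ 2 / 2) (is_derive_mulf
    (@is_derive_invf _ (fun y => y ^+ 2) _ _ bn (is_derive_sqrf (is_derive_idf b)))
    (@is_derive_invf _ (fun y => f y ^+ 2) _ _ fn (is_derive_sqrf df)))) dHf)) => //.
  by rewrite /=; field; rewrite !gt_eqF.
have ec : {within `[al, a], continuous e}.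
  have fc' : {within `[al, a], continuous f}.
    apply: continuous_subspaceW fc => x; rewrite /= !in_itv/= => /andP[-> _]//.
  apply/within_continuousP => b /=; rewrite in_itv/= => /andP[alb ba].
  have b0 : 0 < b by exact: lt_le_trans alb.
  have fb := (within_continuousP _ _).1 fc' b; rewrite /= in_itv/= alb ba in fb.
  have {}fb := fb isT.
  apply: cvgD; last exact: (cvg_comp f H fb (H_continuous dH (fpos _ alb))).
  apply: cvgM; first exact: cvg_cst.
  apply: cvgM; apply: cvgV.
  - by rewrite expf_neq0// gt_eqF.
  - by apply: cvg_within_filter; exact: exprn_continuous.
  - by rewrite expf_neq0// gt_eqF// fpos.
  - by apply: (cvg_comp f (fun y => y ^+ 2) fb); exact: exprn_continuous.
have e1 : e al <= e a.
  apply: (@derive_le_within R e (fun _ => 0) al a (ltW ala) ec) => x /andP[alx _].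
    exact: de.
  exact: lexx.
have e2 : - e al <= - e a.
  apply: (@derive_le_within R (fun b => - e b) (fun _ => 0) al a (ltW ala)).
  - by move=> x; apply: continuousN; exact: ec.
  - by move=> x /andP[alx _]; rewrite -oppr0; apply: is_derive_oppf; exact: de.
  - by move=> x _; exact: lexx.
apply/esym/density_unique => //; [exact: ltW|exact: ltW|].
have Eal : e al = energy m al ul.1 by rewrite /e f0.
by rewrite -Eal -/(e a); apply/eqP; rewrite eq_le e1 andbT -lerN2.
Qed.

Lemma profileE a : al <= a -> profile p al ul a = density a.
Proof.
move=> ala; apply: is_profile_density => //.
exact: (@xgetPex _ (fun=> 0) (is_profile p al ul) (ex_intro _ _ density_is_profile)).
Qed.

(** The momentum form of the stationary equations: the derivative of a P is p along the profile. The
    integral in the junction function is thereby the difference of two boundary values. *)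
Lemma profile_momentum ar : al < ar ->
  ar * P p (density ar, m / ar) =
  al * P p ul + oint al ar (fun a => p (profile p al ul a)).
Proof.
move=> alr; have [_ dc dp] := density_is_profile.
have mm : al ^+ 2 * ul.2 ^+ 2 = m ^+ 2 by rewrite /m exprMn.
have dc' : {within `[al, ar], continuous density}.
  by apply: continuous_subspaceW dc => x; rewrite /= !in_itv/= => /andP[-> _].
have dcb b : al <= b <= ar -> density b' @[b' --> within `[al, ar] (nbhs b)] --> density b.
  move=> bb; have := (within_continuousP _ _).1 dc' b.
  by rewrite /= in_itv/= bb => /(_ isT).
have -> : oint al ar (fun a => p (profile p al ul a)) =
    (\int[lebesgue_measure]_(a in `[al, ar]) p (density a))%R.
  rewrite /oint ltW//; apply: eq_Rintegral => a; rewrite inE/= in_itv/= => /andP[ala _].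
  by rewrite profileE.
(* This is [a * P p (density a, m / a)] written without the inner quotient. *)
pose f a : R := m ^+ 2 * (a * density a)^-1 + a * p (density a).
have fc : {within `[al, ar], continuous f}.
  apply/within_continuousP => b /=; rewrite in_itv/= => bb; have /andP[alb ba] := bb.
  have b0 : 0 < b by exact: lt_le_trans alb.
  have fb := dcb _ bb; have db := density_gt0 alb.
  have bc : b' @[b' --> within `[al, ar] (nbhs b)] --> b by apply: cvg_within_filter; exact: cvg_id.
  apply: cvgD.
    apply: cvgM; first exact: cvg_cst.
    by apply: cvgV; [rewrite mulf_neq0 ?gt_eqF|apply: cvgM].
  apply: cvgM => //; apply: (cvg_comp density p fb); exact: (pressure_continuous hp).
have pc : {within `[al, ar], continuous (fun a => p (density a))}.
  apply/within_continuousP => b /=; rewrite in_itv/= => bb; have /andP[alb ba] := bb.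
  apply: (cvg_comp density p (dcb _ bb)); apply: (pressure_continuous hp).
  exact: density_gt0.
have df (b : R) : al < b < ar -> is_derive b 1 f (p (density b)).
  move=> /andP[alb _]; have b0 : 0 < b by exact: lt_trans alb.
  have [db fs df] := dp _ alb; rewrite mm in fs df.
  have bn : b * density b != 0 by rewrite mulf_neq0 ?gt_eqF.
  have dpd := @is_derive1_comp R p density b _ _ (pressure_is_derive hp db) df.
  apply: (is_derive_eqf (is_derive_addf (is_derive_scalef (m ^+ 2)
    (@is_derive_invf _ (fun y => y * density y) _ _ bn (is_derive_mulf (is_derive_idf b) df)))
    (is_derive_mulf (is_derive_idf b) dpd))) => //.
  by rewrite /=; field; rewrite !gt_eqF.
have I : (\int[lebesgue_measure]_(a in `[al, ar]) p (density a))%R = f ar - f al.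
  rewrite /Rintegral; suff -> : (\int[lebesgue_measure]_(a in `[al, ar])
    (p (density a))%:E)%E = (f ar - f al)%:E by [].
  apply: (FTC2_within (ltW alr)) fc pc df.
have n1 : ul.1 != 0 by rewrite gt_eqF.
have n2 : al != 0 by rewrite gt_eqF.
have n3 : density ar != 0 by rewrite gt_eqF// density_gt0// ltW.
have n4 : ar != 0 by rewrite gt_eqF// (lt_trans al0).
by rewrite I /f /P /= density_at /m; field; apply/and4P; split.
Qed.

End stationary_profile.

(** * The junction condition *)

Section junction.
Context {R : realType} (p : R -> R) (hp : pressure p) (hphi : phi_well_defined p).
Variables (K H : R -> R).
Hypothesis dK : forall r : R, 0 < r -> is_derive r 1 K (c p r / r).
Hypothesis dH : forall r : R, 0 < r -> is_derive r 1 H (derive1 p r / r).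
Implicit Types (u ul ur : R * R) (r s : R).

Lemma sqr_le r s : 0 <= r -> r <= s -> r ^+ 2 <= s ^+ 2.
Proof. by move=> r0 rs; rewrite !expr2; apply: ler_pM. Qed.

Definition reflect u : R * R := (u.1, - u.2).

Lemma L2m_reflect u r : L2m p u r = - L1 p (reflect u) r.
Proof. by rewrite /L2m /L1 /reflect /=; case: ifP => _; ring. Qed.

Lemma A0_reflect u : A0 p u -> A0 p (reflect u).
Proof.
move=> /A0P[u0 /andP[h1 h2]]; apply/A0P; split => //=.
by rewrite mulNr ltrN2 h2 ltrNl h1.
Qed.

(** Sonic states are included and nothing is divided: for positive density this is membership in the
    closure of [A0]. *)
Definition subsonic u : Prop := u.2 ^+ 2 <= derive1 p u.1 * u.1 ^+ 2.

Lemma subsonicP u : 0 < u.1 -> subsonic u <-> - c p u.1 <= u.2 / u.1 <= c p u.1.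
Proof.
move=> u0; rewrite -ler_norml /subsonic -(c_sqr hp u0) -exprMn.
have c0 := c_gt0 hp u0.
rewrite -[u.2 ^+ 2]real_normK ?num_real// ler_pXn2r ?nnegrE ?mulr_ge0 ?(ltW c0) ?(ltW u0)//.
by rewrite normrM normfV (gtr0_norm u0) ler_pdivrMr.
Qed.

(** By [profile_momentum] the second equation equates [P] at [ur] with [P] at the end of the
    profile, at equal momentum. Subsonicity of [ur] excludes the other root. *)
Lemma Phi_S_eq0 al ar ul ur : 0 < al -> al < ar -> 0 < ul.1 -> subsonic ul ->
  0 < ur.1 -> subsonic ur ->
  Phi_S p al ul ar ur = (0, 0) <->
  al * ul.2 = ar * ur.2 /\ ur.1 = profile p al ul ar.
Proof.
move=> al0 alr l0 ls r0 rs; have ar0 : 0 < ar by exact: lt_trans alr.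
have mom := profile_momentum hp dH al0 l0 ls alr.
have dE : profile p al ul ar = density H al ul ar.
  by rewrite (profileE hp dH al0 l0 ls (ltW alr)).
have d0 := density_gt0 hp dH al0 l0 ls (ltW alr).
have dsub := datum_subsonic_lt hp al0 l0 ls alr (densityP hp dH al0 l0 ls (ltW alr)).1.
rewrite /Phi_S -mom; split=> [[/eqP]|[E uE]].
  rewrite subr_eq0 => /eqP E /eqP; rewrite subr_eq0 => /eqP /(mulfI (lt0r_neq0 ar0)) EP.
  split; first by rewrite E.
  have q : al * ul.2 / ar = ur.2 by rewrite -E mulrAC mulfV ?mul1r ?gt_eqF.
  rewrite dE; apply: (momentum_inj hp (q := ur.2)) => //; last first.
    by move: EP; rewrite q; case: (ur).
  rewrite -q ltW// expr_div_n ltr_pdivrMr ?exprn_gt0//.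
  by move: dsub; rewrite [ar ^+ 2 * _]mulrC mulrAC.
have q : al * ul.2 / ar = ur.2 by rewrite E mulrAC mulfV ?mul1r ?gt_eqF.
by rewrite q -dE -uE E; case: (ur) => ? ?; rewrite !subrr.
Qed.

Variables (al ar : R) (ubl ubr : R * R).
Hypotheses (al0 : 0 < al) (alr : al < ar) (hl : A0 p ubl) (hr : A0 p ubr).
Let hat := phi_hat_l p ubl.
Let check := phi_check_l p ubl.

Definition transmitted r : R := profile p al (r, L1 p ubl r) ar.

Lemma hat_gt0 : 0 < hat. Proof. by have [] := phi_hat_lP hp dK hphi hl. Qed.

Lemma hat_lt_check : hat < check.
Proof.
have [_ h1 _] := phi_hat_lP hp dK hphi hl; have [h2 _ _] := phi_check_lP hp dK hphi hl.
exact: lt_trans h2.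
Qed.

Lemma L1_div r : 0 < r -> L1 p ubl r / r = velocity p K ubl r.
Proof.
move=> r0; have [u0 _] := (A0P p ubl).1 hl.
by rewrite (L1_velocity hp dK)// mulrAC mulfV ?mul1r// gt_eqF.
Qed.

Lemma lax_subsonic r : 0 < r -> subsonic (r, L1 p ubl r) <-> hat <= r <= check.
Proof.
move=> r0; rewrite subsonicP//= L1_div//.
by rewrite (velocity_le_c hp dK hphi)// (velocity_ge_Nc hp dK hphi)// andbC.
Qed.

Let pos r : hat <= r -> 0 < r. Proof. by apply: lt_le_trans; exact: hat_gt0. Qed.

Lemma transmittedP r : hat <= r <= check ->
  [/\ r <= transmitted r,
      energy H (al * L1 p ubl r) ar (transmitted r) = bernoulli p K H ubl r,
      transmitted r = density H al (r, L1 p ubl r) ar &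
      (al * L1 p ubl r) ^+ 2 < ar ^+ 2 * derive1 p (transmitted r) * transmitted r ^+ 2].
Proof.
move=> rr; have /andP[r1 _] := rr; have r0 := pos r1.
have rs := (lax_subsonic r0).2 rr.
have E : transmitted r = density H al (r, L1 p ubl r) ar.
  exact: (@profileE _ p hp H dH al (r, L1 p ubl r) al0 r0 rs _ (ltW alr)).
have [d1 d2] := @densityP _ p hp H dH al (r, L1 p ubl r) al0 r0 rs _ (ltW alr).
split => //; rewrite E//; last exact: (@datum_subsonic_lt _ p hp al (r, L1 p ubl r) al0 r0 rs).
rewrite d2 /energy /bernoulli -L1_div//=; congr (_ + _).
by field; rewrite !gt_eqF.
Qed.

Lemma transmitted_gt0 r : hat <= r <= check -> 0 < transmitted r.
Proof. by move=> rr; have [h _ _ _] := transmittedP rr; apply: lt_le_trans h; apply: pos; case/andP: rr. Qed.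

(** Were [transmitted s] below t = [transmitted r], the energy at [t] with the flux of [s] would
    exceed [bernoulli s], while with the flux of [r] it equals [bernoulli r]. The difference of the
    two energies turns out to be too small for that. *)
Lemma transmitted_le r s : hat <= r -> r <= s -> s <= check ->
  transmitted r <= transmitted s.
Proof.
move=> hr1 rs sk; rewrite leNgt; apply/negP => ts.
have ar0 : 0 < ar by exact: lt_trans alr.
have rr : hat <= r <= check by rewrite hr1 (le_trans rs).
have ss : hat <= s <= check by rewrite sk (le_trans hr1).
have [r1 rE _ _] := transmittedP rr; have [s1 sE _ ssub] := transmittedP ss.
have r0 := pos hr1; have s0 : 0 < s by exact: lt_le_trans rs.
have ts0 := transmitted_gt0 ss; have tr0 := transmitted_gt0 rr.
have := energy_lt hp dH ar0 ts0 ts (ltW ssub).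
rewrite sE; set t := transmitted r in rE r1 ts tr0 *.
have Bm := bernoulli_le hp dK dH hphi hl hr1 rs.
have vr : velocity p K ubl r ^+ 2 <= c p r ^+ 2.
  have := (lax_subsonic r0).2 rr; rewrite /subsonic/= (L1_velocity hp dK)//; last by case/A0P: hl.
  by rewrite -(c_sqr hp r0) exprMn mulrC ler_pM2r// exprn_gt0.
(* If the flux of [s] is not larger in modulus, the monotony of [bernoulli] suffices; otherwise the
   extra kinetic energy at [t] must be bounded. *)
have [mm|mm] := leP ((al * L1 p ubl s) ^+ 2) ((al * L1 p ubl r) ^+ 2).
  rewrite ltNge => /negP; apply; apply: le_trans Bm; rewrite -rE /energy lerD2r.
  by rewrite ler_wpM2r ?mulr_ge0 ?invr_ge0 ?sqr_ge0// ler_pM2r.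
have HH := H_ge_sqr hp dH r0 rs.
(* Since ar t >= al s, the extra kinetic energy costs no more at (ar, t) than at (al, s). There it
   is compared with the increase of [bernoulli] through [H_ge_sqr] and the subsonic bound on the
   velocity at [r]. *)
pose k := (ar ^- 2 * t ^- 2).
have k0 : 0 < k by rewrite mulr_gt0 ?invr_gt0 ?exprn_gt0.
have kk : k <= (al ^+ 2 * s ^+ 2)^-1.
  rewrite /k -invfM lef_pV2 ?posrE ?mulr_gt0 ?exprn_gt0//.
  have st : s <= t by rewrite (le_trans s1)// ltW.
  by apply: ler_pM; rewrite ?sqr_ge0//; apply: sqr_le => //; exact: ltW.
have d1 : ((al * L1 p ubl s) ^+ 2 - (al * L1 p ubl r) ^+ 2) * k <=
    ((al * L1 p ubl s) ^+ 2 - (al * L1 p ubl r) ^+ 2) * (al ^+ 2 * s ^+ 2)^-1.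
  by rewrite ler_pM2l// subr_gt0.
have d2 : ((al * L1 p ubl s) ^+ 2 - (al * L1 p ubl r) ^+ 2) * (al ^+ 2 * s ^+ 2)^-1 =
   velocity p K ubl s ^+ 2 - velocity p K ubl r ^+ 2 * (r ^+ 2 / s ^+ 2).
  by rewrite -!L1_div//; field; rewrite !gt_eqF.
have d3 : velocity p K ubl r ^+ 2 * (1 - r ^+ 2 / s ^+ 2) <= c p r ^+ 2 * (1 - r ^+ 2 / s ^+ 2).
  rewrite ler_wpM2r// subr_ge0 ler_pdivrMr ?exprn_gt0// mul1r.
  by apply: sqr_le => //; exact: ltW.
have e2 : energy H (al * L1 p ubl s) ar t - energy H (al * L1 p ubl r) ar t =
    ((al * L1 p ubl s) ^+ 2 - (al * L1 p ubl r) ^+ 2) * k / 2.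
  by rewrite /energy /k; ring.
move: rE e2; rewrite /bernoulli.
move: (energy _ _ _ _) (energy _ _ _ _) => e e' rE e2.
rewrite d2 in d1; move: d1 d3 HH rE e2 {vr mm Bm kk k0}.
move: (velocity _ _ _ _ ^+ 2) (velocity _ _ _ _ ^+ 2) => vs vr.
by move: (_ * k) (r ^+ 2 / _) (c p r ^+ 2) => z x y; lra.
Qed.

(** The sign of energy minus [bernoulli] at the two densities [transmitted r] plus or minus [e] is
    stable under small changes of the starting point, and on the subsonic branch these signs locate
    the root. *)
Lemma transmitted_continuous r : hat <= r <= check ->
  transmitted y @[y --> within `[hat, check]%classic (nbhs r)] --> transmitted r.
Proof.
move=> rr; have /andP[hr1 rk] := rr; have r0 := pos hr1.
have ar0 : 0 < ar by exact: lt_trans alr.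
have [u0 _] := (A0P p ubl).1 hl.
have [r1 rE dE rsub] := transmittedP rr; have tr0 := transmitted_gt0 rr.
have gc s : 0 < s -> {for r, continuous (fun y => energy H (al * L1 p ubl y) ar s - bernoulli p K H ubl y)}.
  move=> s0; apply: cvgB; last exact: (bernoulli_continuous hp dK dH).
  apply: cvgD; last exact: cvg_cst.
  apply: cvgM; last exact: cvg_cst.
  apply: cvgM; last exact: cvg_cst.
  have lc : {for r, continuous (fun y => al * L1 p ubl y)}.
    by apply: cvgM; [exact: cvg_cst|exact: (L1_continuous hp dK)].
  exact: (@cvg_comp _ _ _ _ (fun y => y ^+ 2) _ _ _ lc (@exprn_continuous _ 2 _)).
apply/cvgrPdist_lt => e e0.
have te : transmitted r < transmitted r + e by rewrite ltrDl.
have te0 : 0 < transmitted r + e by rewrite addr_gt0.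
have up : 0 < energy H (al * L1 p ubl r) ar (transmitted r + e) - bernoulli p K H ubl r.
  by rewrite subr_gt0 -rE; apply: (energy_lt hp dH) => //; exact: ltW.
have Nup : \forall y \near r, 0 < energy H (al * L1 p ubl y) ar (transmitted r + e) - bernoulli p K H ubl y.
  exact: (cvgr_gt _ (gc _ te0) _ up).
have Nup' : \forall y \near r, y < transmitted r + e.
  by apply: lt_nbhsl; exact: le_lt_trans r1 te.
have Ndn : \forall y \near r, hat <= y <= check -> transmitted r - e < transmitted y.
  (* Below [r] the energy test could leave the subsonic branch, but there the bound
     [y <= transmitted y] is already enough. *)
  have [tr|rt] := ltP (transmitted r - e) r.
    near=> y => yy; have [y1 _ _ _] := transmittedP yy.
    by apply: lt_le_trans y1; near: y; exact: lt_nbhsr.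
  have t0 : 0 < transmitted r - e by exact: lt_le_trans rt.
  have dn : energy H (al * L1 p ubl r) ar (transmitted r - e) - bernoulli p K H ubl r < 0.
    rewrite subr_lt0 -rE; apply: (energy_lt hp dH) => //; first by rewrite gtrBl.
    by have := @datum_subsonic _ p hp al (r, L1 p ubl r) al0 r0 ((lax_subsonic r0).2 rr)
      ar (transmitted r - e) (ltW alr) rt.
  near=> y => yy; have [y1 yE _ ysub] := transmittedP yy.
  have : energy H (al * L1 p ubl y) ar (transmitted r - e) - bernoulli p K H ubl y < 0.
    by near: y; exact: (cvgr_lt _ (gc _ t0) _ dn).
  rewrite subr_lt0 -yE => lty; rewrite ltNge; apply/negP => yt.
  move: lty; rewrite ltNge => /negP; apply.
  move: yt; rewrite le_eqVlt => /predU1P[->//|yt].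
  by apply/ltW/(energy_lt hp dH) => //; [exact: transmitted_gt0|exact: ltW].
near=> y.
have yy : hat <= y <= check.
  have : (fun y => y \in `[hat, check]) y by near: y; exact: withinT.
  by rewrite /= in_itv.
have /andP[hy yk] := yy; have y0 := pos hy.
have h1 : transmitted y < transmitted r + e.
  have [_ _ -> _] := transmittedP yy.
  apply: (@density_lt _ p hp H dH al (y, L1 p ubl y) al0 y0 ((lax_subsonic y0).2 yy)).
  - exact: ltW.
  - by apply: ltW; near: y; exact: cvg_within.
  - have -> : energy H (al * L1 p ubl y) al y = bernoulli p K H ubl y.
      rewrite /energy /bernoulli -L1_div//; congr (_ + _).
      by field; rewrite !gt_eqF.
    by rewrite -subr_gt0; near: y; exact: cvg_within.
have h2 : transmitted r - e < transmitted y.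
  have : hat <= y <= check -> transmitted r - e < transmitted y by near: y; exact: cvg_within.
  exact.
by rewrite ltr_norml; apply/andP; split; lra.
Unshelve. all: by end_near. Qed.

Let hat_r := phi_hat_l p (reflect ubr).

Lemma L2m_lt r s : hat_r <= r -> r < s -> L2m p ubr r < L2m p ubr s.
Proof.
by move=> h1 rs; rewrite !L2m_reflect ltrN2 (L1_lt hp dK hphi (A0_reflect hr)).
Qed.

Lemma L2m_le_supersonic r : 0 < r -> r <= hat_r -> L2m p ubr r <= - (r * c p r).
Proof.
move=> r0 rh; have ur := A0_reflect hr; have [u0 _] := (A0P p _).1 ur.
rewrite L2m_reflect lerN2 (L1_velocity hp dK)// ler_pM2l//.
by rewrite leNgt (velocity_lt_c hp dK hphi)// -leNgt.
Qed.

Definition junction_density r : Prop :=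
  hat <= r <= check /\ al * L1 p ubl r = ar * L2m p ubr (transmitted r).

(** The inequality is strict because the section really grows, so it contradicts [L2m_le_supersonic]
    even at the sonic ends [hat] and [check]. *)
Lemma transmitted_flux r : hat <= r <= check ->
  - (transmitted r * c p (transmitted r)) < al * L1 p ubl r / ar.
Proof.
move=> rr; have [_ _ _ h] := transmittedP rr; have t0 := transmitted_gt0 rr.
have ar0 : 0 < ar by exact: lt_trans alr.
rewrite ltr_pdivlMr//; rewrite -(c_sqr hp t0) in h.
have tc : 0 <= transmitted r * c p (transmitted r) * ar.
  by rewrite !mulr_ge0// ltW// c_gt0.
have : `|al * L1 p ubl r| < transmitted r * c p (transmitted r) * ar.
  rewrite -(@ltr_pXn2r _ 2) ?nnegrE// real_normK ?num_real//.
  have -> : (transmitted r * c p (transmitted r) * ar) ^+ 2 =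
    ar ^+ 2 * c p (transmitted r) ^+ 2 * transmitted r ^+ 2 by ring.
  exact: h.
by rewrite ltr_norml mulNr => /andP[].
Qed.

Lemma junction_density_gt r : junction_density r -> hat_r < transmitted r.
Proof.
move=> [rr E]; rewrite ltNge; apply/negP => th.
have := L2m_le_supersonic (transmitted_gt0 rr) th; have := transmitted_flux rr.
have ar0 : 0 < ar by exact: lt_trans alr.
rewrite E mulrAC mulfV ?gt_eqF// mul1r => h1 h2.
by have := lt_le_trans h1 h2; rewrite ltxx.
Qed.

Lemma junction_density_unique r s : junction_density r -> junction_density s -> r = s.
Proof.
have half x y : junction_density x -> junction_density y -> x < y -> False.
  move: x y => {}r {}s jr js rs; have tr := junction_density_gt jr.
  have [/andP[r1 r2] rE] := jr; have [/andP[s1 s2] sE] := js.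
  have ar0 : 0 < ar by exact: lt_trans alr.
  have := L1_lt hp dK hphi hl r1 rs; rewrite -(ltr_pM2l al0) rE sE ltr_pM2l// => h.
  have := transmitted_le r1 (ltW rs) s2; rewrite le_eqVlt => /predU1P[E|tt].
    by move: h; rewrite E ltxx.
  by have := L2m_lt (ltW tr) tt; rewrite ltNge (ltW h).
by move=> jr js; have [rs|sr|//] := ltgtP r s; [case: (half r s)|case: (half s r)].
Qed.

Lemma junction_criterion : (exists r, junction_density r) <->
  (al * L1 p ubl hat >= ar * L2m p ubr (transmitted hat) /\
   al * L1 p ubl check <= ar * L2m p ubr (transmitted check)).
Proof.
have ar0 : 0 < ar by exact: lt_trans alr.
have hk := hat_lt_check; have hh : hat <= hat <= check by rewrite lexx ltW.
have kk : hat <= check <= check by rewrite lexx ltW.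
split=> [[r jr]|[h1 h2]].
  have tr := junction_density_gt jr; have [rr E] := jr; have /andP[r1 r2] := rr.
  split.
    (* The density transmitted from [hat] may lie below [hat_r] although that of [r] does not. In
       that case the supersonic bound gives the inequality directly. *)
    have [th|ht] := ltP hat_r (transmitted hat).
      apply: (@le_trans _ _ (ar * L2m p ubr (transmitted r))).
        rewrite ler_pM2l//; have := transmitted_le (lexx hat) r1 r2.
        by rewrite le_eqVlt => /predU1P[->//|/(L2m_lt (ltW th))/ltW].
      by rewrite -E ler_pM2l// (L1_le hp dK hphi hl).
    have := L2m_le_supersonic (transmitted_gt0 hh) ht; have := transmitted_flux hh.
    rewrite ltr_pdivlMr// => f1; rewrite -(ler_pM2l ar0) => f2.
    by rewrite (le_trans f2)// mulrC ltW.
  apply: (@le_trans _ _ (al * L1 p ubl r)); first by rewrite ler_pM2l// (L1_le hp dK hphi hl).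
  rewrite E ler_pM2l//; have := transmitted_le r1 r2 (lexx check).
  by rewrite le_eqVlt => /predU1P[->//|/(L2m_lt (ltW tr))/ltW].
pose F r := al * L1 p ubl r - ar * L2m p ubr (transmitted r).
have Fc : {within `[hat, check], continuous F}.
  apply/within_continuousP => r /=; rewrite in_itv/= => rr; have /andP[r1 _] := rr.
  have r0 := pos r1; have t0 := transmitted_gt0 rr.
  have [u0 _] := (A0P p ubl).1 hl; have [v0 _] := (A0P p _).1 (A0_reflect hr).
  apply: cvgB; apply: cvgM; try exact: cvg_cst.
    apply: cvg_within_filter; exact: (L1_continuous hp dK).
  have -> : (fun x => L2m p ubr (transmitted x)) = (fun x => - L1 p (reflect ubr) (transmitted x)).
    by apply/funext => x; rewrite L2m_reflect.
  rewrite L2m_reflect; apply: cvgN.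
  apply: (cvg_comp transmitted (L1 p (reflect ubr)) (transmitted_continuous rr)).
  exact: (L1_continuous hp dK).
have [|r] := @IVT R F hat check 0 (ltW hk) Fc.
  apply/andP; split.
    by rewrite ge_min; apply/orP; right; rewrite subr_le0.
  by rewrite le_max; apply/orP; left; rewrite subr_ge0.
rewrite in_itv/= => rr /eqP; rewrite subr_eq0 => /eqP E.
by exists r; split.
Qed.

End junction.

(** * Lax waves as weak solutions *)

Section fans.
Context {R : realType}.
Local Notation mu := (@lebesgue_measure R).

(** The inverse of the decreasing speed [lam] on [a, b], continued by constants. *)
Definition is_fan (lam : R -> R) (a b : R) (rho : R -> R) : Prop :=
  [/\ forall xi, a <= rho xi <= b,
      forall xi, xi < lam b -> rho xi = b,
      forall xi, lam a < xi -> rho xi = a &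
      forall xi, lam b <= xi <= lam a -> lam (rho xi) = xi].

Section fan.
Variables (lam : R -> R) (a b : R).
Hypotheses (ab : a <= b) (lc : forall x, a <= x <= b -> {for x, continuous lam}).
Hypothesis (ld : forall x y, a <= x -> x < y -> y <= b -> lam y < lam x).

Let lw x y : a <= x -> x <= y -> y <= b -> lam y <= lam x.
Proof. by move=> ax; rewrite le_eqVlt => /predU1P[->//|xy yb]; exact/ltW/ld. Qed.

Lemma fan_exists : exists rho, is_fan lam a b rho.
Proof.
have lba : lam b <= lam a by exact: lw.
have H xi : exists r, [/\ a <= r <= b, xi < lam b -> r = b, lam a < xi -> r = a &
    lam b <= xi <= lam a -> lam r = xi].
  have /orP[x1|x1] : (xi < lam b) || (lam b <= xi) by case: ltP.
    exists b; rewrite ab lexx; split => //.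
      by move=> x2; have := lt_trans x2 x1; rewrite ltNge lba.
    by rewrite leNgt x1.
  have /orP[x2|x2] : (lam a < xi) || (xi <= lam a) by case: ltP.
    exists a; rewrite ab lexx; split => //.
      by rewrite ltNge x1.
    by rewrite [xi <= _]leNgt x2 andbF.
  have cw : {within `[a, b], continuous lam}.
    by apply: continuous_in_subspaceT => x; rewrite inE/= in_itv/=; exact: lc.
  have [|r] := @IVT R lam a b xi ab cw.
    by rewrite ge_min le_max x1 x2 orbT.
  rewrite in_itv/= => rab E; exists r; split => //; first by rewrite ltNge x1.
  by rewrite ltNge x2.
by have [rho Hr] := choice H; exists rho; split => xi; have [] := Hr xi.
Qed.

Variable rho : R -> R.
Hypothesis fan : is_fan lam a b rho.

(** An order duality from which the monotony, continuity and layers of a fan are read. The point r =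
    b is excluded: for [xi < lam b] the left side would hold there and the right side fail. *)
Lemma fan_ltE xi r : a <= r -> r < b -> (xi < lam r) = (r < rho xi).
Proof.
have [f1 f2 f3 f4] := fan => ar rb.
have [x1|x1] := ltP xi (lam b).
  by rewrite (f2 _ x1) rb (lt_le_trans x1)// lw// ltW.
have [x2|x2] := ltP (lam a) xi.
  rewrite (f3 _ x2) [RHS]ltNge ar ltNge/=; apply/negbTE; rewrite negbK ltW//.
  by rewrite (le_lt_trans _ x2)// lw// ltW.
have E := f4 xi; rewrite x1 x2 in E; have {}E := E isT.
have /andP[g1 g2] := f1 xi; apply/idP/idP => h.
  by rewrite ltNge; apply/negP => rr; move: h; rewrite -E ltNge lw// ltW.
by rewrite -[X in X < _]E ld.
Qed.

Lemma fan_nonincreasing x y : x <= y -> rho y <= rho x.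
Proof.
have [f1 f2 f3 f4] := fan => xy; rewrite leNgt; apply/negP => rr.
have /andP[x1 x2] := f1 x; have /andP[y1 y2] := f1 y.
have rb := lt_le_trans rr y2.
have h : y < lam (rho x) by rewrite fan_ltE.
by have := le_lt_trans xy h; rewrite fan_ltE// ltxx.
Qed.

Lemma fan_continuous : continuous rho.
Proof.
have [f1 f2 f3 f4] := fan => xi; apply/cvgrPdist_lt => e e0.
have /andP[g1 g2] := f1 xi.
have up : \forall y \near xi, rho y < rho xi + e.
  have [h|h] := ltP b (rho xi + e).
    by near=> y; have /andP[_ yb] := f1 y; exact: le_lt_trans h.
  pose m := rho xi + e / 2.
  have m1 : a <= m by rewrite /m; lra.
  have m2 : m < b by rewrite /m; lra.
  have m3 : rho xi < m by rewrite /m; lra.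
  have l1 : lam m < xi.
    (* [fan_ltE] yields only a weak inequality; passing through [m'], strictly between [rho xi] and
       [m], makes it strict. *)
    pose m' := rho xi + e / 4.
    have n1 : a <= m' by rewrite /m'; lra.
    have n2 : m' < b by rewrite /m'; lra.
    have n3 : rho xi < m' by rewrite /m'; lra.
    have n4 : m' < m by rewrite /m /m'; lra.
    apply: (@lt_le_trans _ _ (lam m')); first by apply: ld => //; exact: ltW.
    by rewrite leNgt fan_ltE// -leNgt ltW.
  near=> y; have : lam m < y by near: y; exact: lt_nbhsr.
  move=> ly; have : ~~ (y < lam m) by rewrite -leNgt ltW.
  by rewrite fan_ltE// -leNgt /m; lra.
have dn : \forall y \near xi, rho xi - e < rho y.
  have [h|h] := ltP (rho xi - e) a.
    by near=> y; have /andP[ya _] := f1 y; exact: lt_le_trans ya.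
  pose m := rho xi - e / 2.
  have m1 : a <= m by rewrite /m; lra.
  have m2 : m < b by rewrite /m; lra.
  have l1 : xi < lam m by rewrite fan_ltE// /m; lra.
  near=> y; have : y < lam m by near: y; exact: lt_nbhsl.
  by rewrite fan_ltE// /m; lra.
near=> y; have h1 : rho y < rho xi + e by near: y.
have h2 : rho xi - e < rho y by near: y.
by rewrite ltr_norml; apply/andP; split; lra.
Unshelve. all: by end_near. Qed.

(* Layer-cake decomposition of a fan into infinitesimal fronts. *)
Lemma fan_layers (G g : R -> R) xi : 0 < a ->
  (forall r, 0 < r -> {for r, continuous g}) ->
  (forall r : R, 0 < r -> is_derive r 1 G (g r)) ->
  G (rho xi) =
    G a + (\int[mu]_(r in `[a, b]) (if (xi < lam r)%R then g r else 0))%R.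
Proof.
have [f1 _ _ _] := fan => a0 cg dG; have /andP[r1 r2] := f1 xi.
have lm : measurable_fun (`[a, b] : set R) lam.
  apply: subspace_continuous_measurable_fun; first exact: measurable_itv.
  by apply: continuous_in_subspaceT => x; rewrite inE/= in_itv/=; exact: lc.
have gm : measurable_fun (`[a, b] : set R) g.
  apply: subspace_continuous_measurable_fun; first exact: measurable_itv.
  exact: continuous_pos_within.
have fm : measurable_fun (`[a, b] : set R) (fun r => if xi < lam r then g r else 0).
  apply: measurable_fun_if => //.
    by apply: measurable_fun_ltr.
  by apply: measurable_funS gm; [exact: measurable_itv|exact: subIsetl].
rewrite -[LHS](subrK (G a)) addrC; congr (_ + _).
rewrite -(@Rintegral_FTC2 _ g G a (rho xi))//.
have E : (\int[mu]_(r in `[a, b]) (if (xi < lam r)%R then g r else 0)%:E)%E =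
    (\int[mu]_(r in `[a, b[) (if (xi < lam r)%R then g r else 0)%:E)%E.
  apply/esym; apply: integral_itv_bndo_bndc; apply/measurable_EFinP.
  by apply: measurable_funS fm; [exact: measurable_itv|exact: subset_itv_co_cc].
rewrite /Rintegral E; congr fine.
have gE : (\int[mu]_(r in `[a, rho xi]) (g r)%:E)%E = (\int[mu]_(r in `[a, rho xi[) (g r)%:E)%E.
  apply/esym; apply: integral_itv_bndo_bndc; apply/measurable_EFinP.
  apply: measurable_funS gm; first exact: measurable_itv.
  by move=> x; rewrite /= !in_itv/= => /andP[-> /ltW xr]; rewrite (le_trans xr).
rewrite gE integral_mkcond [RHS]integral_mkcond; apply: eq_integral => r _.
rewrite !patchE !mem_setE !in_itv/=.
case: (leP a r) => ar //=; case: (ltP r b) => rb /=; last by rewrite ltNge (le_trans r2).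
by rewrite fan_ltE//; case: ifP.
Qed.

(** Extends functions given on [a, b] to bounded measurable functions on the line, as
    [weak_superposition] demands. *)
Let clamp r : R := Num.min (Num.max r a) b.

Let clamp_itv r : a <= clamp r <= b.
Proof. by rewrite /clamp le_min le_max lexx orbT ab/= ge_min lexx orbT. Qed.

Let clamp_id r : a <= r <= b -> clamp r = r.
Proof. by move=> /andP[ar rb]; rewrite /clamp max_l// min_l. Qed.

Let clamp_continuous : continuous clamp.
Proof.
move=> r; change {for r, continuous (fun r => Num.min (Num.max r a) b)}.
apply: continuous_min; last exact: cvg_cst.
by apply: continuous_max; [exact: cvg_id|exact: cvg_cst].
Qed.

Let clamp_bounded (f : R -> R) : (forall r, a <= r <= b -> {for r, continuous f}) ->
  measurable_fun setT (f \o clamp) /\ exists M, forall r, `|f (clamp r)| <= M.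
Proof.
move=> cf; split.
  apply: continuous_measurable_fun => r; apply: continuous_comp; first exact: clamp_continuous.
  by apply: cf.
have cw : {within `[a, b], continuous f}.
  by apply: continuous_in_subspaceT => x; rewrite inE/= in_itv/=; exact: cf.
have : compact (f @` `[a, b]).
  by apply: continuous_compact => //; exact: segment_compact.
move=> /compact_bounded[M [_ HM]]; exists (M + 1) => r.
apply: (HM (M + 1)); first by rewrite ltrDl.
by exists (clamp r) => //; rewrite /= in_itv/= clamp_itv.
Qed.

(** That the derivative of [G2] is [lam] times that of [G1] is the jump relation of each
    infinitesimal front; integrating it over the layers gives the conservation law of the whole
    fan. *)
Lemma fan_weak (G1 G2 g : R -> R) (eps : R) : 0 < a -> eps * eps = 1 ->
  (forall r, 0 < r -> {for r, continuous lam}) ->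
  (forall r, 0 < r -> {for r, continuous g}) ->
  (forall r : R, 0 < r -> is_derive r 1 G1 (g r)) ->
  (forall r : R, 0 < r -> is_derive r 1 G2 (lam r * g r)) ->
  weak_equation (fun t x => G1 (rho (eps * x / t)))
                (fun t x => eps * G2 (rho (eps * x / t))).
Proof.
move=> a0 ee lcont gcont dG1 dG2.
have pos r : a <= r <= b -> 0 < r by move=> /andP[ar _]; exact: lt_le_trans ar.
have [ml [L lL]] := clamp_bounded lc.
have [mg [M gM]] := clamp_bounded (fun r rab => gcont r (pos r rab)).
have := weak_superposition a b ml mg lL gM ee.
move=> /(weak_equationD (weak_equation_cst (G1 a) (eps * G2 a))).
apply: eq_weak_equation => t x t0 _.
have lgc r : 0 < r -> {for r, continuous (fun r => lam r * g r)}.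
  by move=> r0; apply: cvgM; [exact: lcont|exact: gcont].
have cond r : r \in `[a, b]%classic ->
    (eps * x < (lam \o clamp) r * t) = (eps * x / t < lam r).
  by rewrite inE/= in_itv/= => rab; rewrite clamp_id// ltr_pdivrMr.
split.
  rewrite (fan_layers _ a0 gcont dG1); congr (_ + _).
  apply: eq_Rintegral => r rab; rewrite cond//; case: ifP => // _.
  by move: rab; rewrite inE/= in_itv/= => rab; rewrite clamp_id.
rewrite (fan_layers _ a0 lgc dG2) mulrDr; congr (_ + _ * _).
apply: eq_Rintegral => r rab; rewrite cond//; case: ifP => // _.
by move: rab; rewrite inE/= in_itv/= => rab; rewrite !clamp_id.
Qed.

End fan.

Lemma weak_front (k s eps : R) : eps * eps = 1 ->
  weak_equation (fun t x => if eps * x < s * t then k else 0)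
                (fun t x => eps * (if eps * x < s * t then s * k else 0)).
Proof.
move=> ee; pose e (y : R) : R := if eps * y < 0 then k else 0.
have me : measurable_fun setT e.
  by apply: measurable_fun_ifT => //; apply: measurable_fun_ltr => //; exact: measurable_funM.
have eM y : `|e y| <= `|k| by rewrite /e; case: ifP => // _; rewrite normr0.
have := weak_wave (eps * s) me eM; apply: eq_weak_equation => t x _ _.
have -> : e (x - eps * s * t) = if eps * x < s * t then k else 0.
  by rewrite /e mulrBr !mulrA ee mul1r subr_lt0.
by split=> //; case: ifP => _; ring.
Qed.

End fans.

(** * Shocks and rarefactions of the first family *)

Section lax_waves.
Context {R : realType} (p : R -> R) (hp : pressure p) (hphi : phi_well_defined p).
Variable (K : R -> R).
Hypothesis dK : forall r : R, 0 < r -> is_derive r 1 K (c p r / r).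
Implicit Types (u ub ul : R * R) (w : R -> R * R).

Definition monotone (f : R -> R) : Prop :=
  (forall x y, x <= y -> f x <= f y) \/ (forall x y, x <= y -> f y <= f x).

(** The sign [eps] states the equations for the wave and for its mirror image at once, so that waves
    of the second family come for free. *)
Definition solves_conservation_laws w : Prop := forall eps : R, eps * eps = 1 ->
  weak_equation (fun t x => (w (eps * x / t)).1) (fun t x => eps * (w (eps * x / t)).2) /\
  weak_equation (fun t x => (w (eps * x / t)).2) (fun t x => eps * P p (w (eps * x / t))).

(** The number [s] is the only similarity variable where a jump may sit, and [Lm] bounds the
    propagation speed. The value [ul] for all xi >= 0 makes it the trace at the junction. *)
Definition admissible_wave ub ul w (s Lm : R) : Prop :=
  [/\ lax1_wave p ub ul w,
      (forall xi, 0 <= xi -> w xi = ul) /\ (forall xi, xi <= - Lm -> w xi = ub),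
      (forall xi, 0 < (w xi).1 /\ subsonic p (w xi)),
      [/\ forall xi, xi != s -> {for xi, continuous (fun xi => (w xi).1)},
          forall xi, xi != s -> {for xi, continuous (fun xi => (w xi).2)},
          monotone (fun xi => (w xi).1) & monotone (fun xi => (w xi).2)] &
      solves_conservation_laws w].

Lemma hugoniot u r : 0 < u.1 -> u.1 < r ->
  let s := (L1 p u r - u.2) / (r - u.1) in
  s * (u.1 - r) = u.2 - L1 p u r /\
  s * (u.2 - L1 p u r) = P p u - P p (r, L1 p u r).
Proof.
move=> u0 ur /=; have r0 : 0 < r by exact: lt_trans ur.
have rn : r - u.1 != 0 by rewrite subr_eq0 gt_eqF.
split; first by field.
have -> : (L1 p u r - u.2) / (r - u.1) * (u.2 - L1 p u r) =
  - (L1 p u r - u.2) ^+ 2 / (r - u.1) by field.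
rewrite /P/=; apply: (mulIf rn); rewrite divfK//.
rewrite (L1_velocity hp dK)// velocity_shock ?ltW//.
set S := shock_fall p u.1 r.
have SE : S ^+ 2 = (u.1^-1 - r^-1) * (p r - p u.1).
  by rewrite sqr_sqrtr// shock_arg_ge0// ltW.
(* Eliminating the pressure at [r] through the square of [S] leaves a rational identity. *)
have -> : p r = p u.1 + S ^+ 2 * (r * u.1) / (r - u.1).
  by rewrite SE; field; rewrite rn !gt_eqF.
by field; rewrite rn !gt_eqF.
Qed.

Lemma shock_wave u r : A0 p u -> u.1 < r -> r <= phi_check_l p u ->
  exists w s Lm, [/\ s < 0, 0 < Lm & admissible_wave u (r, L1 p u r) w s Lm].
Proof.
move=> uA ur rk; have [u0 uc] := (A0P p u).1 uA; have [_ hu _] := phi_hat_lP hp dK hphi uA.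
have r0 : 0 < r by exact: lt_trans ur.
have h0 : u.1 <= u.1 by [].
have Lq : L1 p u r < u.2.
  by have := L1_lt_shock hp dK uA h0 ur; rewrite (L1_at hp dK).
have ru : 0 < r - u.1 by rewrite subr_gt0.
pose s := (L1 p u r - u.2) / (r - u.1).
have s0 : s < 0 by rewrite /s pmulr_llt0 ?invr_gt0// subr_lt0.
pose w xi : R * R := if xi < s then u else (r, L1 p u r).
have [e1 e2] := hugoniot u0 ur.
have wc (f : R * R -> R) xi : xi != s -> {for xi, continuous (fun xi => f (w xi))}.
  move=> xs; have [xs'|xs'] := ltP xi s.
    apply: (@near_cst_continuous _ _ (f u)); near=> y; rewrite /w ifT//.
    by near: y; exact: lt_nbhsl.
  apply: (@near_cst_continuous _ _ (f (r, L1 p u r))); near=> y; rewrite /w ifF//.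
  apply/negbTE; rewrite -leNgt ltW//; near: y; apply: lt_nbhsr.
  by rewrite lt_neqAle eq_sym xs.
have Lm0 : 0 < 1 - s by lra.
exists w, s, (1 - s); split; [exact: s0|exact: Lm0|]; split.
- split; [exact: r0|exact: erefl|by rewrite /= leNgt ur|].
  move=> _ xi; rewrite /= -/s /w; split; first by move=> ->.
  by move=> sx; rewrite ltNge ltW.
- split=> xi xs; rewrite /w; first by rewrite ltNge (le_trans (ltW s0)).
  by rewrite ifT//; lra.
- move=> xi; rewrite /w; case: ifP => _; split => //.
    by apply/(subsonicP hp u0); case/andP: uc => /ltW -> /ltW ->.
  by apply/(lax_subsonic hp hphi dK uA r0); rewrite rk andbT ltW// (lt_trans hu).
- split.
  + exact: (wc fst).
  + exact: (wc snd).
  + left=> x y xy; rewrite /w; case: (ltP x s) => xs; case: (ltP y s) => ys //=; first exact: ltW.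
    by have := le_lt_trans xy ys; rewrite ltNge xs.
  + right=> x y xy; rewrite /w; case: (ltP x s) => xs; case: (ltP y s) => ys //=; first exact: ltW.
    by have := le_lt_trans xy ys; rewrite ltNge xs.
- move=> eps ee.
  have W (f g : R * R -> R) : s * (f u - f (r, L1 p u r)) = g u - g (r, L1 p u r) ->
      weak_equation (fun t x => f (w (eps * x / t))) (fun t x => eps * g (w (eps * x / t))).
    move=> fg; have := weak_front (f u - f (r, L1 p u r)) s ee.
    move=> /(weak_equationD (weak_equation_cst (f (r, L1 p u r)) (eps * g (r, L1 p u r)))).
    apply: eq_weak_equation => t x t0 _; rewrite /w ltr_pdivrMr// fg.
    by case: ifP => _; split; ring.
  by split; [exact: (W fst snd)|exact: (W snd (P p))].
Unshelve. all: by end_near. Qed.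

Lemma rarefaction_wave u r : A0 p u -> phi_hat_l p u <= r -> r <= u.1 ->
  exists w s Lm, [/\ s < 0, 0 < Lm & admissible_wave u (r, L1 p u r) w s Lm].
Proof.
move=> uA hr ru; have [u0 uc] := (A0P p u).1 uA; have [h0 hu _] := phi_hat_lP hp dK hphi uA.
have [uk _ _] := phi_check_lP hp dK hphi uA.
have r0 : 0 < r by exact: lt_le_trans hr.
pose th x := u.2 / u.1 - (K x - K u.1).
pose lam x := th x - c p x.
pose ell x := x * th x.
have thE x : x <= u.1 -> th x = velocity p K u x by move=> xu; rewrite velocity_rarefaction.
have lamc x : 0 < x -> {for x, continuous lam}.
  move=> x0; apply: cvgB; last exact: (c_continuous hp).
  apply: cvgB; first exact: cvg_cst.
  by apply: cvgB; [exact: is_derive_continuous (dK x0)|exact: cvg_cst].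
have ld x y : r <= x -> x < y -> y <= u.1 -> lam y < lam x.
  move=> rx xy yu; have x0 := lt_le_trans r0 rx.
  rewrite /lam !thE//; last by rewrite ltW// (lt_le_trans xy).
  have := velocity_lt hp dK u0 x0 xy; have := c_le hp x0 (ltW xy); lra.
have lcab x : r <= x <= u.1 -> {for x, continuous lam}.
  by move=> /andP[rx _]; apply: lamc; exact: lt_le_trans rx.
have [rho fan] := fan_exists ru lcab ld; have [f1 f2 f3 f4] := fan.
have rho_le xi : rho xi <= u.1 by case/andP: (f1 xi).
have rho_ge xi : r <= rho xi by case/andP: (f1 xi).
have rho0 xi : 0 < rho xi by exact: lt_le_trans (rho_ge xi).
have ellE x : 0 < x -> x <= u.1 -> L1 p u x = ell x by move=> x0 xu; rewrite (L1_rarefaction hp dK).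
have lamE x : 0 < x -> x <= u.1 -> lambda1 p (x, L1 p u x) = lam x.
  by move=> x0 xu; rewrite /lambda1/= ellE// /ell mulrAC mulfV ?mul1r// gt_eqF.
have lamr : lam r <= 0.
  by rewrite /lam subr_le0 thE// (velocity_le_c hp dK hphi).
have ubE : (u.1, L1 p u u.1) = u by rewrite (L1_at hp dK)//; case: (u).
have lamu : lam u.1 = lambda1 p u by rewrite -lamE// ubE.
pose w xi : R * R := (rho xi, L1 p u (rho xi)).
(* The wave is continuous, so any negative number may stand for its jump; [lam u.1] is its lowest
   speed. *)
exists w, (-1), (`|lam u.1| + 1); split; [exact: ltrN10|by rewrite ltr_wpDl|]; split.
- split; [exact: r0|exact: erefl| |by rewrite /= ltNge ru].
  move=> _ xi; split.
  + by rewrite -lamu => /f2; rewrite /w => ->.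
  + rewrite -lamu lamE// => xx; exists (rho xi); split=> //.
    by rewrite lamE// f4.
  + by rewrite lamE// => /f3; rewrite /w => ->.
- split=> xi xx.
    rewrite /w; suff -> : rho xi = r by [].
    (* Only xi = lam r = 0 is delicate, when [r] is sonic: there strict monotony of [lam] forces
       [rho xi = r]. *)
    move: (le_trans lamr xx); rewrite le_eqVlt => /predU1P[E|/f3//].
    apply/eqP; rewrite eq_le rho_ge andbT leNgt; apply/negP => rr.
    have := ld _ _ (lexx r) rr (rho_le xi); rewrite f4 ?E ?ltxx//.
    rewrite lexx andbT -E.
    by move: ru; rewrite le_eqVlt => /predU1P[->//|ru]; apply/ltW/ld.
  rewrite /w f2 ?ubE//; have := ler_norm (- lam u.1); rewrite normrN; lra.
- move=> xi; split; first exact: rho0.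
  apply/(lax_subsonic hp hphi dK uA (rho0 xi)).
  by rewrite (le_trans hr)// (le_trans (rho_le xi))// ltW.
- have rc := fan_continuous ld fan; split.
  + by move=> xi _; exact: rc.
  + move=> xi _; apply: (@continuous_comp _ _ _ rho (L1 p u)); first exact: rc.
    exact: (L1_continuous hp dK).
  + by right=> x y xy; exact: (fan_nonincreasing ld fan xy).
  + left=> x y xy; apply: (L1_le hp dK hphi uA); first by rewrite (le_trans hr).
    exact: (fan_nonincreasing ld fan xy).
- move=> eps ee.
  have dell (x : R) : 0 < x -> is_derive x 1 ell (lam x).
    by move=> x0; exact: (L1_rarefaction_is_derive dK).
  have dP (x : R) : 0 < x -> is_derive x 1 (fun y => ell y ^+ 2 / y + p y) (lam x * lam x).
    move=> x0; have xn : x != 0 by rewrite gt_eqF.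
    apply: (is_derive_eqf (is_derive_addf (is_derive_mulf (is_derive_sqrf (dell _ x0))
      (is_derive_inv xn)) (pressure_is_derive hp x0))) => //.
    by rewrite -(c_sqr hp x0) /ell /lam; field.
  have c1 x : 0 < x -> {for x, continuous (fun _ : R => 1 : R)} by move=> _; exact: cvg_cst.
  have dl1 (x : R) : 0 < x -> is_derive x 1 ell (lam x * 1) by rewrite mulr1; exact: dell.
  split.
    have := fan_weak ru lcab ld fan r0 ee lamc c1 (fun x _ => is_derive_idf x) dl1.
    by apply: eq_weak_equation => t x _ _; rewrite /w /= ellE.
  have := fan_weak ru lcab ld fan r0 ee lamc lamc dell dP.
  by apply: eq_weak_equation => t x _ _; rewrite /w /P /= ellE.
Qed.

Lemma admissible_wave_exists u r : A0 p u -> phi_hat_l p u <= r <= phi_check_l p u ->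
  exists w s Lm, [/\ s < 0, 0 < Lm & admissible_wave u (r, L1 p u r) w s Lm].
Proof.
move=> uA /andP[h1 h2]; have [ru|ur] := leP r u.1; first exact: rarefaction_wave.
exact: shock_wave.
Qed.

End lax_waves.

(** * Bounded variation and convergence in L1 on segments *)

Section tame_functions.
Context {R : realType}.
Local Notation mu := (@lebesgue_measure R).

Lemma ae_neq (a : R) : {ae mu, forall x, x != a}.
Proof.
exists [set a]; split; first exact: measurable_set1.
  exact: lebesgue_measure_set1.
by move=> x /= /negP; rewrite negbK => /eqP.
Qed.

Lemma ae_imply (A B : R -> Prop) : (forall x, A x -> B x) ->
  {ae mu, forall x, A x} -> {ae mu, forall x, B x}.
Proof. by move=> AB; apply: (@filterS _ _ (ae_filter_ringOfSetsType mu)). Qed.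

Lemma ae_and (A B : R -> Prop) : {ae mu, forall x, A x} -> {ae mu, forall x, B x} ->
  {ae mu, forall x, A x /\ B x}.
Proof. by apply: (@filterS2 _ _ (ae_filter_ringOfSetsType mu)) => x. Qed.

Definition tame (f : R -> R) : Prop :=
  [/\ measurable_fun setT f, exists M, forall x, `|f x| <= M & finite_TV f].

Lemma monotone_tame (f : R -> R) M : monotone f -> (forall x, `|f x| <= M) -> tame f.
Proof.
move=> mf fM; split; last 2 first.
- by exists M.
- exists (M + M) => a b ab.
  have h : `|f b - f a| <= M + M by rewrite (le_trans (ler_normB _ _))// lerD.
  case: mf => mf.
    rewrite nondecreasing_total_variation//; last by move=> x y _ _; exact: mf.
    by rewrite lee_fin (le_trans (ler_norm _)).
  rewrite -total_variationN nondecreasing_total_variation//; last first.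
    by move=> x y _ _ xy; rewrite lerN2 mf.
  by rewrite lee_fin /= opprK addrC (le_trans _ h)// distrC ler_norm.
- case: mf => mf; first exact: nondecreasing_measurable.
  exact: nonincreasing_measurable.
Qed.

Lemma tameD (f g : R -> R) : tame f -> tame g -> tame (fun x => f x + g x).
Proof.
move=> [mf [M fM] [A fA]] [mg [N gN] [B gB]]; split.
- exact: measurable_funD.
- by exists (M + N) => x; rewrite (le_trans (ler_normD _ _))// lerD.
- exists (A + B) => a b ab; rewrite (le_trans (total_variation_le f g ab))//.
  by rewrite EFinD leeD ?fA ?gB.
Qed.

Lemma tame_locally_integrable (f : R -> R) : tame f -> locally_integrable [set: R] f.
Proof.
move=> [mf [M fM] _]; split=> //; first exact: openT.
move=> k _ ck; have mk : measurable k by exact: compact_measurable.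
have fin : (mu k < +oo)%E.
  have [B [_ HB]] := compact_bounded ck.
  have kB : k `<=` `[(- (B + 1))%R, B + 1]%classic.
    move=> x kx; rewrite /= in_itv/= -ler_norml.
    by apply: (HB (B + 1)) => //; rewrite ltrDl.
  apply: (@le_lt_trans _ _ (mu `[(- (B + 1))%R, B + 1]%classic)).
    by apply: le_measure; rewrite ?inE//; exact: measurable_itv.
  exact: segment_finite.
have : mu.-integrable k (EFin \o f).
  apply: measurable_bounded_integrable => //; first exact: measurable_funS mf.
  exists M; split; first exact: num_real.
  by move=> x Mx y _ /=; rewrite (le_trans (fM y))// ltW.
by move=> /integrableP[_].
Qed.

Lemma L1_segment_cvg (u : R -> R -> R * R) (C N t0 : R) : 0 <= t0 ->
  (forall t, 0 <= t -> measurable_fun setT (fun x => (u t x).1) /\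
                       measurable_fun setT (fun x => (u t x).2)) ->
  (forall t x, 0 <= t -> `|(u t x).1| <= C /\ `|(u t x).2| <= C) ->
  {ae mu, forall x,
    (u t x).1 @[t --> within [set t | 0 <= t] (nbhs t0)] --> (u t0 x).1 /\
    (u t x).2 @[t --> within [set t | 0 <= t] (nbhs t0)] --> (u t0 x).2} ->
  (\int[mu]_(x in `[(- N)%R, N]) (`|u t x - u t0 x|%R)%:E)%E
    @[t --> within [set t | 0 <= t] (nbhs t0)] --> 0%E.
Proof.
move=> t00 mu12 uC cu.
pose h t x : R := `|u t x - u t0 x|.
have hE t x : h t x = Num.max `|(u t x).1 - (u t0 x).1| `|(u t x).2 - (u t0 x).2|.
  by rewrite /h prod_normE.
have mh t : 0 <= t -> measurable_fun setT (h t).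
  move=> t1; rewrite (funext (hE t)); have [m1 m2] := mu12 _ t1; have [n1 n2] := mu12 _ t00.
  by apply: measurable_maxr; apply: measurableT_comp => //; exact: measurable_funB.
have hC t x : 0 <= t -> `|h t x| <= C + C.
  move=> t1; rewrite hE ger0_norm ?le_max ?normr_ge0//.
  have [m1 m2] := uC _ x t1; have [n1 n2] := uC _ x t00.
  by rewrite ge_max !(le_trans (ler_normB _ _))// lerD.
have ih t : 0 <= t -> mu.-integrable `[(- N)%R, N] (EFin \o h t).
  move=> t1; exact: (bounded_segment_integrable _ _ (mh _ t1) (fun x => hC t x t1)).
pose I t := (\int[mu]_(x in `[(- N)%R, N]) (h t x)%:E)%E.
have If t : 0 <= t -> I t \is a fin_num by move=> t1; exact: integrable_fin_num (ih _ t1).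
(* Dominated convergence is about sequences. Freezing the function at t = 0 for negative times turns
   the limit within t >= 0 into an ordinary one, which sequences characterize. *)
pose G (t : R) : R := fine (I (Num.max t 0)).
have G0 : G t @[t --> t0] --> 0.
  apply/(@cvg_nbhsP _ R^o) => y yt.
  pose z n := Num.max (y n) 0.
  have z0 n : 0 <= z n by rewrite /z le_max lexx orbT.
  have zc : z n @[n --> \oo] --> t0.
    have mc : {for t0, continuous (fun t : R => Num.max t 0)}.
      by apply: continuous_max; [exact: cvg_id|exact: cvg_cst].
    by have := cvg_comp y (fun t : R => Num.max t 0) yt mc; rewrite (max_l t00).
  have zt : z n @[n --> \oo] --> within [set t | 0 <= t] (nbhs t0).
    move=> A /zc zA; have {}zA : \forall n \near \oo, 0 <= z n -> A (z n) by exact: zA.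
    have : \forall n \near \oo, A (z n) by apply: filterS zA => n; apply.
    exact.
  have cvgh x : ((u t x).1 @[t --> within [set t | 0 <= t] (nbhs t0)] --> (u t0 x).1 /\
    (u t x).2 @[t --> within [set t | 0 <= t] (nbhs t0)] --> (u t0 x).2) ->
    h (z n) x @[n --> \oo] --> 0.
    move=> [c1 c2].
    have d1 : (u (z n) x).1 - (u t0 x).1 @[n --> \oo] --> 0.
      rewrite -(subrr (u t0 x).1); apply: cvgB; last exact: cvg_cst.
      exact: cvg_comp zt c1.
    have d2 : (u (z n) x).2 - (u t0 x).2 @[n --> \oo] --> 0.
      rewrite -(subrr (u t0 x).2); apply: cvgB; last exact: cvg_cst.
      exact: cvg_comp zt c2.
    apply/cvgrPdist_lt => e e0.
    have /cvgrPdist_lt/(_ _ e0) f1 := d1; have /cvgrPdist_lt/(_ _ e0) f2 := d2.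
    near=> n; rewrite sub0r normrN hE ger0_norm ?le_max ?normr_ge0// gt_max.
    have b1 : `|0 - ((u (z n) x).1 - (u t0 x).1)| < e by near: n.
    have b2 : `|0 - ((u (z n) x).2 - (u t0 x).2)| < e by near: n.
    by rewrite sub0r normrN in b1; rewrite sub0r normrN in b2; rewrite b1 b2.
  have [] := @dominated_convergence _ _ R mu `[(- N)%R, N]%classic (measurable_itv _)
    (fun n x => (h (z n) x)%:E) (cst 0%E) (cst (C + C)%:E).
  - by move=> n; apply/measurable_EFinP; exact: measurable_funS (mh _ (z0 n)).
  - exact: measurable_cst.
  - apply: ae_imply cu => x /cvgh hx _; apply: cvg_EFin; first exact: nearW.
    exact: hx.
  - apply: (bounded_segment_integrable _ _ (measurable_cst (C + C)) (fun x => lexx `|C + C|)).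
  - by apply: aeW => x n _; rewrite lee_fin; exact: hC.
  move=> _ _; rewrite integral0 => /fine_cvgP[_]; exact.
have IG : \forall t \near within [set t | 0 <= t] (nbhs t0), (G t)%:E = I t.
  near=> t; have t1 : 0 <= t by near: t; exact: withinT.
  by rewrite /G max_l// fineK// If.
apply: cvg_trans (near_eq_cvg IG) _.
apply: cvg_within_filter.
by apply: cvg_EFin; [exact: nearW|].
Unshelve. all: by end_near. Qed.

End tame_functions.

(** * Mirror symmetry and uniqueness of Lax waves *)

Section reflection.
Context {R : realType} (p : R -> R) (hp : pressure p).
Implicit Types (u ub ur : R * R).

Lemma reflectK u : reflect (reflect u) = u.
Proof. by case: u => a b; rewrite /reflect/= opprK. Qed.

Lemma P_reflect u : P p (reflect u) = P p u.
Proof. by rewrite /P/= sqrrN. Qed.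

Lemma subsonic_reflect u : subsonic p (reflect u) <-> subsonic p u.
Proof. by rewrite /subsonic/= sqrrN. Qed.

Lemma lambda1_reflect u : lambda1 p (reflect u) = - lambda2 p u.
Proof. by rewrite /lambda1 /lambda2/=; ring. Qed.

Lemma L1_reflect u r : L1 p (reflect u) r = - L2m p u r.
Proof. by rewrite L2m_reflect opprK. Qed.

Lemma shock_speed_reflect ub ur :
  ((reflect ur).2 - (reflect ub).2) / ((reflect ur).1 - (reflect ub).1) =
  - ((ub.2 - ur.2) / (ub.1 - ur.1)).
Proof.
rewrite /= opprK addrC -(opprB ub.1 ur.1) invrN mulrN; congr (- (_ / _)).
Qed.

(** Reversing x and the momentum exchanges the families: [lambda2] becomes minus [lambda1], and the
    left and right states swap. *)
Lemma lax2_wave_reflect ur ub (w : R -> R * R) :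
  lax2_wave p ur ub w <-> lax1_wave p (reflect ub) (reflect ur) (fun xi => reflect (w (- xi))).
Proof.
rewrite /lax1_wave shock_speed_reflect !lambda1_reflect.
have neg (A : R -> Prop) : (forall xi, A xi) <-> (forall xi, A (- xi)).
  by split=> [h xi|h xi]; [exact: h|rewrite -[xi]opprK; exact: h].
have refl_eq (v v' : R * R) : reflect v = reflect v' <-> v = v'.
  by split=> [E|->//]; rewrite -[v]reflectK E reflectK.
split=> -[h1 h2 h3 h4]; split=> //=.
- by rewrite L1_reflect h2.
- move=> le1 xi; have [a1 a2 a3] := h3 le1 (- xi); split.
  + by move=> x1; rewrite a3//; move: x1; rewrite ltrNr.
  + move=> /andP[x1 x2]; have [|r [r1 wr lr]] := a2.
      by rewrite lerNr x2 lerNl x1.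
    exists r; split => //; first by rewrite wr L1_reflect.
    rewrite L1_reflect -[(r, _)]/(reflect (r, L2m p ub r)) lambda1_reflect lr opprK//.
  + by move=> x1; rewrite a1//; move: x1; rewrite ltrNl.
- move=> lt1 xi; have [a1 a2] := h4 lt1 (- xi); split => x1.
    by rewrite a2// ltrNr.
  by rewrite a1// ltrNl.
- by move: h2; rewrite L2m_reflect /= => <-; rewrite opprK.
- move=> le1 xi; have [a1 a2 a3] := h3 le1 (- xi); rewrite opprK in a1 a2 a3; split.
  + by move=> x1; apply/refl_eq/a3; rewrite ltrN2.
  + move=> /andP[x1 x2]; have [|r [r1 wr lr]] := a2; first by rewrite !lerN2 x2 x1.
    exists r; split => //.
      by apply/refl_eq; rewrite wr L1_reflect.
    move: lr; rewrite L1_reflect -[(r, - _)]/(reflect (r, L2m p ub r)) lambda1_reflect.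
    exact: oppr_inj.
  + by move=> x1; apply/refl_eq/a1; rewrite ltrN2.
- move=> lt1 xi; have [a1 a2] := h4 lt1 (- xi); rewrite opprK in a1 a2; split => x1.
    by apply/refl_eq/a2; rewrite ltrN2.
  by apply/refl_eq/a1; rewrite ltrN2.
Qed.

Variable (K : R -> R).
Hypothesis dK : forall r : R, 0 < r -> is_derive r 1 K (c p r / r).

Lemma lax1_wave_unique ub ul (w w' : R -> R * R) : 0 < ub.1 ->
  lax1_wave p ub ul w -> lax1_wave p ub ul w' -> exists s, forall xi, xi != s -> w xi = w' xi.
Proof.
move=> b0 [l0 _ h1 h2] [_ _ k1 k2]; have [le1|lt1] := leP ul.1 ub.1; last first.
  exists ((ul.2 - ub.2) / (ul.1 - ub.1)) => xi; rewrite neq_lt => /orP[x1|x1].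
    by rewrite (h2 lt1 xi).1// (k2 lt1 xi).1.
  by rewrite (h2 lt1 xi).2// (k2 lt1 xi).2.
(* In a rarefaction the waves agree everywhere, so the exceptional point is arbitrary; within the
   fan the density is determined because [lambda1] is strictly decreasing along the curve. *)
exists 0 => xi _; have [a1 a2 a3] := h1 le1 xi; have [c1 c2 c3] := k1 le1 xi.
have /orP[x1|x1] : (xi < lambda1 p ub) || (lambda1 p ub <= xi) by case: ltP.
  by rewrite a1// c1.
have /orP[x2|x2] : (lambda1 p ul < xi) || (xi <= lambda1 p ul) by case: ltP.
  by rewrite a3// c3.
have xx : lambda1 p ub <= xi <= lambda1 p ul by rewrite x1.
have [r [/andP[r1 _] -> er]] := a2 xx; have [s [/andP[s1 _] -> es]] := c2 xx.
suff -> : r = s by [].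
have dec x y : 0 < x -> x < y -> lambda1 p (y, L1 p ub y) < lambda1 p (x, L1 p ub x).
  move=> x0 xy; have y0 : 0 < y by exact: lt_trans xy.
  rewrite /lambda1/= !(L1_velocity hp dK)// ![_ * velocity _ _ _ _ / _]mulrAC.
  rewrite !mulfV ?gt_eqF// !mul1r ltr_leD//; first exact: (velocity_lt hp dK).
  by rewrite lerN2 (c_le hp)// ltW.
have r0 := lt_le_trans l0 r1; have s0 := lt_le_trans l0 s1.
have [rs|sr|//] := ltgtP r s.
  by have := dec _ _ r0 rs; rewrite er es ltxx.
by have := dec _ _ s0 sr; rewrite er es ltxx.
Qed.

Lemma lax2_wave_unique ur ub (w w' : R -> R * R) : 0 < ub.1 ->
  lax2_wave p ur ub w -> lax2_wave p ur ub w' -> exists s, forall xi, xi != s -> w xi = w' xi.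
Proof.
move=> b0 /lax2_wave_reflect h /lax2_wave_reflect h'.
have b0' : 0 < (reflect ub).1 by [].
have [s Hs] := lax1_wave_unique b0' h h'; exists (- s) => xi xs.
have := Hs (- xi); rewrite eqr_oppLR xs opprK => /(_ isT).
by move=> E; rewrite -[w xi]reflectK E reflectK.
Qed.

End reflection.

(** * The closure of the subsonic region and traces *)

Section closure.
Context {R : realType} (p : R -> R) (hp : pressure p).
Local Notation mu := (@lebesgue_measure R).
Implicit Types (u : R * R).

Lemma subsonic_closure u : 0 < u.1 -> subsonic p u -> closure (A0 p) u.
Proof.
move=> u0 us B /nbhs_ballP[e /= e0 eB].
have uc := (subsonicP hp u0).1 us; have c0 := c_gt0 hp u0.
have n0 := normr_ge0 u.2.
(* Multiplying the momentum by 1 - d makes a sonic state strictly subsonic. The bound 1/2 keeps the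
   factor positive, the other one keeps the displacement below [e]. *)
pose d : R := Num.min (2^-1) (e / (2 * (`|u.2| + 1))).
have d0 : 0 < d by rewrite lt_min invr_gt0 ltr0n/= divr_gt0// mulr_gt0//; lra.
have d1 : d <= 2^-1 by rewrite ge_min lexx.
have d2 : d * (2 * (`|u.2| + 1)) <= e.
  by rewrite -ler_pdivlMr ?ge_min ?lexx ?orbT// mulr_gt0//; lra.
exists (u.1, (1 - d) * u.2); split.
  apply/A0P; split=> //=; rewrite -mulrA -ltr_norml normrM gtr0_norm; last by lra.
  have uc' : `|u.2 / u.1| <= c p u.1 by rewrite ler_norml.
  apply: (@le_lt_trans _ _ ((1 - d) * c p u.1)); first by rewrite ler_wpM2l//; lra.
  by rewrite gtr_pMl//; lra.
apply: eB; split; rewrite /ball/=; first by rewrite subrr normr0.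
rewrite (_ : u.2 - (1 - d) * u.2 = d * u.2); last by ring.
rewrite normrM gtr0_norm// (lt_le_trans _ d2)// ltr_pM2l//; lra.
Qed.

Lemma closure_subsonic u : 0 < u.1 -> closure (A0 p) u -> subsonic p u.
Proof.
move=> u0 cu; rewrite /subsonic leNgt; apply/negP => gt.
pose g (v : R * R) : R := v.2 ^+ 2 - derive1 p v.1 * v.1 ^+ 2.
have gc : {for u, continuous g}.
  have c2 : {for u, continuous (fun v : R * R => v.2)} by exact: cvg_snd.
  have c1 : {for u, continuous (fun v : R * R => v.1)} by exact: cvg_fst.
  apply: cvgB.
    by apply: (@continuous_comp _ _ _ (fun v : R * R => v.2) (fun y => y ^+ 2)) => //; exact: exprn_continuous.
  apply: cvgM.
    apply: (@continuous_comp _ _ _ (fun v : R * R => v.1) (derive1 p)) => //.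
    exact: (derive1_pressure_continuous hp).
  by apply: (@continuous_comp _ _ _ (fun v : R * R => v.1) (fun y => y ^+ 2)) => //; exact: exprn_continuous.
have gp : 0 < g u by rewrite subr_gt0.
have N : \forall v \near u, 0 < g v by exact: (cvgr_gt _ gc _ gp).
have [v [/A0P[v0 /andP[v1 v2]] gv]] := cu _ N.
have : subsonic p v by apply/(subsonicP hp v0); rewrite !ltW.
by rewrite /subsonic leNgt -subr_gt0 gv.
Qed.

Lemma ae_itv (A : R -> Prop) (a b : R) : a < b -> {ae mu, forall x, A x} ->
  exists2 x, a < x < b & A x.
Proof.
move=> ab [N [mN N0 AN]]; apply: contrapT => H.
have sub : `]a, b[%classic `<=` N.
  move=> x; rewrite /= in_itv/= => xab; apply: AN => /= Ax; apply: H; by exists x.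
have : (mu `]a, b[%classic <= mu N)%E.
  by apply: le_measure; rewrite ?inE//; exact: measurable_itv.
by rewrite N0 lebesgue_measure_itv/= lte_fin ab -EFinB lee_fin subr_le0 leNgt ab.
Qed.

Lemma left_trace_closure (f : R -> R * R) u :
  f x @[x --> 0^'-] --> u -> {ae mu, forall x, closure (A0 p) (f x)} -> closure (A0 p) u.
Proof.
move=> fu ca; apply: contrapT => nc.
have : nbhs u (~` closure (A0 p)).
  by apply: open_nbhs_nbhs; split => //; apply: closed_openC; exact: closed_closure.
move=> /fu; rewrite /at_left /= => /nbhs_ballP[e /= e0 He].
have ne : - e < 0 by rewrite oppr_lt0.
have [x /andP[x1 x2] cx] := ae_itv ne ca.
apply: (He x) => //; rewrite /ball/= sub0r normrN ltr0_norm//; lra.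
Qed.

Lemma right_trace_closure (f : R -> R * R) u :
  f x @[x --> 0^'+] --> u -> {ae mu, forall x, closure (A0 p) (f x)} -> closure (A0 p) u.
Proof.
move=> fu ca; apply: contrapT => nc.
have : nbhs u (~` closure (A0 p)).
  by apply: open_nbhs_nbhs; split => //; apply: closed_openC; exact: closed_closure.
move=> /fu; rewrite /at_right /= => /nbhs_ballP[e /= e0 He].
have [x /andP[x1 x2] cx] := ae_itv e0 ca.
apply: (He x) => //; rewrite /ball/= sub0r normrN gtr0_norm//.
Qed.

End closure.

(** * Existence and uniqueness of the solution *)

Section pairs.
Context {R : realType}.

Lemma cvg_state (T : Type) (F : set_system T) (FF : Filter F) (f : T -> R * R) (u : R * R) :
  (f x).1 @[x --> F] --> u.1 -> (f x).2 @[x --> F] --> u.2 -> f x @[x --> F] --> u.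
Proof.
move=> /cvgrPdist_lt h1 /cvgrPdist_lt h2 B /nbhs_ballP[e /= e0 eB].
near=> x; apply: eB; split; rewrite /ball/=; near: x; [exact: h1|exact: h2].
Unshelve. all: by end_near. Qed.

Lemma monotoneZ (f : R -> R) (k : R) : monotone f -> monotone (fun x => f (k * x)).
Proof.
move=> mf; have [k0|k0] := leP 0 k.
  by case: mf => mf; [left|right] => x y xy; apply: mf; rewrite ler_wpM2l.
by case: mf => mf; [right|left] => x y xy; apply: mf; rewrite ler_wnM2l// ltW.
Qed.

Lemma monotoneN (f : R -> R) : monotone f -> monotone (fun x => - f x).
Proof. by case=> mf; [right|left] => x y xy; rewrite lerN2 mf. Qed.

Lemma monotone_step (k l : R) : monotone (fun x : R => if x < 0 then k else l).
Proof.
have [kl|lk] := leP k l; [left|right] => x y xy.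
  have /orP[y0|y0] : (y < 0) || (0 <= y) by case: ltP.
    by rewrite y0 (le_lt_trans xy y0).
  by rewrite (ltNge y) y0/=; case: ifP.
have /orP[y0|y0] : (y < 0) || (0 <= y) by case: ltP.
  by rewrite y0 (le_lt_trans xy y0).
by rewrite (ltNge y) y0/=; case: ifP => // _; exact: ltW.
Qed.

Lemma step_le (k l x : R) : `|if x < 0 then k else l| <= `|k| + `|l|.
Proof. by case: ifP => _; rewrite ?lerDl ?lerDr. Qed.

Lemma step_tame (k l : R) : tame (fun x : R => if x < 0 then k else l).
Proof. exact: monotone_tame (monotone_step k l) (step_le k l). Qed.

(** The two jumps at x = 0 are unrelated: the first is carried by a wave of speed 0, which has no
    flux, the second by [weak_equation_flux_jump]. *)
Lemma weak_equation_step (k1 k2 l1 l2 : R) :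
  weak_equation (fun _ x => if x < 0 then k1 else k2) (fun _ x => if x < 0 then l1 else l2).
Proof.
have [mk _ _] := step_tame (k1 - k2) 0.
apply: (eq_weak_equation _ (weak_equationD (weak_equation_cst k2 l2) (weak_equationD
  (weak_wave 0 mk (step_le _ _)) (weak_equation_flux_jump (l1 - l2))))) => t x _ _.
by rewrite mul0r subr0 mul0r; case: ifP => _; split; ring.
Qed.

Lemma monotone_between (f : R -> R) (L b c xi : R) : 0 <= L -> monotone f ->
  (forall x, 0 <= x -> f x = c) -> (forall x, x <= - L -> f x = b) -> `|f xi| <= `|b| + `|c|.
Proof.
move=> L0 mf fc fb; have [x0|x0] := leP 0 xi; first by rewrite fc// lerDr.
have [x1|x1] := leP xi (- L); first by rewrite fb// lerDl.
have cE := fc 0 (lexx _); have bE := fb (- L) (lexx _).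
have [b1 b2 c1 c2] := (And4 (ler_norm b) (ler_norm (- b)) (ler_norm c) (ler_norm (- c))).
rewrite normrN in b2; rewrite normrN in c2.
have b0 := normr_ge0 b; have c0 := normr_ge0 c.
rewrite ler_norml; case: mf => mf.
  have := mf _ _ (ltW x0); have := mf _ _ (ltW x1); rewrite cE bE => h1 h2.
  by apply/andP; split; lra.
have := mf _ _ (ltW x0); have := mf _ _ (ltW x1); rewrite cE bE => h1 h2.
by apply/andP; split; lra.
Qed.

End pairs.

(** * Gluing two waves at the junction *)

Section two_waves.
Context {R : realType} (p : R -> R) (hp : pressure p).
Local Notation mu := (@lebesgue_measure R).
Variables (ubl ubr ul vr : R * R) (w1 w2 : R -> R * R) (s1 s2 M1 M2 : R).
Hypotheses (hl : A0 p ubl) (hr : A0 p ubr).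
Hypotheses (s10 : s1 < 0) (M10 : 0 < M1) (adm1 : admissible_wave p ubl ul w1 s1 M1).
Hypotheses (s20 : s2 < 0) (M20 : 0 < M2) (adm2 : admissible_wave p (reflect ubr) vr w2 s2 M2).

(* The wave on [x > 0] is the mirror image of a wave of the first family. *)
Definition glue (t x : R) : R * R :=
  if x < 0 then w1 (x / t) else reflect (w2 (- x / t)).

Definition two_waves (t x : R) : R * R :=
  if t <= 0 then riemann_datum ubl ubr x else glue t x.

Lemma two_wavesE (t x : R) : 0 < t -> two_waves t x = glue t x.
Proof. by move=> t0; rewrite /two_waves leNgt t0. Qed.

(** On each side of the junction one of the two waves sits at its constant end state, which the last
    term subtracts. The identity thus holds for nonlinear [f] such as [P p], and the weak equations
    of the waves simply add up. *)
Lemma glue_superposition (f : R * R -> R) (t x : R) : 0 < t ->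
  f (glue t x) = f (w1 (x / t)) + f (reflect (w2 (- x / t))) +
    (if x < 0 then - f (reflect vr) else - f ul).
Proof.
move=> t0; have [_ [h1 _] _ _ _] := adm1; have [_ [h2 _] _ _ _] := adm2.
rewrite /glue; have /orP[x0|x0] : (x < 0) || (0 <= x) by case: ltP.
  by rewrite x0 h2 ?addrK//; apply: divr_ge0; [rewrite oppr_ge0 ltW|exact: ltW].
rewrite ltNge x0/= h1; last by apply: divr_ge0 => //; exact: ltW.
by rewrite addrAC subrr add0r.
Qed.

Lemma glue_subsonic (t x : R) : 0 < (glue t x).1 /\ subsonic p (glue t x).
Proof.
have [_ _ h1 _ _] := adm1; have [_ _ h2 _ _] := adm2.
rewrite /glue; case: ifP => _; first exact: h1.
by have [a b] := h2 (- x / t); split => //; apply/subsonic_reflect.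
Qed.

Lemma glue_weak :
  weak_equation (fun t x => (glue t x).1) (fun t x => (glue t x).2) /\
  weak_equation (fun t x => (glue t x).2) (fun t x => P p (glue t x)).
Proof.
have [_ _ _ _ h1] := adm1; have [_ _ _ _ h2] := adm2.
have [m1 q1] := h1 1 (mulr1 1).
have [m2 q2] := h2 (-1) (etrans (mulrNN 1 1) (mulr1 1)).
have D (k : R * R -> R) := weak_equation_step (- k (reflect vr)) (- k ul).
split.
  apply: (eq_weak_equation _ (weak_equationD (weak_equationD m1 m2)
    (weak_equation_step (- (reflect vr).1) (- ul.1) (- (reflect vr).2) (- ul.2)))) => t x t0 _.
  rewrite (glue_superposition (fun u => u.1))// (glue_superposition (fun u => u.2))//.
  by rewrite /= !mulN1r !mul1r.
apply: (eq_weak_equation _ (weak_equationD (weak_equationD q1 (weak_equationZ (-1) q2))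
  (weak_equation_step (- (reflect vr).2) (- ul.2) (- P p (reflect vr)) (- P p ul)))) => t x t0 _.
rewrite (glue_superposition (fun u => u.2))// (glue_superposition (P p))// !P_reflect.
by rewrite /= !mulN1r !mul1r [- - P p _]opprK.
Qed.

Lemma two_waves_weak :
  weak_equation (fun t x => (two_waves t x).1) (fun t x => (two_waves t x).2) /\
  weak_equation (fun t x => (two_waves t x).2) (fun t x => P p (two_waves t x)).
Proof.
have [m q] := glue_weak.
by split; [apply: (eq_weak_equation _ m)|apply: (eq_weak_equation _ q)] => t x t0 _;
  rewrite two_wavesE.
Qed.

Let bound : R := (`|ubl.1| + `|ul.1|) + (`|ubl.2| + `|ul.2|)
  + ((`|ubr.1| + `|vr.1|) + (`|ubr.2| + `|vr.2|)).

Lemma wave1_le xi : `|(w1 xi).1| <= `|ubl.1| + `|ul.1| /\ `|(w1 xi).2| <= `|ubl.2| + `|ul.2|.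
Proof.
have [_ [h1 h1'] _ [_ _ m1 m2] _] := adm1; split.
  by apply: (monotone_between _ (ltW M10) m1) => x x0; [rewrite h1|rewrite h1'].
by apply: (monotone_between _ (ltW M10) m2) => x x0; [rewrite h1|rewrite h1'].
Qed.

Lemma wave2_le xi : `|(w2 xi).1| <= `|ubr.1| + `|vr.1| /\ `|(w2 xi).2| <= `|ubr.2| + `|vr.2|.
Proof.
have [_ [h1 h1'] _ [_ _ m1 m2] _] := adm2; split.
  by apply: (monotone_between _ (ltW M20) m1) => x x0; [rewrite h1|rewrite h1'].
rewrite -[`|ubr.2|]normrN.
by apply: (monotone_between _ (ltW M20) m2) => x x0; [rewrite h1|rewrite h1'].
Qed.

Lemma two_waves_bounded t x : `|(two_waves t x).1| <= bound /\ `|(two_waves t x).2| <= bound.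
Proof.
have a1 := normr_ge0 ubl.1; have a2 := normr_ge0 ubl.2.
have a3 := normr_ge0 ubr.1; have a4 := normr_ge0 ubr.2.
have a5 := normr_ge0 ul.1; have a6 := normr_ge0 ul.2.
have a7 := normr_ge0 vr.1; have a8 := normr_ge0 vr.2.
rewrite /two_waves /riemann_datum /glue /bound; case: ifP => _; case: ifP => _.
- by split; lra.
- by split; lra.
- have [h1 h2] := wave1_le (x / t); split; [apply: (le_trans h1)|apply: (le_trans h2)]; lra.
- have [h1 h2] := wave2_le (- x / t); rewrite /= normrN.
  by split; [apply: (le_trans h1)|apply: (le_trans h2)]; lra.
Qed.

Lemma two_waves_tame t : 0 <= t ->
  tame (fun x => (two_waves t x).1) /\ tame (fun x => (two_waves t x).2).
Proof.
rewrite le_eqVlt => /orP[/eqP <-|t0].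
  have st (f : R * R -> R) : tame (fun x => f (two_waves 0 x)).
    rewrite (_ : (fun x => _) = fun x => if x < 0 then f ubl else f ubr); first exact: step_tame.
    by apply/funext => x; rewrite /two_waves lexx /riemann_datum; case: ifP.
  by split; [exact: (st fst)|exact: (st snd)].
have [_ _ _ [_ _ m1 n1] _] := adm1; have [_ _ _ [_ _ m2 n2] _] := adm2.
have sc (g : R -> R) (k B : R) : monotone g -> (forall x, `|g x| <= B) -> tame (fun x => g (k * x)).
  by move=> mg gB; apply: (@monotone_tame _ _ B); [exact: monotoneZ|move=> x; exact: gB].
have e1 x : x / t = t^-1 * x by rewrite mulrC.
have e2 x : - x / t = (- t^-1) * x by rewrite mulNr mulrC mulNr.
split.
  rewrite (_ : (fun x => _) = fun x => (w1 (t^-1 * x)).1 + (w2 ((- t^-1) * x)).1 +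
      (if x < 0 then - (reflect vr).1 else - ul.1)); last first.
    by apply/funext => x; rewrite two_wavesE// (glue_superposition fst)// e1 e2.
  apply: tameD; last exact: step_tame.
  apply: tameD; first exact: (sc _ _ _ m1 (fun x => (wave1_le x).1)).
  exact: (sc _ _ _ m2 (fun x => (wave2_le x).1)).
rewrite (_ : (fun x => _) = fun x => (w1 (t^-1 * x)).2 + (- (w2 ((- t^-1) * x)).2) +
    (if x < 0 then - (reflect vr).2 else - ul.2)); last first.
  by apply/funext => x; rewrite two_wavesE// (glue_superposition snd)// e1 e2.
apply: tameD; last exact: step_tame.
apply: tameD; first exact: (sc _ _ _ n1 (fun x => (wave1_le x).2)).
apply: (sc (fun xi => - (w2 xi).2)); first exact: monotoneN.
by move=> x; rewrite normrN; exact: (wave2_le x).2.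
Qed.

Lemma selfsimilar_cvg (g : R -> R) (x t0 : R) : 0 < t0 -> {for x / t0, continuous g} ->
  g (x / t) @[t --> t0] --> g (x / t0).
Proof.
move=> t00 gc; apply: (@cvg_comp _ _ _ (fun t => x / t) g _ (nbhs (x / t0)) _ _ gc).
by apply: cvgM; [exact: cvg_cst|apply: cvgV => //; rewrite gt_eqF].
Qed.

(** At time [t0] the points left out are the junction and the two possible jumps, a null set in
    x. *)
Lemma two_waves_cvg (f : R * R -> R) (t0 x : R) : 0 <= t0 ->
  (forall xi, xi != s1 -> {for xi, continuous (fun xi => f (w1 xi))}) ->
  (forall xi, xi != s2 -> {for xi, continuous (fun xi => f (reflect (w2 xi)))}) ->
  x != 0 -> x != s1 * t0 -> x != - s2 * t0 ->
  f (two_waves t x) @[t --> within [set t | 0 <= t] (nbhs t0)] --> f (two_waves t0 x).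
Proof.
move=> t00 c1 c2 x0 x1 x2.
have [_ [_ h1] _ _ _] := adm1; have [_ [_ h2] _ _ _] := adm2.
move: t00; rewrite le_eqVlt => /orP[/eqP t0E|t0p].
  (* Speeds are bounded by [M], so for t < |x| / M no wave has reached [x] and the initial value is
     still there. *)
  rewrite -t0E; pose M := M1 + M2.
  have m1 : M1 <= M by rewrite /M lerDl ltW.
  have m2 : M2 <= M by rewrite /M lerDr ltW.
  have Mp : 0 < M by rewrite addr_gt0.
  have dx : 0 < `|x| / M by rewrite divr_gt0// normr_gt0.
  have eq : \forall t \near within [set t | 0 <= t] (nbhs (0 : R)),
      f (two_waves 0 x) = f (two_waves t x).
    rewrite near_withinE; near=> t => /= tt.
    have tM : t < `|x| / M by near: t; exact: lt_nbhsl.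
    rewrite /two_waves lexx; case: ifPn => //; rewrite -ltNge => tp.
    have big : M <= `|x| / t by rewrite ler_pdivlMr// mulrC -ler_pdivlMr// ltW.
    rewrite /riemann_datum /glue; have /orP[xx|xx] : (x < 0) || (0 <= x) by case: ltP.
      rewrite xx h1// lerNr (le_trans m1)// (le_trans big)// ltr0_norm// mulNr//.
    rewrite ltNge xx/= h2 ?reflectK//.
    by rewrite mulNr lerN2 (le_trans m2)// (le_trans big)// ger0_norm.
  by apply: cvg_trans (near_eq_cvg eq) _; exact: cvg_cst.
apply: cvg_within_filter; rewrite two_wavesE//.
have pos : \forall t \near t0, 0 < t by exact: lt_nbhsr.
have eq : \forall t \near t0, f (glue t x) = f (two_waves t x).
  by apply: filterS pos => t tp; rewrite two_wavesE.
apply: cvg_trans (near_eq_cvg eq) _; rewrite /glue.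
have /orP[xx|xx] : (x < 0) || (0 <= x) by case: ltP.
  rewrite xx; apply: (selfsimilar_cvg t0p (g := fun xi => f (w1 xi))); apply: c1.
  by apply: contra x1 => /eqP <-; rewrite divfK// gt_eqF.
rewrite ltNge xx/=.
apply: (selfsimilar_cvg t0p (g := fun xi => f (reflect (w2 xi)))); apply: c2.
by apply: contra x2 => /eqP <-; rewrite mulNr divfK ?opprK// gt_eqF.
Unshelve. all: by end_near. Qed.

Lemma two_waves_C0_L1loc : C0_L1loc two_waves.
Proof.
split=> [t t0|t t0|N t0 t00].
- by have [h1 h2] := two_waves_tame t0; split; exact: tame_locally_integrable.
- apply: aeW => x; rewrite /two_waves; case: ifP => _; last by have [] := glue_subsonic t x.
  by have [[lp _ _] [rp _ _]] := (hl, hr); rewrite /riemann_datum; case: ifP.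
- apply: (@L1_segment_cvg _ two_waves bound N t0 t00).
  + by move=> t t1; have [[m1 _ _] [m2 _ _]] := two_waves_tame t1.
  + by move=> t x _; exact: two_waves_bounded.
  have [_ _ _ [c1 d1 _ _] _] := adm1; have [_ _ _ [c2 d2 _ _] _] := adm2.
  apply: (ae_imply _ (ae_and (ae_neq 0) (ae_and (ae_neq (s1 * t0)) (ae_neq (- s2 * t0))))).
  move=> x [n0 [n1 n2]]; split.
    exact: (two_waves_cvg (f := fst) t00 c1 c2 n0 n1 n2).
  have d2' xi : xi != s2 -> {for xi, continuous (fun xi => (reflect (w2 xi)).2)}.
    by move=> xs; apply: cvgN; exact: d2.
  exact: (two_waves_cvg (f := snd) t00 d1 d2' n0 n1 n2).
Qed.

Lemma two_waves_finite_TV t : 0 <= t ->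
  finite_TV (fun x => (two_waves t x).1) /\ finite_TV (fun x => (two_waves t x).2).
Proof. by move=> t0; have [[_ _ h1] [_ _ h2]] := two_waves_tame t0. Qed.

Lemma wave_cvg0 (w : R -> R * R) (v : R * R) (s k : R) : s < 0 ->
  (forall xi, xi != s -> {for xi, continuous (fun xi => (w xi).1)}) ->
  (forall xi, xi != s -> {for xi, continuous (fun xi => (w xi).2)}) ->
  w 0 = v -> w (k * x) @[x --> (0 : R)] --> v.
Proof.
move=> s0 c1 c2 <-; have ns : 0 != s by rewrite gt_eqF.
have kc : k * x @[x --> (0 : R)] --> (0 : R).
  by rewrite -[X in _ --> X](mulr0 k); apply: cvgM; [exact: cvg_cst|exact: cvg_id].
apply: cvg_state.
  exact: (@cvg_comp _ _ _ (fun x : R => k * x) (fun xi => (w xi).1) _ _ _ kc (c1 _ ns)).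
exact: (@cvg_comp _ _ _ (fun x : R => k * x) (fun xi => (w xi).2) _ _ _ kc (c2 _ ns)).
Qed.

Lemma reflect_cvg (T : Type) (F : set_system T) (FF : Filter F) (f : T -> R * R) (u : R * R) :
  f x @[x --> F] --> u -> reflect (f x) @[x --> F] --> reflect u.
Proof.
move=> fu; apply: cvg_state => /=.
  by apply: cvg_comp fu _; exact: cvg_fst.
by apply: cvgN; apply: cvg_comp fu _; exact: cvg_snd.
Qed.

Lemma two_waves_left t : 0 < t -> two_waves t x @[x --> 0^'-] --> ul.
Proof.
move=> t0; have [_ [h1 _] _ [c1 d1 _ _] _] := adm1.
have h : w1 (t^-1 * x) @[x --> 0^'-] --> ul.
  by apply: cvg_at_left_filter; apply: (wave_cvg0 _ s10 c1 d1); exact: h1.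
apply: cvg_trans h; apply: near_eq_cvg.
by near=> x; rewrite two_wavesE// /glue ifT 1?mulrC//; near: x; exact: nbhs_left_lt.
Unshelve. all: by end_near. Qed.

Lemma two_waves_right t : 0 < t -> two_waves t x @[x --> 0^'+] --> reflect vr.
Proof.
move=> t0; have [_ [h1 _] _ [c1 d1 _ _] _] := adm2.
have h : reflect (w2 ((- t^-1) * x)) @[x --> 0^'+] --> reflect vr.
  apply: reflect_cvg; apply: cvg_at_right_filter.
  by apply: (wave_cvg0 _ s20 c1 d1); exact: h1.
apply: cvg_trans h; apply: near_eq_cvg.
near=> x; rewrite two_wavesE// /glue ifF.
  by rewrite mulNr mulrC !mulNr.
apply/negbTE; rewrite -leNgt ltW//; near: x; exact: nbhs_right_gt.
Unshelve. all: by end_near. Qed.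

Lemma two_waves_made : made_of_lax_waves p ubl ubr two_waves.
Proof.
have [lax1 _ _ _ _] := adm1; have [lax2 _ _ _ _] := adm2.
exists ul, (reflect vr), w1, (fun xi => reflect (w2 (- xi))); split => //.
  apply/lax2_wave_reflect; rewrite reflectK.
  rewrite (_ : (fun xi => _) = w2)//.
  by apply/funext => xi; rewrite reflectK opprK.
move=> t t0; split; [exact: two_waves_left|exact: two_waves_right| |] => x x0.
  by rewrite two_wavesE// /glue x0.
by rewrite two_wavesE// /glue ltNge ltW//= mulNr.
Qed.

Lemma two_waves_attains : attains_values_in_A0 p two_waves.
Proof.
move=> t t0; apply: aeW => x; rewrite /two_waves; case: ifP => _.
  by apply: subset_closure; rewrite /riemann_datum; case: ifP.
by have [g0 gs] := glue_subsonic t x; exact: (subsonic_closure hp).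
Qed.

Lemma two_waves_solution (al ar : R) : Phi_S p al ul ar (reflect vr) = (0, 0) ->
  S_solution p al ar ubl ubr two_waves.
Proof.
move=> Phi0; split; last exact: two_waves_made.
split; [exact: two_waves_C0_L1loc| |exact: two_waves_weak| |].
- by apply: aeW => t t0; exact: two_waves_finite_TV.
- by apply: aeW => x; rewrite /two_waves lexx.
- apply: (ae_imply _ (ae_neq 0)) => t tn t0; exists ul, (reflect vr).
  have tp : 0 < t by rewrite lt_neqAle eq_sym tn.
  by split; [exact: two_waves_left|exact: two_waves_right|].
Qed.

End two_waves.

(** * From junction densities to solutions and back *)

Section solutions.
Context {R : realType} (p : R -> R) (hp : pressure p) (hphi : phi_well_defined p).
Local Notation mu := (@lebesgue_measure R).
Variables (K H : R -> R).
Hypothesis dK : forall r : R, 0 < r -> is_derive r 1 K (c p r / r).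
Hypothesis dH : forall r : R, 0 < r -> is_derive r 1 H (derive1 p r / r).
Variables (al ar : R) (ubl ubr : R * R).
Hypotheses (al0 : 0 < al) (alr : al < ar) (hl : A0 p ubl) (hr : A0 p ubr).

Let solution u := S_solution p al ar ubl ubr u /\ attains_values_in_A0 p u.

Lemma solution_exists r : junction_density p al ar ubl ubr r -> exists u, solution u.
Proof.
move=> jr; have [rr E] := jr; have ar0 : 0 < ar by exact: lt_trans alr.
have [_ _ _ sub] := transmittedP hp hphi dK dH al0 alr hl rr.
have /andP[r1 _] := rr.
have r0 : 0 < r by apply: lt_le_trans r1; exact: (hat_gt0 hp hphi dK hl).
have t0 := transmitted_gt0 hp hphi dK dH al0 alr hl rr.
have [w1 [s1 [M1 [s10 M10 adm1]]]] := admissible_wave_exists hp hphi dK hl rr.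
have hr' := A0_reflect hr; set t := transmitted p al ar ubl r in E sub t0 *.
have LE : al * L1 p ubl r = - (ar * L1 p (reflect ubr) t) by rewrite E L2m_reflect mulrN.
(* The flux balance carries the subsonic bound of the transmitted state over to the mirrored right
   curve, which places its density between the two sonic ones of that curve. *)
have ts : subsonic p (t, L1 p (reflect ubr) t).
  rewrite /subsonic/= -(ler_pM2l (exprn_gt0 2 ar0)) -exprMn mulrA ltW//.
  by move: sub; rewrite LE sqrrN.
have tt := (lax_subsonic hp hphi dK hr' t0).1 ts.
have [w2 [s2 [M2 [s20 M20 adm2]]]] := admissible_wave_exists hp hphi dK hr' tt.
exists (two_waves ubl ubr w1 w2); split.
  apply: (two_waves_solution hl hr s10 M10 adm1 s20 M20 adm2).
  apply/(Phi_S_eq0 hp dH al0 alr) => //=.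
  - exact: ((lax_subsonic hp hphi dK hl r0).2 rr).
  - exact/subsonic_reflect.
  - by rewrite LE mulrN.
exact: (two_waves_attains hp hl hr adm1 adm2).
Qed.

Lemma solutionP v : solution v -> exists ul ur (wl wr : R -> R * R),
  [/\ lax1_wave p ubl ul wl, lax2_wave p ur ubr wr,
      junction_density p al ar ubl ubr ul.1,
      ur.1 = transmitted p al ar ubl ul.1 &
      forall t x : R, 0 < t -> x != 0 -> v t x = if x < 0 then wl (x / t) else wr (x / t)].
Proof.
move=> [[[_ _ _ _ tr] [ul [ur [wl [wr [lax1 lax2 tv]]]]]] att].
exists ul, ur, wl, wr.
have [l0 lE _ _] := lax1; have [r0 rE _ _] := lax2.
(* One time in ]0, 1[ is enough: the traces of self-similar waves are the same at every positive
   time, and uniqueness of limits identifies them with those in the junction condition. *)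
have [t /andP[t0 _] /(_ (ltW t0)) [ul' [ur' [lim1 lim2 Phi0]]]] := ae_itv ltr01 tr.
have [tl tr' _ _] := tv t t0.
have ulE : ul' = ul by exact: (cvg_unique (@norm_hausdorff R _) lim1 tl).
have urE : ur' = ur by exact: (cvg_unique (@norm_hausdorff R _) lim2 tr').
rewrite {}ulE {}urE in lim1 lim2 Phi0.
have uls : subsonic p ul.
  by apply: (closure_subsonic hp l0); exact: (left_trace_closure lim1 (att t (ltW t0))).
have urs : subsonic p ur.
  by apply: (closure_subsonic hp r0); exact: (right_trace_closure lim2 (att t (ltW t0))).
have [mom dens] := (Phi_S_eq0 hp dH al0 alr l0 uls r0 urs).1 Phi0.
have ulE : ul = (ul.1, L1 p ubl ul.1) by rewrite -lE; case: (ul).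
have rt : ur.1 = transmitted p al ar ubl ul.1 by rewrite /transmitted -ulE.
split => //.
  split; last by rewrite -lE -rt -rE.
  by apply/(lax_subsonic hp hphi dK hl l0); rewrite -ulE.
move=> t' x t'0; have [_ _ h1 h2] := tv t' t'0.
by rewrite neq_lt => /orP[x0|x0]; [rewrite x0 h1|rewrite ltNge ltW//= h2].
Qed.

Lemma solution_unique u v : solution u -> solution v ->
  forall t : R, 0 <= t -> {ae mu, forall x, v t x = u t x}.
Proof.
move=> su sv t; rewrite le_eqVlt => /orP[/eqP <-|t0].
  have [[[_ _ _ u0 _] _] _] := su; have [[[_ _ _ v0 _] _] _] := sv.
  by apply: (ae_imply _ (ae_and u0 v0)) => x [-> ->].
have [ul [ur [wl [wr [l1 l2 j d uE]]]]] := solutionP su.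
have [ul' [ur' [wl' [wr' [l1' l2' j' d' vE]]]]] := solutionP sv.
have rE := junction_density_unique hp hphi dK dH al0 alr hl hr j j'.
have [_ q1 _ _] := l1; have [_ q1' _ _] := l1'.
have [_ q2 _ _] := l2; have [_ q2' _ _] := l2'.
have ulE : ul' = ul.
  by move: q1 q1'; rewrite -rE => <-; case: (ul) (ul') rE => ? ? [? ?] /= -> ->.
have urE : ur' = ur.
  have e : ur'.1 = ur.1 by rewrite d' d rE.
  by move: q2 q2'; rewrite e => <-; case: (ur) (ur') e => ? ? [? ?] /= -> ->.
rewrite {}ulE {}urE in l1' l2'.
have [ubl0 _ _] := hl; have [ubr0 _ _] := hr.
have [s Es] := lax1_wave_unique hp dK ubl0 l1 l1'.
have [s' Es'] := lax2_wave_unique hp dK ubr0 l2 l2'.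
(* At a fixed time each wave is undetermined at one point at most, the image of its exceptional
   similarity variable. *)
apply: (ae_imply _ (ae_and (ae_neq 0) (ae_and (ae_neq (s * t)) (ae_neq (s' * t))))).
move=> x [x0 [x1 x2]]; have n (y : R) : x != y * t -> x / t != y.
  by apply: contra => /eqP <-; rewrite divfK// gt_eqF.
by rewrite uE// vE// Es ?n// Es' ?n.
Qed.

End solutions.
Theorem theorem2p12 (R : realType) (p : R -> R)
  (hp : pressure p) (hphi : phi_well_defined p)
  (al ar : R) (hal : 0 < al) (har : al < ar)
  (ubl ubr : R * R) (hl : A0 p ubl) (hr : A0 p ubr) :
  let hat := phi_hat_l p ubl in
  let check := phi_check_l p ubl in
  let l' := profile p al (hat, L1 p ubl hat) ar in
  let l'' := profile p al (check, L1 p ubl check) ar in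
  exists_unique_solution
    (fun u => S_solution p al ar ubl ubr u /\ attains_values_in_A0 p u)
  <->
  (al * L1 p ubl hat >= ar * L2m p ubr l' /\
   al * L1 p ubl check <= ar * L2m p ubr l'').
Proof.
move=> hat check l' l''.
have [K dK] := primitive_pos (c_div_continuous hp).
have [H dH] : exists H : R -> R, forall r : R, 0 < r -> is_derive r 1 H (derive1 p r / r).
  apply: primitive_pos => r r0; apply: cvgM; first exact: (derive1_pressure_continuous hp).
  by apply: cvgV => //; rewrite gt_eqF.
rewrite -(junction_criterion hp hphi dK dH hal har hl hr); split.
  move=> [u su _]; have [ul [_ [_ [_ [_ _ j _ _]]]]] :=
    solutionP hp hphi dK dH hal har hl su.
  by exists ul.1.
move=> [r jr]; have [u su] := solution_exists hp hphi dK dH hal har hl hr jr.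
by exists u => // v sv; exact: (solution_unique hp hphi dK dH hal har hl hr su sv).
Qed.
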